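(* Let $d\ge 1$ and let $\omega:(0,1]\to(0,+\infty)$ be an increasing function. Put $I(x)=\int_x^1\frac{\omega^2(t)}{t}\,dt$ for $0<x<1$, and $I(0+)=\lim_{x\to 0+}I(x)\in[0,+\infty]$. (i) Suppose $I(0+)<\infty$. If $f\in\mathcal{B}^{\omega}(B_d)$, then $f$ has a radial limit at $\sigma_d$-almost every point $\zeta\in\partial B_d$. (ii) Suppose $I(0+)=\infty$ and suppose that $\omega(t)/t^{1-\varepsilon}$ is a decreasing function of $t\in(0,1]$ for some $\varepsilon>0$. Then the space $\mathcal{B}^{\omega}(B_d)$ contains a function which, for $\sigma_d$-almost every $\zeta\in\partial B_d$, has no radial limit at $\zeta$.
   Context: $B_d$ is the open unit ball of $\mathbb{C}^d$, $\partial B_d$ is the unit sphere, $\sigma_d$ is the normalized Lebesgue measure on $\partial B_d$, and $H(B_d)$ is the space of holomorphic functions on $B_d$. For $f\in H(B_d)$ the radial derivative is $\mathcal{R}f(z)=\sum_{j=1}^d z_j\frac{\partial f}{\partial z_j}(z)$. The weighted Bloch space $\mathcal{B}^{\omega}(B_d)$ consists of those $f\in H(B_d)$ for which $$\|f\|_{\mathcal{B}^{\omega}(B_d)}=|f(0)|+\sup_{z\in B_d}\frac{|\mathcal{R}f(z)|(1-|z|)}{\omega(1-|z|)}<\infty.$$ A function $f\in H(B_d)$ has a radial limit at $\zeta\in\partial B_d$ if there exists a finite limit $\lim_{r\to1-}f(r\zeta)$. ''Increasing'' and ''decreasing'' are understood in the non-strict sense (e.g. $\omega\equiv1$ is allowed).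 *)

(* Defs.v *)
From HB Require Import structures.
From mathcomp Require Import all_boot all_order all_algebra.
From mathcomp Require Import complex.
From mathcomp Require Import all_classical all_reals all_analysis.
From mathcomp Require Import measurable_realfun lra.
Set Implicit Arguments.
Unset Strict Implicit.
Unset Printing Implicit Defensive.
Import Order.TTheory GRing.Theory Num.Theory.
Import numFieldNormedType.Exports.
Import ComplexField.Normc.
Local Open Scope classical_set_scope.
Local Open Scope ring_scope.
Local Open Scope complex_scope.

#[non_forgetful_inheritance]
HB.instance Definition _ (R : realType) := PseudoPointedMetric.copy R[i] R[i]^o.
#[non_forgetful_inheritance]
HB.instance Definition _ (R : realType) := NormedModule.copy R[i] R[i]^o.

Section Ball.
Context {R : realType} {d : nat}.
Implicit Types (z : 'rV[R[i]]_d) (f : 'rV[R[i]]_d -> R[i]) (w : R -> R).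

(* The library norm on 'rV[R[i]]_d is the sup norm; it induces the same
   topology, but not the same unit ball. *)
Definition enorm z : R := Num.sqrt (\sum_(j < d) normc (z 0 j) ^+ 2).

Definition unit_ball : set 'rV[R[i]]_d := [set z | enorm z < 1].

Definition unit_sphere : set 'rV[R[i]]_d := [set z | enorm z = 1].

(* Differentiability is over the scalar field R[i], hence C-linear; only the
   values of f on the ball matter. *)
Definition holomorphic_ball f := forall z, unit_ball z -> differentiable f z.

Definition radial_derivative f z : R[i] :=
  \sum_(j < d) z 0 j * 'D_(delta_mx 0 j) f z.

Definition bloch_norm w f : \bar R :=
  ((normc (f 0))%:E +
   ereal_sup [set (normc (radial_derivative f z) * (1 - enorm z)
                   / w (1 - enorm z))%:E | z in unit_ball])%E.

Definition bloch_space w : set ('rV[R[i]]_d -> R[i]) :=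
  [set f | holomorphic_ball f /\ (bloch_norm w f < +oo)%E].

Definition has_radial_limit f z := cvg (f (r%:C *: z) @[r --> (1 : R)^'-]).

End Ball.

Section ImageMeasure.
Context d1 d2 (T1 : measurableType d1) (T2 : measurableType d2) (R : realType).
Variables (mu : {measure set T1 -> \bar R}) (g : {mfun T1 >-> T2}).

Definition image_measure : set T2 -> \bar R := pushforward mu g.

Let image_measure0 : image_measure set0 = 0%E.
Proof. exact: measure0. Qed.

Let image_measure_ge0 A : (0 <= image_measure A)%E.
Proof. exact: measure_ge0. Qed.

Let image_measure_sigma_additive : semi_sigma_additive image_measure.
Proof. exact: measure_semi_sigma_additive. Qed.

HB.instance Definition _ := isMeasure.Build _ _ _ image_measure
  image_measure0 image_measure_ge0 image_measure_sigma_additive.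

End ImageMeasure.

Section LebesgueTuple.
Context {R : realType}.
Local Notation mR := (measurableTypeR R).

Definition tuple_snoc n (p : n.-tuple mR * mR) : n.+1.-tuple mR :=
  [tuple of p.2 :: p.1].

Lemma measurable_tuple_snoc n : measurable_fun setT (@tuple_snoc n).
Proof. exact: (measurable_cons measurable_snd measurable_fst). Qed.

HB.instance Definition _ n :=
  isMeasurableFun.Build _ _ _ _ (@tuple_snoc n) (@measurable_tuple_snoc n).

(* Lebesgue measure on R^n (restricted to the Borel sigma-algebra), as an
   iterated product measure. *)
Fixpoint lebesgue_tuple n : {measure set (n.-tuple mR) -> \bar R} :=
  match n with
  | 0 => \d_([tuple] : 0.-tuple mR)
  | m.+1 => image_measure (lebesgue_tuple m \x lebesgue_measure)%E (@tuple_snoc m)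
  end.

Lemma measurable_cube n (I : interval R) :
  measurable [set x : n.-tuple mR | forall i, tnth x i \in I].
Proof.
rewrite (_ : mkset _ = \bigcap_i ((fun x : n.-tuple mR => tnth x i) @^-1` [set` I])).
  apply: fin_bigcap_measurable => // i _.
  rewrite -[X in measurable X]setTI.
  exact: (@measurable_tnth _ mR n i measurableT _ (measurable_itv I)).
by apply/seteqP; split => x /= H i => [_|]; exact: (H i).
Qed.

Lemma lebesgue_tuple_cube n (a : R) : 0 < a ->
  lebesgue_tuple n [set x | forall i, tnth x i \in `]- a, a[] =
    ((a *+ 2) ^+ n)%:E.
Proof.
move=> a0; elim: n => [|n ih] /=.
  by rewrite expr0 diracE mem_set//= => -[].
rewrite /image_measure /pushforward.
have -> : @tuple_snoc n @^-1` [set x | forall i, tnth x i \in `]- a, a[] =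
    [set x | forall i, tnth x i \in `]- a, a[] `*` `]- a, a[%classic.
  apply/seteqP; split => -[x y] /=.
    move=> H; split; last by have := H ord0; rewrite tnth0.
    by move=> i; have := H (lift ord0 i); rewrite tnthS.
  move=> [H1 H2] i; have [->|] := eqVneq i ord0; first by rewrite tnth0.
  by case: (unliftP ord0 i) => [j -> _|->]; rewrite ?eqxx// tnthS.
rewrite product_measure1E//; last exact: measurable_cube.
rewrite ih /= lebesgue_measure_itv/= lte_fin gtrN// -EFinD -EFinM opprK.
by rewrite exprSr mulr2n.
Qed.

End LebesgueTuple.

Section SphereMeasure.
Context {R : realType} {d : nat}.
Local Notation mR := (measurableTypeR R).

Definition borel_space := g_sigma_algebraType (@open 'rV[R[i]]_d).

Lemma measurable_borel_space d' (T : measurableType d') (g : T -> borel_space) :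
  (forall j, measurable_fun setT (fun x => complex.Re ((g x : 'rV[R[i]]_d) 0 j))) ->
  (forall j, measurable_fun setT (fun x => complex.Im ((g x : 'rV[R[i]]_d) 0 j))) ->
  measurable_fun setT g.
Proof.
move=> mRe mIm; apply: (@measurability _ _ _ borel_space _ _ (@open 'rV[R[i]]_d)) => // _ [U oU <-].
rewrite setTI.
pose box (q : {ffun 'I_d -> rat * rat} * rat) : set T :=
  \bigcap_j ((fun x => complex.Re ((g x : 'rV[R[i]]_d) 0 j)) @^-1`
      `]ratr (q.1 j).1 - ratr q.2, ratr (q.1 j).1 + ratr q.2[%classic
    `&` (fun x => complex.Im ((g x : 'rV[R[i]]_d) 0 j)) @^-1`
      `]ratr (q.1 j).2 - ratr q.2, ratr (q.1 j).2 + ratr q.2[%classic).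
have mbox q : measurable (box q).
  apply: fin_bigcap_measurable => // j _.
  by apply: measurableI; rewrite -[X in measurable X]setTI;
    [exact: mRe | exact: mIm].
have -> : g @^-1` U = \bigcup_q (if `[< box q `<=` g @^-1` U >] then box q else set0).
  apply/seteqP; split; last first.
    by move=> x [q _]; case: asboolP => // + bx; exact.
  move=> x Ux.
  have /nbhs_ballP[e /= e0 eU] := open_nbhs_nbhs (conj oU Ux).
  have [er0 eE] : 0 < complex.Re e /\ e = (complex.Re e)%:C.
    by move: e0; case: (e) => a b; rewrite ltcE/= => /andP[/eqP -> ?].
  have [q /itvP qe] : exists q : rat, ratr q \in `](0 : R), complex.Re e / 4[.
    by apply: rat_in_itvoo; rewrite divr_gt0.
  have q0 : 0 < ratr q :> R by rewrite qe.
  have near_rat (t : R) : exists p : rat, t - ratr q < ratr p < t + ratr q.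
    have [|p] := @rat_in_itvoo _ (t - ratr q) (t + ratr q).
      by rewrite ltrBlDr -addrA ltrDl addr_gt0.
    by rewrite in_itv/= => pt; exists p.
  pose z : 'rV[R[i]]_d := g x.
  have [c cP] := choice (fun j => near_rat (complex.Re (z 0 j))).
  have [c' c'P] := choice (fun j => near_rat (complex.Im (z 0 j))).
  exists ([ffun j => (c j, c' j)], q) => //.
  case: asboolP => [_|]; last first.
    case=> y by_; apply: eU; rewrite eE; split => [|i j].
      by rewrite ltcR.
    rewrite ord1 -ball_normE /ball_/= normc_def ltcR.
    have := by_ j I; rewrite /= ffunE/= !in_itv/= => -[].
    have /andP[] := cP j; have /andP[] := c'P j.
    rewrite -/z; set a := complex.Re (z 0 j); set b := complex.Im (z 0 j).
    set a' := complex.Re _; set b' := complex.Im _ => h1 h2 h3 h4 /andP[h5 h6] /andP[h7 h8].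
    have -> : complex.Re (z 0 j - (g y : 'rV[R[i]]_d) 0 j) = a - a' by rewrite raddfB.
    have -> : complex.Im (z 0 j - (g y : 'rV[R[i]]_d) 0 j) = b - b' by rewrite raddfB.
    have qe4 : ratr q < complex.Re e / 4 by rewrite qe.
    rewrite -(ger0_norm (ltW er0)) -sqrtr_sqr ltr_sqrt ?exprn_gt0//.
    nra.
  move=> j _; rewrite /= ffunE/= !in_itv/=.
  have /andP[h1 h2] := cP j; have /andP[h3 h4] := c'P j.
  by rewrite -/z; split; apply/andP; split; lra.
apply: countable_bigcupT_measurable => // q.
by case: asboolP.
Qed.

Definition complex_vec (x : (d + d).-tuple mR) : 'rV[R[i]]_d :=
  \row_j (tnth x (lshift d j) +i* tnth x (rshift d j)).

Lemma enorm_complex_vec x :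
  enorm (complex_vec x) = Num.sqrt (\sum_i tnth x i ^+ 2).
Proof.
rewrite /enorm big_split_ord/= -big_split/=; congr Num.sqrt.
by apply: eq_bigr => j _; rewrite mxE/= sqr_sqrtr// addr_ge0// sqr_ge0.
Qed.

Lemma measurable_enorm_complex_vec :
  measurable_fun setT (fun x => enorm (complex_vec x)).
Proof.
under eq_fun do rewrite enorm_complex_vec.
apply: measurableT_comp.
  by apply: continuous_measurable_fun; exact: sqrt_continuous.
by apply: measurable_sum => i; apply: measurable_funX; exact: measurable_tnth.
Qed.

Definition unit_ball_tuple := [set x | unit_ball (complex_vec x)].

Lemma measurable_unit_ball_tuple : measurable unit_ball_tuple.
Proof.
rewrite (_ : unit_ball_tuple =
    (fun x => enorm (complex_vec x)) @^-1` `]-oo, 1[%classic).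
  rewrite -[X in measurable X]setTI.
  exact: measurable_enorm_complex_vec.
by apply/seteqP; split => x /=; rewrite in_itv.
Qed.

Lemma lebesgue_unit_ball_tuple_gt0 :
  (0 < lebesgue_tuple (d + d) unit_ball_tuple)%E.
Proof.
pose a : R := (d + d).+1%:R^-1.
have a0 : 0 < a by rewrite invr_gt0.
apply: (@lt_le_trans _ _
  (lebesgue_tuple (d + d) [set x | forall i, tnth x i \in `]- a, a[])).
  by rewrite lebesgue_tuple_cube// lte_fin exprn_gt0// pmulrn_lgt0.
apply: le_measure; rewrite ?inE.
- exact: measurable_cube.
- exact: measurable_unit_ball_tuple.
move=> x /= xa; rewrite /unit_ball_tuple/unit_ball/= enorm_complex_vec -sqrtr1 ltr_sqrt//.
apply: (@le_lt_trans _ _ (\sum_(i < d + d) a)).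
  apply: ler_sum => i _; have := xa i; rewrite in_itv/= => /andP[h1 h2].
  have : a <= 1 by rewrite invf_le1// ler1n.
  by nra.
rewrite sumr_const card_ord -mulr_natl ltr_pdivrMr// mul1r ltr_nat.
exact: ltnSn.
Qed.

Lemma lebesgue_unit_ball_tuple_lty :
  (lebesgue_tuple (d + d) unit_ball_tuple < +oo)%E.
Proof.
apply: (@le_lt_trans _ _
  (lebesgue_tuple (d + d) [set x | forall i, tnth x i \in `](- 1), 1[])).
  apply: le_measure; rewrite ?inE.
  - exact: measurable_unit_ball_tuple.
  - exact: measurable_cube.
  move=> x /=; rewrite /unit_ball_tuple/unit_ball/= enorm_complex_vec -[X in _ < X]sqrtr1.
  rewrite ltr_sqrt// => x1 i.
  have : tnth x i ^+ 2 < 1.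
    apply: le_lt_trans x1; rewrite (bigD1 i)//= lerDl.
    by apply: sumr_ge0 => k _; exact: sqr_ge0.
  by rewrite in_itv/= => xi1; apply/andP; split; nra.
by rewrite lebesgue_tuple_cube// ltey.
Qed.

Definition radial_proj (x : (d + d).-tuple mR) : borel_space :=
  (enorm (complex_vec x))^-1%:C *: complex_vec x.

Lemma measurable_radial_proj : measurable_fun setT radial_proj.
Proof.
have minv : measurable_fun setT (fun x => (enorm (complex_vec x))^-1).
  apply: (@measurableT_comp _ _ _ _ _ _ (@GRing.inv R)); last first.
    exact: measurable_enorm_complex_vec.
  rewrite -(setUv [set (0 : R)]); apply/measurable_funU => //.
    exact: measurableC.
  split; first exact: measurable_fun_set1.
  apply: open_continuous_measurable_fun.
    by apply: closed_openC; exact: closed_eq.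
  by move=> x; rewrite inE => /eqP x0; exact: inv_continuous.
apply: measurable_borel_space => j.
  rewrite (_ : (fun x => _) =
      (fun x => (enorm (complex_vec x))^-1 * tnth x (lshift d j))).
    by apply: measurable_funM => //; exact: measurable_tnth.
  by apply/funext => x; rewrite !mxE/= mul0r subr0.
rewrite (_ : (fun x => _) =
    (fun x => (enorm (complex_vec x))^-1 * tnth x (rshift d j))).
  by apply: measurable_funM => //; exact: measurable_tnth.
by apply/funext => x; rewrite !mxE/= mul0r addr0.
Qed.

HB.instance Definition _ :=
  isMeasurableFun.Build _ _ _ _ radial_proj measurable_radial_proj.

(* Normalized Lebesgue measure on the sphere, as a Borel probability measure on
   C^d concentrated on the sphere: the image under z |-> z / |z| of normalized
   Lebesgue measure on the ball (polar coordinates). The default \d_0 of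
   mnormalize is never used, by lebesgue_unit_ball_tuple_gt0 and
   lebesgue_unit_ball_tuple_lty. *)
Definition sphere_measure : probability borel_space R :=
  mnormalize
    (image_measure
      (mrestr (lebesgue_tuple (d + d)) measurable_unit_ball_tuple) radial_proj)
    \d_(0 : borel_space).

Lemma sphere_measureE (A : set borel_space) :
  sphere_measure A =
    (lebesgue_tuple (d + d) (radial_proj @^-1` A `&` unit_ball_tuple) *
     (fine (lebesgue_tuple (d + d) unit_ball_tuple))^-1%:E)%E.
Proof.
rewrite /sphere_measure/= /mnormalize; set m := (X in (X == 0)%E).
have mE : m = lebesgue_tuple (d + d) unit_ball_tuple.
  rewrite /m /image_measure /pushforward /mrestr.
  by congr (lebesgue_tuple _ _); exact: setTI.
case: ifPn => [/orP[/eqP m0|/eqP moo]|_].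
- by have := lebesgue_unit_ball_tuple_gt0; rewrite -mE m0 ltxx.
- by have := lebesgue_unit_ball_tuple_lty; rewrite -mE /m moo ltxx.
- by rewrite -mE.
Qed.

End SphereMeasure.
Arguments borel_space : clear implicits.
Arguments sphere_measure : clear implicits.

Definition weight_integral (R : realType) (w : R -> R) (x : R) : \bar R :=
  \int[lebesgue_measure]_(t in `[x, 1]) (w t ^+ 2 / t)%:E.

(* Main.v *)
From HB Require Import structures.
Require Import Defs.
From mathcomp Require Import all_boot all_order all_algebra.
From mathcomp Require Import complex.
From mathcomp Require Import all_classical all_reals all_analysis.
From mathcomp Require Import measurable_realfun ring lra zify.
Set Implicit Arguments.
Unset Strict Implicit.
Unset Printing Implicit Defensive.
Import Order.TTheory GRing.Theory Num.Theory.
Import numFieldNormedType.Exports.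
Import ComplexField.Normc.
Local Open Scope classical_set_scope.
Local Open Scope ring_scope.

(** Both parts compare the weight integral with sums of [w (q ^- n) ^ 2] over
geometric scales ([weight_sum_bounded], [weight_sum_unbounded]), which are the
sums of squares of the increments of [f] from one scale to the next.

Existence of limits. For a unit vector [zeta] the function
[y, t |-> f (exp (- y + i t) zeta)] is holomorphic on the half-plane [0 < y],
and its derivative is the radial derivative of [f], of size at most
[C w (y) / y]. Averages of its real part over dyadic arcs, taken at a very
small height, form a dyadic martingale. Since moving an arc only costs, by the
Cauchy-Riemann equations, the increments of the conjugate function at its end
points, the average over an arc of length [2 ^- n] is within [C w (2 ^- n)] of
the value at height [2 ^- n] above it ([arc_average_close]), so the increments
of the martingale have the same order. Kolmogorov's maximal inequality bounds
the number of points of a fine grid of angles over which the function deviates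
([strip_count]). As the measure of the sphere is invariant under rotations
([sphere_measure_rotation]), the average over the grid is a bound for the
measure of the set of [zeta] where [f] oscillates along the radius, by a tail
of the sum of the [w (2 ^- n) ^ 2] ([oscillation_le]). Finiteness of the
integral makes the radial values Cauchy almost everywhere.

Absence of limits. For each scale [m] there are boundedly many sums of peaks
[\sum_zeta <z, zeta> ^ n], with [n] between [m ^ 2] and [2 m ^ 2], bounded by
[2] on the sphere and of which at least one is [>= 1 / 2] in modulus at any
given point ([exists_peak_polynomials]). The function [f] is the sum, over a
geometric sequence of scales, of these polynomials with the coefficient
[w (m ^- 2)]. It is a Bloch function because the terms of its radial
derivative at distance [h] from the sphere decrease geometrically on both
sides of the scale [m ^- 2 = h]: towards coarse scales by the decrease of
[w (t) / t ^ (1 - eps)], towards fine ones by that of [(1 - h) ^ n]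
([lacunary_bloch]).

Suppose that [f] is bounded along a sequence of radii tending to [1], on a set
[E] of positive measure. The degrees are chosen to form a Sidon set
([degree_sidon]), so that rotation invariance makes the real parts of the
products of two different terms an orthogonal system
([pair_product_orthogonal]). By Bessel's inequality their integrals over [E]
are square-summable, and in the integral over [E] of the square modulus of the
sum of the late terms of [f] the off-diagonal part is negligible against the
diagonal one ([energy_bound]). The latter is at least a constant times the sum
of the [w (m ^- 2) ^ 2], which would therefore converge
([bounded_radial_null]), and the weight integral would be finite. *)

(** * Complex modulus and Euclidean norm *)

Section ComplexModulus.
Context {R : realType}.
Implicit Types a b x y : R[i].

Lemma normc_ge0 x : 0 <= normc x.
Proof. by case: x => a b; exact: sqrtr_ge0. Qed.

Lemma normcXn x n : normc (x ^+ n) = normc x ^+ n.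
Proof.
elim: n => [|n ih]; first by rewrite !expr0 normc1.
by rewrite !exprS normcM ih.
Qed.

Lemma normc_real (r : R) : normc r%:C%C = `|r|.
Proof. by rewrite /normc /= expr0n addr0 sqrtr_sqr. Qed.

Lemma sqr_normcE x : normc x ^+ 2 = complex.Re x ^+ 2 + complex.Im x ^+ 2.
Proof. by case: x => a b; rewrite /normc sqr_sqrtr// addr_ge0// sqr_ge0. Qed.

Lemma normcBC x y : normc (x - y) = normc (y - x).
Proof. by rewrite -normcN opprB. Qed.

Lemma normc_conj x : normc (conjc x) = normc x.
Proof. by case: x => a b; rewrite /normc /= sqrrN. Qed.

Lemma ler_normcB x y : normc (x - y) <= normc x + normc y.
Proof. by rewrite (le_trans (le_normcD _ _))// normcN. Qed.

Lemma ler_normc_distD z x y : normc (x - y) <= normc (x - z) + normc (z - y).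
Proof. by rewrite (le_trans _ (le_normcD _ _))// addrA subrK. Qed.

Lemma normc_Re x : `|complex.Re x| <= normc x.
Proof.
rewrite -(ler_sqr) ?nnegrE ?normc_ge0// sqr_normcE -normrX ger0_norm ?sqr_ge0//.
by rewrite lerDl sqr_ge0.
Qed.

Lemma normc_Im x : `|complex.Im x| <= normc x.
Proof.
rewrite -(ler_sqr) ?nnegrE ?normc_ge0// sqr_normcE -normrX ger0_norm ?sqr_ge0//.
by rewrite lerDr sqr_ge0.
Qed.

Lemma normc_leD x : normc x <= `|complex.Re x| + `|complex.Im x|.
Proof.
rewrite -(ler_sqr) ?nnegrE ?normc_ge0 ?addr_ge0// sqr_normcE.
rewrite -(real_normK (num_real (complex.Re x))) -(real_normK (num_real (complex.Im x))).
have := normr_ge0 (complex.Re x); have := normr_ge0 (complex.Im x); nra.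
Qed.

Lemma ler_normc_sum I (s : seq I) (P : pred I) (F : I -> R[i]) :
  normc (\sum_(i <- s | P i) F i) <= \sum_(i <- s | P i) normc (F i).
Proof.
elim/big_rec2: _ => [|i y1 y2 _ h]; first by rewrite normc0.
by rewrite (le_trans (le_normcD _ _))// lerD2l.
Qed.

Lemma Re_mulr_real (r : R) x : complex.Re (r%:C%C * x) = r * complex.Re x.
Proof. by case: x => a b /=; rewrite mul0r subr0. Qed.

Lemma Im_mulr_real (r : R) x : complex.Im (r%:C%C * x) = r * complex.Im x.
Proof. by case: x => a b /=; rewrite mul0r addr0. Qed.

Lemma Re_mulc x y :
  complex.Re (x * y) = complex.Re x * complex.Re y - complex.Im x * complex.Im y.
Proof. by case: x => a b; case: y. Qed.

Lemma Im_mulc x y :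
  complex.Im (x * y) = complex.Re x * complex.Im y + complex.Im x * complex.Re y.
Proof. by case: x => a b; case: y. Qed.

Lemma complex_ext x y :
  complex.Re x = complex.Re y -> complex.Im x = complex.Im y -> x = y.
Proof. by case: x => a b; case: y => c e /= -> ->. Qed.

(** Real and imaginary parts under one name, so that estimates are proved once
for both. *)
Definition cpart (b : bool) (x : R[i]) := if b then complex.Re x else complex.Im x.

Lemma cpart_norm (b : bool) x : `|cpart b x| <= normc x.
Proof. by case: b; [exact: normc_Re|exact: normc_Im]. Qed.

Lemma cpartB (b : bool) x y : cpart b (x - y) = cpart b x - cpart b y.
Proof. by case: b; rewrite /= raddfB. Qed.

(** Second order Taylor bound for [x ^ n]. The factors [r ^ 2] and [r ^ n]
stand for the power [r ^ (n - 2)], which gives the bound the same form for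
every [n]. *)
Lemma pow_taylor1 (r : R) x y n : 0 < r -> normc x <= r -> normc y <= r ->
  normc (x ^+ n - y ^+ n - n%:R * y ^+ n.-1 * (x - y)) * r ^+ 2 <=
  n%:R ^+ 2 * r ^+ n * normc (x - y) ^+ 2.
Proof.
move=> r0 xr yr; elim: n => [|n ih].
  by rewrite !expr0 subrr mul0r mul0r subr0 normc0 mul0r expr0n /= !mul0r.
have -> : x ^+ n.+1 - y ^+ n.+1 - n.+1%:R * y ^+ n.+1.-1 * (x - y) =
   x * (x ^+ n - y ^+ n - n%:R * y ^+ n.-1 * (x - y)) +
   n%:R * y ^+ n.-1 * (x - y) ^+ 2.
  rewrite !exprS -[n.+1.-1]/n -[n.+1%:R]natr1; case: n {ih} => [|n].
    by rewrite !expr0 /=; ring.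
  by rewrite -[n.+1.-1]/n !exprS; ring.
apply: (le_trans (ler_wpM2r _ (le_normcD _ _))); first by rewrite exprn_ge0// ltW.
rewrite mulrDl [normc (x * _)]normcM [normc (_ * (x - y) ^+ 2)]normcM.
rewrite [normc (n%:R * _)]normcM !normcXn.
have h1 : normc x * normc (x ^+ n - y ^+ n - n%:R * y ^+ n.-1 * (x - y)) * r ^+ 2 <=
  n%:R ^+ 2 * r ^+ n.+1 * normc (x - y) ^+ 2.
  rewrite -mulrA (le_trans (ler_wpM2r _ xr))//.
    by rewrite mulr_ge0 ?normc_ge0// exprn_ge0// ltW.
  by rewrite (le_trans (ler_wpM2l (ltW r0) ih))// (exprS r n) le_eqVlt; apply/orP; left; apply/eqP; ring.
have nn : normc n%:R = n%:R :> R.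
  by rewrite -(rmorph_nat (real_complex R)) normc_real normr_nat.
have h2 : normc n%:R * normc y ^+ n.-1 * normc (x - y) ^+ 2 * r ^+ 2 <=
   n%:R * r ^+ n.+1 * normc (x - y) ^+ 2.
  rewrite nn; case: n {ih h1 nn} => [|n]; first by rewrite !mul0r.
  set N := normc (x - y); rewrite -[n.+1.-1]/n.
  have -> : n.+1%:R * normc y ^+ n * N ^+ 2 * r ^+ 2 =
    n.+1%:R * (normc y ^+ n * (N ^+ 2 * r ^+ 2)) by ring.
  have -> : n.+1%:R * r ^+ n.+2 * N ^+ 2 =
    n.+1%:R * (r ^+ n * (N ^+ 2 * r ^+ 2)).
    by rewrite (exprS r n.+1) (exprS r n); ring.
  rewrite ler_wpM2l//.
  rewrite ler_wpM2r ?mulr_ge0 ?exprn_ge0 ?normc_ge0 ?(ltW r0)//.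
  by rewrite lerXn2r ?nnegrE ?normc_ge0 ?(ltW r0).
rewrite (le_trans (lerD h1 h2))// -!mulrDl ler_wpM2r ?exprn_ge0 ?normc_ge0//.
rewrite ler_wpM2r ?exprn_ge0 ?(ltW r0)// -natr1; have := ler0n R n; nra.
Qed.

End ComplexModulus.

Section EuclideanNorm.
Context {R : realType} {d : nat}.
Implicit Types z w : 'rV[R[i]]_d.

Definition cdot z w : R[i] := \sum_(j < d) z 0 j * conjc (w 0 j).

Lemma enorm_ge0 z : 0 <= enorm z.
Proof. exact: sqrtr_ge0. Qed.

Lemma sqr_enorm z : enorm z ^+ 2 = \sum_(j < d) normc (z 0 j) ^+ 2.
Proof. by rewrite sqr_sqrtr// sumr_ge0// => j _; rewrite sqr_ge0. Qed.

Lemma enorm0 : enorm (0 : 'rV[R[i]]_d) = 0.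
Proof.
rewrite /enorm big1 ?sqrtr0// => j _.
by rewrite mxE normc0 expr0n.
Qed.

Lemma enormZ (a : R[i]) z : enorm (a *: z) = normc a * enorm z.
Proof.
have -> : enorm (a *: z) = Num.sqrt (normc a ^+ 2 * enorm z ^+ 2).
  rewrite sqr_enorm mulr_sumr; congr Num.sqrt; apply: eq_bigr => j _.
  by rewrite mxE normcM exprMn.
by rewrite -exprMn sqrtr_sqr ger0_norm// mulr_ge0 ?normc_ge0 ?enorm_ge0.
Qed.

Lemma enormN z : enorm (- z) = enorm z.
Proof. by rewrite -scaleN1r enormZ normcN normc1 mul1r. Qed.

Lemma enormBC z w : enorm (z - w) = enorm (w - z).
Proof. by rewrite -enormN opprB. Qed.

Lemma normc_coord z j : normc (z 0 j) <= enorm z.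
Proof.
rewrite -(ler_sqr) ?nnegrE ?normc_ge0 ?enorm_ge0// sqr_enorm (bigD1 j)//= lerDl.
by rewrite sumr_ge0// => k _; rewrite sqr_ge0.
Qed.

Lemma enorm_le_sum z : enorm z <= \sum_(j < d) normc (z 0 j).
Proof.
have s0 (P : pred 'I_d) : 0 <= \sum_(j < d | P j) normc (z 0 j).
  by rewrite sumr_ge0// => k _; exact: normc_ge0.
rewrite -(ler_sqr) ?nnegrE ?enorm_ge0// sqr_enorm expr2 mulr_suml.
apply: ler_sum => j _; rewrite expr2 ler_wpM2l ?normc_ge0//.
by rewrite (bigD1 j)//= lerDl.
Qed.

Lemma enorm_eq0 z : enorm z = 0 -> z = 0.
Proof.
move=> z0; apply/rowP => j; rewrite mxE; apply: eq0_normc.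
by apply/eqP; rewrite eq_le normc_ge0 andbT -z0 normc_coord.
Qed.

Lemma cdotDl z z' w : cdot (z + z') w = cdot z w + cdot z' w.
Proof.
by rewrite /cdot -big_split; apply: eq_bigr => j _; rewrite mxE mulrDl.
Qed.

Lemma cdotZl (a : R[i]) z w : cdot (a *: z) w = a * cdot z w.
Proof.
by rewrite /cdot mulr_sumr; apply: eq_bigr => j _; rewrite mxE mulrA.
Qed.

Lemma cdotBl z z' w : cdot (z - z') w = cdot z w - cdot z' w.
Proof. by rewrite -scaleN1r cdotDl cdotZl mulN1r. Qed.

Lemma cdotC z w : cdot w z = conjc (cdot z w).
Proof.
rewrite /cdot rmorph_sum; apply: eq_bigr => j _.
by rewrite rmorphM /= conjcK mulrC.
Qed.

Lemma sqr_enormB z w : enorm (z - w) ^+ 2 =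
  enorm z ^+ 2 + enorm w ^+ 2 - 2 * complex.Re (cdot z w).
Proof.
rewrite !sqr_enorm /cdot raddf_sum/= mulr_sumr -big_split -sumrB.
apply: eq_bigr => j _ /=; rewrite !mxE !sqr_normcE.
by case: (z 0 j) => a b; case: (w 0 j) => a' b' /=; ring.
Qed.

Lemma cdotZr (a : R[i]) z w : cdot z (a *: w) = conjc a * cdot z w.
Proof.
rewrite /cdot mulr_sumr; apply: eq_bigr => j _; rewrite mxE rmorphM /=.
by ring.
Qed.

(** The square of the norm of [z - t c w], where [c] is the product [cdot z w],
is nonnegative for the minimizing value [t = |w| ^- 2]. *)
Lemma cauchy_schwarz z w : normc (cdot z w) <= enorm z * enorm w.
Proof.
set c := cdot z w.
have h (t : R) : 0 <= enorm z ^+ 2 + t ^+ 2 * (normc c ^+ 2 * enorm w ^+ 2)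
    - 2 * t * normc c ^+ 2.
  have := sqr_ge0 (enorm (z - (t%:C%C * c) *: w)).
  rewrite sqr_enormB enormZ normcM normc_real !exprMn real_normK ?num_real//.
  rewrite cdotZr -/c (_ : conjc _ = t%:C%C * conjc c); last first.
    by case: (c) => a b; apply: complex_ext => /=; ring.
  rewrite -[_ * _ * c]mulrA Re_mulr_real.
  have -> : complex.Re (conjc c * c) = normc c ^+ 2.
    by rewrite sqr_normcE; case: (c) => a b /=; ring.
  by rewrite !mulrA.
have [w0|w0] := eqVneq (enorm w) 0.
  suff -> : normc c = 0 by rewrite mulr_ge0 ?enorm_ge0.
  by rewrite /c (enorm_eq0 w0) -(scale0r 0) cdotZr rmorph0 mul0r normc0.
have w1 : 0 < enorm w ^+ 2 by rewrite exprn_gt0// lt_neqAle eq_sym w0 enorm_ge0.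
rewrite -(ler_sqr) ?nnegrE ?normc_ge0 ?mulr_ge0 ?enorm_ge0// exprMn.
have := h (enorm w ^+ 2)^-1.
set A := enorm z ^+ 2; set B := enorm w ^+ 2; set N := normc c ^+ 2.
have -> : A + B^-1 ^+ 2 * (N * B) - 2 * B^-1 * N = A - N / B.
  by field; rewrite gt_eqF.
by rewrite subr_ge0 ler_pdivrMr.
Qed.

Lemma enormD z w : enorm (z + w) <= enorm z + enorm w.
Proof.
rewrite -(ler_sqr) ?nnegrE ?enorm_ge0 ?addr_ge0 ?enorm_ge0//.
have -> : z + w = z - (-1) *: w by rewrite scaleN1r opprK.
rewrite sqr_enormB enormZ normcN normc1 mul1r.
have -> : complex.Re (cdot z (-1 *: w)) = - complex.Re (cdot z w).
  by rewrite cdotZr; case: (cdot z w) => a b /=; ring.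
have := cauchy_schwarz z w; have := ler_norm (complex.Re (cdot z w)).
have := normc_Re (cdot z w); nra.
Qed.

Lemma ler_enorm_distD z' z w : enorm (z - w) <= enorm (z - z') + enorm (z' - w).
Proof. by rewrite (le_trans _ (enormD _ _))// addrA subrK. Qed.

End EuclideanNorm.

(** * Tails of bounded sums *)

Section BoundedTails.
Context {R : realType}.

(** The values eventually lie within [e] of their supremum. *)
Lemma nondecreasing_bounded_tail (P : nat -> R) (B e : R) :
  {homo P : m n / (m <= n)%N >-> m <= n} -> (forall n, P n <= B) -> 0 < e ->
  exists N, forall n, P n - P N <= e.
Proof.
move=> Pnd PB e0.
have ubP : has_sup (range P).
  by split; [exists (P 0%N), 0%N|exists B => _ [n _ <-]].
have [_ [N _ <-] PN] := sup_adherent e0 ubP.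
exists N => n; have : P n <= sup (range P) by apply: sup_upper_bound => //; exists n.
by move: PN; lra.
Qed.

Lemma sum_bounded_tail (a : nat -> R) (B e : R) : (forall n, 0 <= a n) ->
  (forall n, \sum_(k < n) a k <= B) -> 0 < e ->
  exists N, forall n, \sum_(k < n) a (N + k)%N <= e.
Proof.
move=> a0 aB e0.
have nd : {homo (fun n => \sum_(k < n) a k) : m n / (m <= n)%N >-> m <= n}.
  move=> m n mn; rewrite -(subnKC mn) big_split_ord/= lerDl.
  by apply: sumr_ge0.
have [N NP] := nondecreasing_bounded_tail nd aB e0.
exists N => n; have := NP (N + n)%N; rewrite big_split_ord/=.
by rewrite addrAC subrr add0r.
Qed.

End BoundedTails.

(** * Differentiability in the Euclidean norm *)

(** The little-o in the definition of differentiability, in epsilon form. *)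
Lemma littleo_shiftP (K : numFieldType) (U W : normedModType K) (f : U -> W)
    (z : U) (L : U -> W) :
  (f \o shift z = cst (f z) + L +o_ 0 id) <->
  (forall e : K, 0 < e ->
     \forall h \near 0, `|f (h + z) - f z - L h| <= e * `|h|).
Proof.
split.
  move=> /eqaddoP fL e e0; have := fL e e0; apply: filterS => h.
  by rewrite !fctE /= opprD addrA.
move=> H; apply/eqaddoP => e e0; have := H e e0; apply: filterS => h.
by rewrite !fctE /= opprD addrA.
Qed.

Lemma differentiable_approx (K : numFieldType) (U W : normedModType K)
    (f : U -> W) (z : U) : differentiable f z ->
  forall e : K, 0 < e ->
     \forall h \near 0, `|f (h + z) - f z - 'd f z h| <= e * `|h|.
Proof. by move=> /diff_locally/littleo_shiftP. Qed.

Lemma approx_differentiable (K : numFieldType) (U W : normedModType K)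
    (f : U -> W) (z : U) (L : {linear U -> W}) : continuous L ->
  (forall e : K, 0 < e ->
     \forall h \near 0, `|f (h + z) - f z - L h| <= e * `|h|) ->
  differentiable f z /\ 'd f z = L :> (U -> W).
Proof.
move=> Lc /littleo_shiftP fL; have dE := diff_unique Lc fL; split => //.
by apply/diff_locallyP; rewrite dE.
Qed.

Section Topology.
Context {R : realType} {d : nat}.
Local Notation V := 'rV[R[i]]_d.
Implicit Types (z w : V) (f : V -> R[i]).

Lemma normr_normc (x : R[i]) : `|x| = (normc x)%:C%C.
Proof. by rewrite normc_def; case: x. Qed.

Lemma gt0_complex (e : R[i]) : 0 < e -> exists2 r : R, 0 < r & e = r%:C%C.
Proof.
by case: e => a b; rewrite ltcE/= => /andP[/eqP -> a0]; exists a.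
Qed.

Lemma coord_le_mx_norm z j : `|z 0 j| <= `|z|.
Proof.
rewrite [leRHS]/Num.norm /= mx_normE -[leLHS]nngE num_le.
exact: (le_bigmax _ (fun i : 'I_1 * 'I_d => `|z i.1 i.2|%:nng) (0, j)).
Qed.

Lemma mx_norm_le_enorm z : `|z| <= (enorm z)%:C%C.
Proof.
rewrite [leLHS]/Num.norm /=; have [->|/mx_norm_neq0[[i j] ->]] := eqVneq (mx_norm z) 0.
  by rewrite lecR enorm_ge0.
by rewrite normr_normc lecR (ord1 i) normc_coord.
Qed.

Lemma enorm_le_mx_norm z : (enorm z)%:C%C <= d%:R * `|z|.
Proof.
apply: (@le_trans _ _ ((\sum_(j < d) normc (z 0 j))%:C%C)).
  by rewrite lecR enorm_le_sum.
rewrite rmorph_sum /= mulr_natl -[X in _ *+ X]card_ord -sumr_const.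
by apply: ler_sum => j _; rewrite -normr_normc coord_le_mx_norm.
Qed.

(** The sup norm of row vectors and the Euclidean norm are equivalent, which
lets every topological notion below be stated with real radii in [enorm]. *)
Lemma nbhs_enormP z (A : set V) :
  nbhs z A <-> exists2 e : R, 0 < e & forall z', enorm (z' - z) < e -> A z'.
Proof.
split.
  move=> /nbhs_normP[e /= /gt0_complex[r r0 ->] sA]; exists r => // z' zz'.
  apply: sA; rewrite /= -opprB normrN.
  by rewrite (le_lt_trans (mx_norm_le_enorm _))// ltcR.
move=> [e e0 sA]; apply/nbhs_ballP; exists (e / d.+1%:R)%:C%C.
  by rewrite /= ltcR divr_gt0.
move=> z'; rewrite mx_norm_ball => /= zz'; apply: sA; rewrite enormBC -ltcR.
rewrite (le_lt_trans (enorm_le_mx_norm _))//.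
apply: (@le_lt_trans _ _ (d.+1%:R * `|z - z'|)).
  by rewrite ler_wpM2r// ler_nat.
rewrite mulrC -ltr_pdivlMr//.
by rewrite (_ : _ / _ = (e / d.+1%:R)%:C%C)// rmorphM fmorphV rmorph_nat.
Qed.

Lemma nbhs_normcP (x : R[i]) (A : set R[i]) :
  nbhs x A <-> exists2 e : R, 0 < e & forall y, normc (y - x) < e -> A y.
Proof.
split.
  move=> /nbhs_normP[e /= /gt0_complex[r r0 ->] sA]; exists r => // y xy.
  by apply: sA; rewrite /= -opprB normrN normr_normc ltcR.
move=> [e e0 sA]; apply/nbhs_ballP; exists e%:C%C; first by rewrite /= ltcR.
by move=> y; rewrite -ball_normE => /= xy; apply: sA; rewrite normcBC -ltcR -normr_normc.
Qed.

Definition grad_dot (c : 'I_d -> R[i]) (h : V) : R[i] := \sum_j h 0 j * c j.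

Lemma grad_dot_is_linear c : linear (grad_dot c).
Proof.
move=> a u v; rewrite /grad_dot scaler_sumr -big_split; apply: eq_bigr => j _.
by rewrite !mxE mulrDl -mulrA.
Qed.

HB.instance Definition _ c := GRing.isLinear.Build R[i] V R[i] _ (grad_dot c)
  (grad_dot_is_linear c).

Lemma normc_grad_dot_le c h : normc (grad_dot c h) <= (\sum_j normc (c j)) * enorm h.
Proof.
rewrite (le_trans (ler_normc_sum _ _ _))// mulr_suml; apply: ler_sum => j _.
by rewrite normcM mulrC ler_wpM2l ?normc_ge0 ?normc_coord.
Qed.

Lemma linear_sum_delta (L : {linear V -> R[i]}) h :
  L h = grad_dot (fun j => L (delta_mx 0 j)) h.
Proof.
rewrite {1}(row_sum_delta h) linear_sum; apply: eq_bigr => j _.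
by rewrite linearZ.
Qed.

(** Complex differentiability at [z] with all quantities real: the scalar field
of [differentiable] is [R[i]], whose order is only partial. *)
Definition has_gradient f z (c : 'I_d -> R[i]) :=
  forall e : R, 0 < e -> exists2 r : R, 0 < r & forall z', enorm (z' - z) < r ->
    normc (f z' - f z - grad_dot c (z' - z)) <= e * enorm (z' - z).

Lemma differentiable_has_gradient f z : differentiable f z ->
  exists2 c, has_gradient f z c & radial_derivative f z = grad_dot c z.
Proof.
move=> df; exists (fun j => 'd f z (delta_mx 0 j)); last first.
  by apply: eq_bigr => j _; rewrite deriveE.
move=> e e0; have e0' : 0 < e%:C%C :> R[i] by rewrite ltcR.
have /nbhs_enormP[r r0 rP] := differentiable_approx df e0'.
exists r => // z' zz'; have := rP (z' - z).
rewrite subr0 => /(_ zz'); rewrite subrK => le.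
rewrite -lecR -normr_normc -linear_sum_delta (le_trans le)// rmorphM.
by rewrite ler_wpM2l ?mx_norm_le_enorm// lecR ltW.
Qed.

Lemma has_gradient_differentiable f z c : has_gradient f z c ->
  differentiable f z /\ radial_derivative f z = grad_dot c z.
Proof.
move=> fc.
have cc : continuous (grad_dot c).
  move=> x A /nbhs_normcP[e e0 sA]; apply/nbhs_enormP.
  have C0 : 0 <= \sum_j normc (c j) by rewrite sumr_ge0// => j _; exact: normc_ge0.
  exists (e / (\sum_j normc (c j) + 1)).
    by rewrite divr_gt0// ltr_wpDl.
  move=> y; rewrite ltr_pdivlMr ?ltr_wpDl// => xy; apply: sA.
  rewrite -[_ - _]raddfB (le_lt_trans (normc_grad_dot_le _ _))// (le_lt_trans _ xy)//.
  by rewrite mulrC ler_wpM2l ?enorm_ge0// lerDl.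
have [|df dE] := @approx_differentiable _ _ _ f z (grad_dot c) cc.
  move=> _ /gt0_complex[e e0 ->].
  have [r r0 rP] := fc _ (divr_gt0 e0 (ltr0Sn _ d)).
  apply/nbhs_enormP; exists r => // h; rewrite subr0 => hr.
  have := rP (h + z); rewrite addrK => /(_ hr) le.
  rewrite normr_normc.
  apply: (@le_trans _ _ ((e / d.+1%:R * enorm h)%:C%C)); first by rewrite lecR.
  rewrite rmorphM fmorph_div rmorph_nat -mulrA ler_wpM2l ?lecR ?(ltW e0)//.
  rewrite mulrC ler_pdivrMr// mulrC (le_trans (enorm_le_mx_norm _))//.
  by rewrite ler_wpM2r// ler_nat.
split => //; apply: eq_bigr => j _; rewrite deriveE// dE; congr (_ * _).
suff : grad_dot c (delta_mx 0 j) = c j by [].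
rewrite /grad_dot (bigD1 j)//= big1 ?addr0; last first.
  by move=> k kj; rewrite mxE eqxx/= (negPf kj) mul0r.
by rewrite mxE !eqxx mul1r.
Qed.

Lemma has_gradient_lipschitz f z c : has_gradient f z c ->
  exists2 r : R, 0 < r & forall z', enorm (z' - z) < r ->
    normc (f z' - f z) <= (1 + \sum_j normc (c j)) * enorm (z' - z).
Proof.
move=> fc; have [r r0 rP] := fc 1 ltr01; exists r => // z' zz'.
have le1 := rP _ zz'; have le2 := normc_grad_dot_le c (z' - z).
rewrite -[f z' - f z](subrK (grad_dot c (z' - z))) (le_trans (le_normcD _ _))//.
by rewrite mulrDl lerD.
Qed.

Lemma differentiable_continuous_enorm f z : differentiable f z ->
  forall e : R, 0 < e -> exists2 r : R, 0 < r &
    forall z', enorm (z' - z) < r -> normc (f z' - f z) < e.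
Proof.
move=> /differentiable_has_gradient[c /has_gradient_lipschitz[r r0 rP] _] e e0.
have C0 : 0 < 1 + \sum_j normc (c j).
  by rewrite ltr_pwDl// sumr_ge0// => j _; exact: normc_ge0.
exists (Num.min r (e / (1 + \sum_j normc (c j)))).
  by rewrite lt_min r0 divr_gt0.
move=> z'; rewrite lt_min => /andP[zz' zz'e].
by rewrite (le_lt_trans (rP _ zz'))// mulrC -ltr_pdivlMr.
Qed.

End Topology.

(** * Rotation invariance of the sphere measure *)

Section Translation.
Context {R : realType}.
Local Notation mR := (measurableTypeR R).
Local Notation mu := (@lebesgue_measure R).

Definition shiftR (c : R) : mR -> mR := fun y => y + c.

Lemma measurable_shiftR c : measurable_fun setT (shiftR c).
Proof. by apply: measurable_funD => //; exact: measurable_id. Qed.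

HB.instance Definition _ c :=
  isMeasurableFun.Build _ _ _ _ (shiftR c) (measurable_shiftR c).

Lemma lebesgue_measure_shift (c : R) (A : set mR) : measurable A ->
  mu ((fun y => y + c) @^-1` A) = mu A.
Proof.
move=> mA; apply/esym.
have := @lebesgue_measure_unique R (image_measure mu (shiftR c)).
apply => // _ [[a b] _ <-]; rewrite /image_measure /pushforward /=.
rewrite (_ : shiftR c @^-1` `]a, b]%classic = `]a - c, b - c]%classic); last first.
  apply/seteqP; split => y /=; rewrite /shiftR !in_itv/= => /andP[h1 h2];
  by apply/andP; split; lra.
rewrite !lebesgue_measure_itv/= !lte_fin ltrD2r; case: ifPn => // _.
by rewrite -!EFinB; congr EFin; ring.
Qed.

End Translation.

Section SectionInvariance.
Context d1 d2 (T1 : measurableType d1) (T2 : measurableType d2) (R : realType).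
Local Open Scope ereal_scope.

(** Cavalieri's principle: product measures see only the measures of the
sections. With [product_measure_eq_ysection] it reduces the invariance of a
product under a shear to translations in one factor. *)
Lemma product_measure_eq_xsection (m1 : {measure set T1 -> \bar R})
    (m2 : {sigma_finite_measure set T2 -> \bar R}) (A B : set (T1 * T2)) :
  (forall x, m2 (xsection A x) = m2 (xsection B x)) ->
  (m1 \x m2) A = (m1 \x m2) B.
Proof. by move=> AB; apply: eq_integral => x _ /=; rewrite AB. Qed.

Lemma product_measure_eq_ysection (m1 : {sigma_finite_measure set T1 -> \bar R})
    (m2 : {sigma_finite_measure set T2 -> \bar R}) (A B : set (T1 * T2)) :
  measurable A -> measurable B ->
  (forall y, m1 (ysection A y) = m1 (ysection B y)) ->
  (m1 \x m2) A = (m1 \x m2) B.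
Proof.
move=> mA mB AB.
have sw X : measurable X -> (m1 \x m2) X = (m1 \x^ m2) X.
  by apply: product_measure_unique => *; exact: product_measure2E.
by rewrite !sw//; apply: eq_integral => y _ /=; rewrite AB.
Qed.

End SectionInvariance.

Section Shears.
Context {R : realType}.
Local Notation mR := (measurableTypeR R).

Lemma lebesgue_tuple_sigma_finite n : sigma_finite setT (@lebesgue_tuple R n).
Proof.
exists (fun k => [set x : n.-tuple mR | forall i,
    tnth x i \in `]- k.+1%:R, k.+1%:R[ ]).
  apply/esym; rewrite -subTset => x _.
  exists (\sum_(i < n) (Num.truncn `|tnth x i|).+1)%N => // i.
  rewrite in_itv/= -ltr_norml.
  rewrite (@lt_le_trans _ _ (Num.truncn `|tnth x i|).+1%:R)//.
    by rewrite truncnS_gt.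
  by rewrite ler_nat ltnW// ltnS (bigD1 i)//= leq_addr.
move=> k; split; first exact: measurable_cube.
by rewrite lebesgue_tuple_cube// ltey.
Qed.

(** A delta-expansion of [lebesgue_tuple], a head symbol to which the
sigma-finite structure can be attached. *)
Definition lebesgue_power n : set (n.-tuple mR) -> \bar R := lebesgue_tuple n.

HB.instance Definition _ n := Measure.copy (@lebesgue_power n) (lebesgue_tuple n).

HB.instance Definition _ n := Measure_isSigmaFinite.Build _ _ _
  (@lebesgue_power n) (@lebesgue_tuple_sigma_finite n).

Definition preserves n (T : n.-tuple mR -> n.-tuple mR) :=
  measurable_fun setT T /\ forall A, measurable A ->
    lebesgue_tuple n (T @^-1` A) = lebesgue_tuple n A.

Lemma preserves_comp n (S T : n.-tuple mR -> n.-tuple mR) :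
  preserves S -> preserves T -> preserves (S \o T).
Proof.
move=> [mS iS] [mT iT]; split; first exact: measurableT_comp.
move=> A mA; rewrite -[(S \o T) @^-1` A]/(T @^-1` (S @^-1` A)) iT ?iS//.
by rewrite -[X in measurable X]setTI; exact: mS.
Qed.

Definition shear n (i : 'I_n) (g : n.-tuple mR -> R) (x : n.-tuple mR) :
  n.-tuple mR := [tuple tnth x j + (if j == i then g x else 0) | j < n].

Lemma measurable_shear n (i : 'I_n) g : measurable_fun setT g ->
  measurable_fun setT (shear i g).
Proof.
move=> mg; apply/measurable_fun_tnthP => j.
rewrite (_ : _ \o _ = (fun x => tnth x j + (if j == i then g x else 0))).
  apply: measurable_funD; first exact: measurable_tnth.
  by case: (j == i); [exact: mg|exact: measurable_cst].
by apply/funext => x /=; rewrite tnth_mktuple.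
Qed.

(** Induction on the dimension. If the sheared coordinate is the last one
adjoined, each of its sections is translated by a constant, since [g] does not
depend on it; otherwise the last coordinate is frozen and the shear acts on
the remaining ones. *)
Lemma preserves_shear n (i : 'I_n) g : measurable_fun setT g ->
  (forall x y : n.-tuple mR, (forall j, j != i -> tnth x j = tnth y j) ->
     g x = g y) ->
  preserves (shear i g).
Proof.
move=> mg gi; split; first exact: measurable_shear.
elim: n i g mg gi => [[]//|n ih] i g mg gi A mA.
rewrite /= /image_measure /pushforward.
have mB : measurable (@tuple_snoc R n @^-1` A).
  by rewrite -[X in measurable X]setTI; exact: measurable_tuple_snoc.
have mB' : measurable (@tuple_snoc R n @^-1` (shear i g @^-1` A)).
  rewrite -[X in measurable X]setTI; apply: measurable_tuple_snoc => //.
  by rewrite -[X in measurable X]setTI; exact: measurable_shear.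
have [i0|] := eqVneq i ord0.
  apply: product_measure_eq_xsection => t.
  rewrite -[RHS](lebesgue_measure_shift (g [tuple of 0 :: t])); last exact: measurable_xsection.
  congr (lebesgue_measure _); apply/seteqP.
  have E (y : mR) : shear i g [tuple of y :: t] = [tuple of (y + g [tuple of 0 :: t]) :: t].
    apply: eq_from_tnth => j; rewrite tnth_mktuple i0.
    have -> : g [tuple of y :: t] = g [tuple of 0 :: t].
      apply: gi => k; rewrite i0; case: (unliftP ord0 k) => [l ->|->]; rewrite ?eqxx//.
      by rewrite !tnthS.
    case: (unliftP ord0 j) => [l ->|->]; first by rewrite !tnthS addr0.
    by rewrite eqxx !tnth0.
  by split => y; rewrite /xsection /= !inE /= E.
case: (unliftP ord0 i) => [k ik _|->]; last by rewrite eqxx.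
apply: (@product_measure_eq_ysection _ _ _ _ _ (@lebesgue_power n)) => // y.
pose g' (t : n.-tuple mR) := g [tuple of y :: t].
have mg' : measurable_fun setT g'.
  apply: measurableT_comp => //.
  by apply: measurable_cons => //; exact: measurable_cst.
rewrite /lebesgue_power -[RHS](ih k g' mg').
- congr (lebesgue_tuple n _); apply/seteqP.
  have E (t : n.-tuple mR) : shear i g [tuple of y :: t] = [tuple of y :: shear k g' t].
    apply: eq_from_tnth => j; rewrite tnth_mktuple ik.
    case: (unliftP ord0 j) => [l ->|->]; last by rewrite !tnth0 addr0.
    by rewrite !tnthS tnth_mktuple (inj_eq lift_inj).
  by split => t; rewrite /ysection /= !inE /= E.
- move=> x x' xx'; apply: gi => j; rewrite ik.
  case: (unliftP ord0 j) => [l ->|->]; last by rewrite !tnth0.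
  by rewrite !tnthS (inj_eq lift_inj) => /xx'.
- exact: measurable_ysection.
Qed.

End Shears.

Section Rotation.
Context {R : realType} {d : nat}.
Local Notation mR := (measurableTypeR R).
Local Notation T := ((d + d).-tuple mR).
Variables (c s : R).

(** Multiplication by [c + i s] of the first [n] complex coordinates. *)
Definition rotate_upto n (x : T) : T :=
  [tuple match fintype.split k with
     | inl j => if (j < n)%N then c * tnth x (lshift d j) - s * tnth x (rshift d j)
                else tnth x (lshift d j)
     | inr j => if (j < n)%N then s * tnth x (lshift d j) + c * tnth x (rshift d j)
                else tnth x (rshift d j)
     end | k < d + d].

Lemma rotate_upto_l n x j : tnth (rotate_upto n x) (lshift d j) =
  if (j < n)%N then c * tnth x (lshift d j) - s * tnth x (rshift d j)
  else tnth x (lshift d j).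
Proof.
rewrite tnth_mktuple; case: fintype.splitP => k /= jk.
  by have -> : j = k by exact: val_inj.
by have := ltn_ord j; rewrite jk ltnNge leq_addr.
Qed.

Lemma rotate_upto_r n x j : tnth (rotate_upto n x) (rshift d j) =
  if (j < n)%N then s * tnth x (lshift d j) + c * tnth x (rshift d j)
  else tnth x (rshift d j).
Proof.
rewrite tnth_mktuple; case: fintype.splitP => k /= jk.
  by have := ltn_ord k; rewrite -jk ltnNge leq_addr.
by have -> : j = k by apply: val_inj; apply: addnI jk.
Qed.

Hypothesis cs1 : c ^+ 2 + s ^+ 2 = 1.

Let tau := s / (1 + c).

Lemma preserves_scaled_shear (i k : 'I_(d + d)) (t : R) : k != i ->
  preserves (shear i (fun x => t * tnth x k)).
Proof.
move=> ki; apply: preserves_shear => [|x y xy]; last by rewrite xy.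
apply: measurable_funM; first exact: measurable_cst.
exact: measurable_tnth.
Qed.

(** A plane rotation is the product of three shears. *)
Lemma preserves_rotate_upto n : 1 + c != 0 -> (n <= d)%N ->
  preserves (rotate_upto n).
Proof.
move=> c1; elim: n => [_|n ih nd].
  rewrite (_ : rotate_upto 0 = id).
    by split => //; exact: measurable_id.
  apply/funext => x; apply: eq_from_tnth => k.
  rewrite -(splitK k); case: (fintype.split k) => j /=.
    by rewrite rotate_upto_l.
  by rewrite rotate_upto_r.
pose j : 'I_d := Ordinal nd.
have lr : lshift d j != rshift d j by rewrite eq_lrshift.
have rl : rshift d j != lshift d j by rewrite eq_rlshift.
(* [tau] is the tangent of half the angle. *)
pose S1 := shear (lshift d j) (fun x => - tau * tnth x (rshift d j)).
pose S2 := shear (rshift d j) (fun x => s * tnth x (lshift d j)).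
have p1 : preserves S1 by exact: preserves_scaled_shear.
have p2 : preserves S2 by exact: preserves_scaled_shear.
have {}ih := ih (ltnW nd).
rewrite (_ : rotate_upto n.+1 = S1 \o (S2 \o (S1 \o rotate_upto n))).
  by do 3 apply: preserves_comp => //.
have S1l y : tnth (S1 y) (lshift d j) = tnth y (lshift d j) - tau * tnth y (rshift d j).
  by rewrite tnth_mktuple eqxx mulNr.
have S1r y : tnth (S1 y) (rshift d j) = tnth y (rshift d j).
  by rewrite tnth_mktuple (negPf rl) addr0.
have S2l y : tnth (S2 y) (lshift d j) = tnth y (lshift d j).
  by rewrite tnth_mktuple (negPf lr) addr0.
have S2r y : tnth (S2 y) (rshift d j) = tnth y (rshift d j) + s * tnth y (lshift d j).
  by rewrite tnth_mktuple eqxx.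
have SO y k : k != lshift d j -> k != rshift d j ->
    (tnth (S1 y) k = tnth y k) * (tnth (S2 y) k = tnth y k).
  by move=> /negPf k1 /negPf k2; rewrite !tnth_mktuple k1 k2 !addr0.
have t2 : tau * (1 + c) = s by rewrite /tau divfK.
have t1 : 1 - s * tau = c.
  apply: (mulIf c1); rewrite mulrBl mul1r -mulrA t2.
  by have := cs1; rewrite !expr2; lra.
apply/funext => x; apply: eq_from_tnth => k /=.
have Cj m : (m < n.+1)%N = (m == n) || (m < n)%N by rewrite ltnS leq_eqVlt.
have nn : (n < n)%N = false by rewrite ltnn.
have [->|kl] := eqVneq k (lshift d j).
  rewrite S1l S2l S2r S1l S1r !rotate_upto_l !rotate_upto_r /= ltnSn nn.
  set a := tnth x _; set b := tnth x _; apply/esym/eqP; rewrite -subr_eq0.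
  have -> : a - tau * b - tau * (b + s * (a - tau * b)) - (c * a - s * b) =
    (a - tau * b) * (1 - s * tau - c) - b * (tau * (1 + c) - s) by ring.
  by rewrite t1 t2 !subrr !mulr0 subr0.
have [->|kr] := eqVneq k (rshift d j).
  rewrite S1r S2r S1l S1r !rotate_upto_l !rotate_upto_r /= ltnSn nn.
  set a := tnth x _; set b := tnth x _; apply/esym/eqP; rewrite -subr_eq0.
  have -> : b + s * (a - tau * b) - (s * a + c * b) = b * (1 - s * tau - c) by ring.
  by rewrite t1 subrr mulr0.
rewrite !SO//; move: kl kr; rewrite -(splitK k); case: (fintype.split k) => m /=.
  move=> ml _; rewrite !rotate_upto_l Cj.
  by have /negPf -> : (m : nat) != n by apply: contra ml => /eqP mn; apply/eqP; congr lshift; exact: val_inj.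
move=> _ mr; rewrite !rotate_upto_r Cj.
by have /negPf -> : (m : nat) != n by apply: contra mr => /eqP mn; apply/eqP; congr rshift; exact: val_inj.
Qed.

Lemma complex_vec_rotate x :
  complex_vec (rotate_upto d x) = (c +i* s)%C *: complex_vec x.
Proof.
apply/rowP => j; rewrite !mxE rotate_upto_l rotate_upto_r ltn_ord.
by apply: complex_ext => /=; ring.
Qed.

End Rotation.

Section SphereRotation.
Context {R : realType} {d : nat}.
Local Notation V := 'rV[R[i]]_d.
Local Notation sigma := (sphere_measure R d).

Lemma unimodularE (u : R[i]) : normc u = 1 ->
  complex.Re u ^+ 2 + complex.Im u ^+ 2 = 1.
Proof. by move=> u1; rewrite -sqr_normcE u1 expr1n. Qed.

(** Preimages of open sets are open, and the sigma-algebra is generated by the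
open sets; continuity is stated in the Euclidean norm. *)
Lemma measurable_borel_continuous (h : V -> V) :
  (forall z (e : R), 0 < e -> exists2 r : R, 0 < r &
     forall z', enorm (z' - z) < r -> enorm (h z' - h z) < e) ->
  measurable_fun setT (h : borel_space R d -> borel_space R d).
Proof.
move=> hc; apply: (@measurability _ _ _ (borel_space R d) _ _ (@open V)) => // _ [U oU <-].
rewrite setTI; apply: sub_sigma_algebra; move: oU; rewrite !openE => oU z Uz.
have /nbhs_enormP[e e0 eU] := oU _ Uz; have [r r0 rP] := hc z e e0.
by apply/nbhs_enormP; exists r => // z' zz'; apply/eU/rP.
Qed.

Lemma measurable_scale (u : R[i]) (A : set (borel_space R d)) : measurable A ->
  measurable [set z : borel_space R d | A (u *: (z : V))].
Proof.
move=> mA; suff /(_ measurableT _ mA) : measurable_fun setT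
    ((fun z : V => u *: z) : borel_space R d -> borel_space R d) by rewrite setTI.
apply: measurable_borel_continuous => z e e0.
exists (e / (normc u + 1)); first by rewrite divr_gt0// ltr_wpDl ?normc_ge0.
move=> z'; rewrite ltr_pdivlMr ?ltr_wpDl ?normc_ge0// => zz'.
rewrite -scalerBr enormZ (le_lt_trans _ zz')// mulrC.
by rewrite ler_wpM2l ?enorm_ge0// lerDl.
Qed.

Let rotation_half (u : R[i]) (A : set (borel_space R d)) : normc u = 1 ->
  1 + complex.Re u != 0 -> measurable A ->
  sigma [set z | A (u *: (z : V))] = sigma A.
Proof.
move=> u1 uN mA; rewrite !sphere_measureE; congr (_ * _)%E.
have [mT pT] := preserves_rotate_upto (unimodularE u1) uN (leqnn d).
have uE : (complex.Re u +i* complex.Im u)%C = u by case: (u).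
rewrite -[RHS]pT; last first.
  apply: measurableI; last exact: measurable_unit_ball_tuple.
  by rewrite -[X in measurable X]setTI; exact: measurable_radial_proj.
congr (lebesgue_tuple _ _); apply/seteqP.
have e x : enorm (complex_vec (rotate_upto (complex.Re u) (complex.Im u) d x)) =
    enorm (complex_vec x : V).
  by rewrite complex_vec_rotate uE enormZ u1 mul1r.
have p x : radial_proj (rotate_upto (complex.Re u) (complex.Im u) d x) =
    u *: (radial_proj x : V).
  by rewrite /radial_proj e complex_vec_rotate uE !scalerA mulrC.
by split => x; rewrite /unit_ball_tuple /unit_ball /= p e.
Qed.

(** For [u = -1] the three shears degenerate, but [-1] is [i ^+ 2]. *)
Lemma sphere_measure_rotation (u : R[i]) (A : set (borel_space R d)) :
  normc u = 1 -> measurable A ->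
  sigma [set z | A (u *: (z : V))] = sigma A.
Proof.
move=> u1 mA; have [uN|/(rotation_half u1)] := eqVneq (1 + complex.Re u) 0; last exact.
have uE : u = (0 +i* 1)%C * (0 +i* 1)%C.
  have uR : complex.Re u = -1 by lra.
  have u0 : complex.Im u ^+ 2 = 0.
    by have := unimodularE u1; rewrite uR sqrrN expr1n; lra.
  move/eqP: u0; rewrite sqrf_eq0 => /eqP u0.
  by apply: complex_ext => /=; lra.
have i1 : normc (0 +i* 1)%C = 1 :> R by rewrite /normc expr0n expr1n add0r sqrtr1.
have iN : 1 + complex.Re (0 +i* 1)%C != 0 :> R by rewrite /= addr0 oner_eq0.
rewrite -[RHS](rotation_half i1 iN mA) -[RHS](rotation_half i1 iN); last exact: measurable_scale.
by congr (sigma _); apply/seteqP; split => z /=; rewrite scalerA -uE.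
Qed.

End SphereRotation.

(** * Derivatives of integrals over arcs *)

Section RealCalculus.
Context {R : realType}.
Local Notation mu := (@lebesgue_measure R).

Lemma is_derive_continuous (f df : R -> R) :
  (forall t : R, is_derive t 1 f (df t)) -> continuous f.
Proof.
by move=> dvf t; apply/differentiable_continuous/derivable1_diffP; have [] := dvf t.
Qed.

Lemma continuous_integrable_itv (f : R -> R) a b : continuous f ->
  mu.-integrable `[a, b] (EFin \o f).
Proof.
move=> cf; apply: continuous_compact_integrable; first exact: segment_compact.
exact: continuous_subspaceT.
Qed.

Lemma is_derive_shift (f : R -> R) (x c df : R) :
  is_derive (x + c) 1 f df -> is_derive x 1 (fun t => f (t + c)) df.
Proof.
move=> dfx; have d1 : is_derive x 1 (fun t : R => t + c) 1.
  have := @is_deriveD R R R id (cst c) x 1 1 0 _ _.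
  by rewrite addr0; apply.
by have := @is_derive1_comp R f (fun t => t + c) x df 1 dfx d1; rewrite mulr1.
Qed.

(** The integrals over the translates of [a, b] have, at the origin, both
derivatives: one under the integral sign, one by the fundamental theorem. *)
Lemma FTC2_bounded (v dv : R -> R) M a b : a < b ->
  (forall t : R, is_derive t 1 v (dv t)) -> (forall t, `|dv t| <= M) ->
  \int[mu]_(t in `[a, b]) dv t = v b - v a.
Proof.
move=> ab dvv dvM; have cv := is_derive_continuous dvv.
pose P x := \int[mu]_(t in `[a - 2, x]) v t.
have dP x : a - 2 < x -> is_derive x 1 P (v x).
  move=> ax; have [||||dPx PE] := @continuous_FTC1_closed R v (a - 2) x (x + 1).
  - by rewrite ltrDl.
  - exact: continuous_integrable_itv.
  - exact: ax.
  - exact: cv.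
  - by rewrite -PE derive1E; exact: DeriveDef.
pose F h := \int[mu]_(t in `[a, b]) v (t + h).
have FP h : -1 < h < 1 -> F h = P (b + h) - P (a + h).
  move=> /andP[h0 h1].
  have dPh t : a <= t -> is_derive t 1 (fun t => P (t + h)) (v (t + h)).
    by move=> at_; apply: is_derive_shift; apply: dP; lra.
  have := @continuous_FTC2 R (fun t => v (t + h)) (fun t => P (t + h)) a b ab.
  rewrite /F /Rintegral => ->//.
  - apply: continuous_subspaceT => t; apply: (@is_derive_continuous _ (fun t => dv (t + h))).
    by move=> s; exact: is_derive_shift.
  - split.
    + by move=> t; rewrite in_itv/= => /andP[/ltW at_ _]; have [] := dPh t at_.
    + have [/derivable1_diffP/differentiable_continuous cPh _] := dPh a (lexx a).
      exact: cvg_at_right_filter.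
    + have [/derivable1_diffP/differentiable_continuous cPh _] := dPh b (ltW ab).
      exact: cvg_at_left_filter.
  - move=> t; rewrite in_itv/= => /andP[/ltW at_ _].
    by have dPt := dPh t at_; rewrite derive1E derive_val.
have I0 : (`](-1 : R), 1[%classic : set R) 0 by rewrite /= in_itv/=; lra.
have dE h t : partial1of2 (fun h t => v (t + h)) h t = dv (t + h).
  rewrite partial1of2E.
  suff -> : (fun h => v (t + h)) = (fun h => v (h + t)).
    have := @is_derive_shift v h t (dv (t + h)).
    by rewrite addrC => /(_ (dvv _)) dh; rewrite derive_val.
  by apply/funext => k; rewrite addrC.
have := @cvg_differentiation_under_integral R _ _ mu (fun h t => v (t + h))
  `[a, b] (measurable_itv _) 0 (-1) 1 I0 _ _ (fun=> M) _ _ _.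
have h1 x : (`](-1 : R), 1[%classic : set R) x -> mu.-integrable `[a, b] (EFin \o (fun t => v (t + x))).
  move=> _; apply: continuous_integrable_itv => t.
  apply: (@is_derive_continuous _ (fun t => dv (t + x))) => s.
  exact: is_derive_shift.
have h2 x y : (`](-1 : R), 1[%classic : set R) x -> (`[a, b]%classic : set R) y -> derivable (fun h => v (y + h)) x 1.
  move=> _ _; suff -> : (fun h => v (y + h)) = (fun h => v (h + y)).
    by have [] := @is_derive_shift v x y _ (dvv _).
  by apply/funext => k; rewrite addrC.
have M0 : 0 <= M by rewrite (le_trans _ (dvM 0)).
have h3 : mu.-integrable `[a, b] (EFin \o fun=> M).
  by apply: continuous_integrable_itv; exact: cst_continuous.
have h4 x y : (`](-1 : R), 1[%classic : set R) x -> (`[a, b]%classic : set R) y ->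
    `|partial1of2 (fun h t => v (t + h)) x y| <= M.
  by move=> _ _; rewrite dE.
move=> /(_ h1 h2 (fun=> M0) h3 h4) cF.
have cP : h^-1 *: (F (h + 0) - F 0) @[h --> 0^'] --> v b - v a.
  have dPb := dP b ltac:(lra); have dPa := dP a ltac:(lra).
  have dPab : is_derive (0 : R) 1 (fun h => P (h + b) - P (h + a)) (v b - v a).
    apply: is_deriveB; apply: is_derive_shift; by rewrite add0r.
  have [dPabd dPabE] := dPab.
  have := dPabd; rewrite /derivable => /cvg_ex[l].
  move=> lc; have lE : l = v b - v a by rewrite -dPabE; apply/esym/cvg_lim.
  rewrite -lE; apply: cvg_trans lc; apply: near_eq_cvg; near=> h.
  rewrite /= addr0 [h *: 1]mulr1 addr0 !FP.
  - by rewrite !addr0 !add0r ![_ + h]addrC.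
  - by lra.
  - rewrite -ltr_norml; near: h; apply: dnbhs0_lt; exact: ltr01.
have := cvg_unique _ cF cP => /= <- //.
by apply: eq_Rintegral => t _; rewrite dE addr0.
Unshelve. all: by end_near.
Qed.

(** The derivative of the integral of [u] is an integral of [du], which is
also the [t]-derivative of the conjugate function [v]. *)
Lemma is_derive_integral_conjugate (u v du : R -> R -> R) l r y0 M a b :
  a < b -> l < y0 < r ->
  (forall y t : R, l < y < r -> is_derive y 1 (u ^~ t) (du y t)) ->
  (forall y, l < y < r -> continuous (u y)) ->
  (forall t : R, is_derive t 1 (v y0) (du y0 t)) ->
  (forall y t, l < y < r -> `|du y t| <= M) ->
  is_derive y0 1 (fun y => \int[mu]_(t in `[a, b]) u y t) (v y0 b - v y0 a).
Proof.
move=> ab y0lr dyu cu dtv duM.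
have I0 : (`]l, r[%classic : set R) y0 by rewrite /= in_itv.
have h1 x : (`]l, r[%classic : set R) x -> mu.-integrable `[a, b] (EFin \o u x).
  by rewrite /= in_itv => xlr; apply: continuous_integrable_itv; exact: cu.
have h2 x y : (`]l, r[%classic : set R) x -> (`[a, b]%classic : set R) y -> derivable (u ^~ y) x 1.
  by rewrite /= in_itv => xlr _; have [] := dyu x y xlr.
have dE y t : l < y < r -> partial1of2 u y t = du y t.
  by move=> ylr; have dd := dyu y t ylr; rewrite partial1of2E derive_val.
have M0 : 0 <= M by rewrite (le_trans _ (duM y0 0 y0lr)).
have h3 : mu.-integrable `[a, b] (EFin \o fun=> M).
  by apply: continuous_integrable_itv; exact: cst_continuous.
have h4 x y : (`]l, r[%classic : set R) x -> (`[a, b]%classic : set R) y -> `|partial1of2 u x y| <= M.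
  by rewrite /= in_itv => xlr _; rewrite dE// duM.
have dU := @derivable_under_integral R _ _ mu u `[a, b] (measurable_itv _)
  y0 l r I0 h1 h2 (fun=> M) (fun=> M0) h3 h4.
have UE := @differentiation_under_integral R _ _ mu u `[a, b] (measurable_itv _)
  y0 l r I0 h1 h2 (fun=> M) (fun=> M0) h3 h4.
apply: DeriveDef; first exact: dU.
rewrite -derive1E UE -(FTC2_bounded ab dtv (fun t => duM y0 t y0lr)).
by apply: eq_Rintegral => t _; rewrite dE.
Qed.

Lemma MVT_bound (f df : R -> R) (a b M : R) : a <= b ->
  (forall x : R, a <= x <= b -> is_derive x 1 f (df x)) ->
  (forall x, a <= x <= b -> `|df x| <= M) -> `|f b - f a| <= M * (b - a).
Proof.
move=> ab dff dfM.
have [||c cab ->] := @MVT_segment R f df a b ab.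
- by move=> x; rewrite in_itv/= => /andP[h1 h2]; apply: dff; rewrite !ltW.
- apply: continuous_in_subspaceT => x; rewrite inE/= in_itv/= => xab.
  by apply/differentiable_continuous/derivable1_diffP; have [] := dff x xab.
rewrite normrM [X in _ * X]ger0_norm ?subr_ge0// ler_wpM2r ?subr_ge0//.
by apply: dfM; rewrite in_itv/= in cab.
Qed.

End RealCalculus.

(** * Dyadic martingales and averages over arcs *)

Section DyadicMartingale.
Context {R : realType}.
Variables (A : nat -> nat -> R) (c : nat -> R) (a e : R).
Hypothesis e0 : 0 <= e.

(** [A n i] is the value on the [i]th dyadic block of level [n]. The leaf [l]
of level [n + K] lies in the block [l %/ 2 ^ (K - k)] of level [n + k], and
escapes when one of the blocks along this branch is far from [a]. *)
Definition escapes n K l :=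
  [exists k : 'I_K.+1, e < `|A (n + k) (l %/ 2 ^ (K - k)) - a|].

(** Kolmogorov's maximal inequality: a block whose value already deviates by
more than [e] from [a] is charged to its own square deviation, any other block
to its two halves, for which the square deviations add up by the parallelogram
identity. *)
Lemma dyadic_maximal_inequality N :
  (forall n i, (n < N)%N -> A n i *+ 2 = A n.+1 i.*2 + A n.+1 i.*2.+1) ->
  (forall n i, (n < N)%N -> `|A n.+1 i.*2 - A n i| <= c n) ->
  forall K n i, (n + K <= N)%N ->
  (\sum_(i * 2 ^ K <= l < i.+1 * 2 ^ K) escapes n K l)%:R * e ^+ 2 <=
  2 ^+ K * ((A n i - a) ^+ 2 + \sum_(k < K) c (n + k) ^+ 2).
Proof.
move=> mart incr; elim=> [|K ih] n i nKN.
  rewrite expn0 !muln1 big_nat1 expr0 mul1r big_ord0 addr0.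
  have [ei|] := boolP (escapes n 0 i); last by rewrite mul0r sqr_ge0.
  move: ei => /existsP[k]; rewrite (ord1 k) addn0 subn0 expn0 divn1 => ei.
  rewrite mul1r -[leRHS]real_normK ?num_real// lerXn2r ?nnegrE//.
  exact: ltW.
have [big|small] := ltP e `|A n i - a|.
  apply: (@le_trans _ _ (2 ^+ K.+1 * e ^+ 2)).
    rewrite ler_wpM2r ?sqr_ge0// -natrX ler_nat.
    apply: (@leq_trans (\sum_(i * 2 ^ K.+1 <= l < i.+1 * 2 ^ K.+1) 1)%N).
      by apply: leq_sum => l _; case: escapes.
    by rewrite sum_nat_const_nat muln1 mulSn addnK.
  rewrite ler_wpM2l ?exprn_ge0// (@le_trans _ _ ((A n i - a) ^+ 2))//.
    by rewrite -[leRHS]real_normK ?num_real// lerXn2r ?nnegrE// ltW.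
  by rewrite lerDl sumr_ge0// => k _; exact: sqr_ge0.
have esc l : (i * 2 ^ K.+1 <= l < i.+1 * 2 ^ K.+1)%N ->
    escapes n K.+1 l = escapes n.+1 K l.
  move=> lB; apply/existsP/existsP => -[k ek].
    case: (unliftP ord0 k) ek => [m ->|->].
      rewrite lift0 subSS => ek; exists m.
      by rewrite addSnnS.
    rewrite addn0 subn0.
    have -> : (l %/ 2 ^ K.+1)%N = i.
      apply/eqP; rewrite eqn_leq leq_divRL ?expn_gt0// -ltnS ltn_divLR ?expn_gt0//.
      by case/andP: lB => -> ->.
    by rewrite ltNge small.
  by exists (lift ord0 k); rewrite lift0 subSS -addSnnS.
rewrite big_nat; under eq_bigr do rewrite esc//.
rewrite -big_nat (@big_cat_nat _ _ _ (i.*2.+1 * 2 ^ K))/=; last 2 first.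
- by rewrite expnS mulnA muln2 leq_mul2r leqnSn orbT.
- by rewrite expnS mulnA muln2 leq_mul2r doubleS ltnS leqnSn orbT.
rewrite natrD mulrDl.
have nN : (n < N)%N by lia.
have e1 : (i * 2 ^ K.+1 = i.*2 * 2 ^ K)%N by rewrite expnS mulnA muln2.
have e2 : (i.+1 * 2 ^ K.+1 = i.*2.+2 * 2 ^ K)%N by rewrite expnS mulnA muln2 doubleS.
rewrite e1 e2.
have ih1 := ih n.+1 i.*2 ltac:(lia); have ih2 := ih n.+1 i.*2.+1 ltac:(lia).
apply: (le_trans (lerD ih1 ih2)); rewrite -mulrDr (exprS 2 K) -mulrA mulrCA ler_wpM2l ?exprn_ge0//.
rewrite big_ord_recl /= addn0.
have -> : \sum_(k < K) c (n + bump 0 k) ^+ 2 = \sum_(k < K) c (n.+1 + k) ^+ 2.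
  by apply: eq_bigr => k _; rewrite addSnnS.
set S := \sum_(k < K) _.
have := mart n i nN; have := incr n i nN; rewrite mulr2n.
set x := A n i; set y := A n.+1 i.*2; set z := A n.+1 i.*2.+1 => dyx yz.
have : (y - x) ^+ 2 <= c n ^+ 2.
  by rewrite -[leLHS]real_normK ?num_real// lerXn2r ?nnegrE// (le_trans _ dyx).
have -> : z = x *+ 2 - y by rewrite mulr2n yz addrAC subrr add0r.
by rewrite mulr2n; nra.
Qed.

End DyadicMartingale.

Section Strip.
Context {R : realType}.
Local Notation mu := (@lebesgue_measure R).

Definition pw (n : nat) : R := 2^-1 ^+ n.

Lemma pw_gt0 n : 0 < pw n. Proof. by rewrite exprn_gt0. Qed.

Lemma pwS n : pw n = pw n.+1 + pw n.+1.
Proof. by rewrite /pw exprS; set x := _ ^+ n; lra. Qed.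

Lemma pw_mul2X n : 2 ^+ n * pw n = 1.
Proof. by rewrite /pw -exprMn divff ?expr1n. Qed.

Lemma pw_le m n : (m <= n)%N -> pw n <= pw m.
Proof. by move=> mn; rewrite ler_wiXn2l// ?invr_ge0// invf_le1// ler1n. Qed.

(** [u + i v] is a holomorphic function of [- y + i t] on [0 < y], with
derivative [A + i B]. *)
Definition conjugate_pair (u v A B : R -> R -> R) := forall y t : R, 0 < y ->
  [/\ is_derive y 1 (u ^~ t) (- A y t), is_derive t 1 (u y) (- B y t),
      is_derive y 1 (v ^~ t) (- B y t) & is_derive t 1 (v y) (A y t)].

Lemma conjugate_pair_sym u v A B : conjugate_pair u v A B ->
  conjugate_pair v (fun y t => - u y t) B (fun y t => - A y t).
Proof.
move=> cp y t y0; have [h1 h2 h3 h4] := cp y t y0; split => //.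
- by rewrite opprK.
- exact: is_deriveN.
- by rewrite -[X in is_derive _ _ _ X]opprK; apply: is_deriveN; exact: h2.
Qed.

Variables (c : nat -> R).
Hypothesis c0 : forall n, 0 <= c n.
Hypothesis cD : forall m n, (m <= n)%N -> c n <= c m.

(** The second clause is the Bloch bound at height about [2 ^- n], with [c n] of
the order of the weight there. The first one makes the derivatives locally
bounded, as differentiation under the integral requires. *)
Definition derivative_bound (A B : R -> R -> R) :=
  (forall l : R, 0 < l -> exists M, forall y t, l < y ->
     `|A y t| <= M /\ `|B y t| <= M) /\
  (forall n y t, pw n.+1 <= y <= pw n ->
     `|A y t| <= c n * 2 ^+ n.+1 /\ `|B y t| <= c n * 2 ^+ n.+1).

Section Estimates.
Variables u v A B : R -> R -> R.
Hypothesis cp : conjugate_pair u v A B.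
Hypothesis dB : derivative_bound A B.

Lemma radial_increment n y y' t : pw n.+1 <= y <= pw n -> pw n.+1 <= y' <= pw n ->
  `|u y t - u y' t| <= c n.
Proof.
wlog yy' : y y' / y' <= y.
  move=> wl h1 h2; have [|/ltW] := leP y' y; first by move=> /wl; exact.
  by move=> /wl; rewrite distrC; exact.
move=> /andP[h1 h2] /andP[h3 h4].
apply: (@le_trans _ _ (c n * 2 ^+ n.+1 * (y - y'))).
  apply: (@MVT_bound R (u ^~ t) (fun y => - A y t)) => // x /andP[x1 x2].
    by have [] := cp t (lt_le_trans (pw_gt0 n.+1) (le_trans h3 x1)).
  by rewrite normrN; apply (dB.2 n); rewrite (le_trans h3 x1) (le_trans x2 h2).
apply: (@le_trans _ _ (c n * 2 ^+ n.+1 * pw n.+1)); last first.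
  by rewrite -mulrA pw_mul2X mulr1.
rewrite ler_wpM2l ?mulr_ge0 ?exprn_ge0//.
by have := pwS n; lra.
Qed.

(** An arc as long as its height is crossed at the cost of one derivative bound
times the length. *)
Lemma tangential_increment0 n t t' : `|t - t'| <= pw n ->
  `|u (pw n) t - u (pw n) t'| <= 2 * c n.
Proof.
wlog tt' : t t' / t' <= t.
  move=> wl h; have [|/ltW] := leP t' t; first by move=> /wl; exact.
  by move=> /wl h'; rewrite distrC; apply: h'; rewrite distrC.
rewrite ger0_norm ?subr_ge0// => tn.
apply: (@le_trans _ _ (c n * 2 ^+ n.+1 * (t - t'))).
  apply: (@MVT_bound R (u (pw n)) (fun t => - B (pw n) t)) => // x _.
    by have [] := cp x (pw_gt0 n).
  by rewrite normrN; apply (dB.2 n); rewrite lexx pw_le.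
apply: (@le_trans _ _ (c n * 2 ^+ n.+1 * pw n)).
  by rewrite ler_wpM2l ?mulr_ge0 ?exprn_ge0.
by rewrite exprS -mulrA -(mulrA 2) pw_mul2X; lra.
Qed.

Lemma radial_chain n k y t : pw (n + k).+1 <= y <= pw (n + k) ->
  `|u y t - u (pw n) t| <= k.+1%:R * c n.
Proof.
elim: k y => [|k ih] y.
  rewrite addn0 mul1r => yn; apply: radial_increment => //.
  by rewrite lexx pw_le.
move=> yk; rewrite (le_trans (ler_distD (u (pw (n + k.+1)) t) _ _))//.
rewrite -[k.+2%:R]natr1 addrC mulrDl mul1r lerD//.
  by apply: ih; rewrite addnS lexx pw_le.
rewrite (le_trans _ (cD (leq_addr k.+1 n)))//; apply: radial_increment => //.
by rewrite lexx pw_le.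
Qed.

(** Up to height [2 ^- n], across, and down again: a bound linear in [k], where
crossing at height [y] directly would cost a power of [2]. *)
Lemma tangential_increment n k y t t' :
  pw (n + k).+1 <= y <= pw (n + k) -> `|t - t'| <= pw n ->
  `|u y t - u y t'| <= (2 * k%:R + 4) * c n.
Proof.
move=> yk tt'; rewrite (le_trans (ler_distD (u (pw n) t) _ _))//.
have h1 := radial_chain t yk.
rewrite (le_trans (lerD h1 (ler_distD (u (pw n) t') _ _)))//.
have h2 := radial_chain t' yk; have h3 := tangential_increment0 tt'.
rewrite [X in _ + (_ + X)]distrC -natr1 in h1 h2 *; lra.
Qed.

End Estimates.

Section Averages.
Variables u v A B : R -> R -> R.
Hypothesis cp : conjugate_pair u v A B.
Hypothesis dB : derivative_bound A B.

Lemma derivative_bound_sym : derivative_bound B (fun y t => - A y t).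
Proof.
split=> [l l0|n y t yn].
  by have [M MP] := dB.1 l l0; exists M => y t ly; rewrite normrN; have [] := MP y t ly.
by rewrite normrN; have [] := dB.2 n y t yn.
Qed.

Let cont_u y : 0 < y -> continuous (u y).
Proof.
move=> y0; apply: (@is_derive_continuous _ _ (fun t => - B y t)) => t.
by have [] := cp t y0.
Qed.

Definition arc_integral y a b := \int[mu]_(t in `[a, b]) u y t.

(** By the Cauchy-Riemann equations the derivative in height of the integral of
[u] over an arc is the difference of [v] at its end points, which
[tangential_increment] controls. *)
Lemma arc_integral_increment n k a :
  `|arc_integral (pw (n + k)) a (a + pw n) -
    arc_integral (pw (n + k).+1) a (a + pw n)| <=
  pw (n + k).+1 * ((2 * k%:R + 4) * c n).
Proof.
rewrite mulrC.
have E : pw (n + k).+1 = pw (n + k) - pw (n + k).+1 by have := pwS (n + k); lra.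
rewrite [X in _ <= _ * X]E.
apply: (@MVT_bound R (fun y => arc_integral y a (a + pw n))
  (fun y => - v y (a + pw n) - - v y a)) => [|y /andP[y1 y2]|y yk].
- exact: pw_le.
- have [M MP] := dB.1 (pw (n + k).+2) (pw_gt0 _).
  have ly : pw (n + k).+2 < y.
    by have := pwS (n + k).+1; have := pw_gt0 (n + k).+2; lra.
  have y0 : 0 < y := lt_trans (pw_gt0 _) ly.
  apply: (@is_derive_integral_conjugate R u (fun y t => - v y t) (fun y t => - A y t)
    (pw (n + k).+2) (y + 1) y M) => [||z t /andP[z1 _]|z /andP[z1 _]|t|z t /andP[z1 _]].
  + by rewrite ltrDl pw_gt0.
  + by rewrite ly ltrDl ltr01.
  + by have [] := cp t (lt_trans (pw_gt0 _) z1).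
  + exact: cont_u (lt_trans (pw_gt0 _) z1).
  + by apply: is_deriveN; have [] := cp t y0.
  + by rewrite normrN; have [] := MP z t z1.
- rewrite -opprD normrN.
  have h := tangential_increment (conjugate_pair_sym cp) derivative_bound_sym.
  apply: (h n k y (a + pw n) a yk).
  by rewrite addrAC subrr add0r ger0_norm// ltW// pw_gt0.
Qed.

(** The bound sums the increments [pw (n + k).+1 * (2 k + 4) c n], whose closed
form is exactly the right-hand side; it stays below [6 c n pw n]. *)
Lemma arc_integral_telescope n K a :
  `|arc_integral (pw n) a (a + pw n) -
    arc_integral (pw (n + K)) a (a + pw n)| <=
  pw n * (c n * (6 - (2 * K%:R + 6) * pw K)).
Proof.
elim: K => [|K ih].
  by rewrite addn0 subrr normr0 /pw expr0 mulr1 mulr0 add0r subrr !mulr0.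
rewrite addnS.
rewrite (le_trans (ler_distD (arc_integral (pw (n + K)) a (a + pw n)) _ _))//.
rewrite (le_trans (lerD ih (arc_integral_increment n K a)))//.
have -> : pw (n + K).+1 = pw n * pw K.+1 by rewrite -addnS /pw exprD.
rewrite -!mulrA -mulrDr ler_wpM2l ?(ltW (pw_gt0 _))// (pwS K) -natr1 le_eqVlt.
by apply/orP; left; apply/eqP; ring.
Qed.

(** The average of [u] over an arc of length [2 ^- n] hardly depends on the
level at which it is taken below [2 ^- n]: moving the arc costs, by the
Cauchy-Riemann equations, only the increments of [v] at the two end points. *)
Lemma arc_average_close n K a t : a <= t <= a + pw n ->
  `|2 ^+ n * arc_integral (pw (n + K)) a (a + pw n) - u (pw n) t| <= 8 * c n.
Proof.
move=> /andP[t1 t2].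
have h1 : `|2 ^+ n * arc_integral (pw (n + K)) a (a + pw n) -
    2 ^+ n * arc_integral (pw n) a (a + pw n)| <= 6 * c n.
  rewrite -mulrBr normrM distrC [X in X * _]ger0_norm ?exprn_ge0//.
  rewrite (le_trans (ler_wpM2l _ (arc_integral_telescope n K a))) ?exprn_ge0//.
  rewrite (mulrA (2 ^+ n)) pw_mul2X mul1r mulrC ler_wpM2r// lerBlDr lerDl.
  by rewrite mulr_ge0 ?ltW ?pw_gt0//.
have h2 : `|2 ^+ n * arc_integral (pw n) a (a + pw n) - u (pw n) t| <= 2 * c n.
  have int : mu.-integrable `[a, a + pw n] (EFin \o u (pw n)).
    by apply: continuous_integrable_itv; exact: cont_u (pw_gt0 n).
  have icst x : mu.-integrable `[a, a + pw n] (EFin \o (cst x)).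
    by apply: continuous_integrable_itv; exact: cst_continuous.
  have Icst x : \int[mu]_(s in `[a, a + pw n]) cst x s = x * pw n.
    rewrite Rintegral_cst//= lebesgue_measure_itv/= lte_fin ltrDl pw_gt0.
    by rewrite -EFinB /= addrAC subrr add0r.
  have -> : u (pw n) t = 2 ^+ n * \int[mu]_(s in `[a, a + pw n]) (cst (u (pw n) t) s).
    by rewrite Icst mulrCA pw_mul2X mulr1.
  rewrite -mulrBr normrM [X in X * _]ger0_norm ?exprn_ge0// /arc_integral.
  rewrite -RintegralB//.
  have iB : mu.-integrable `[a, a + pw n] (EFin \o (fun s => u (pw n) s - u (pw n) t)).
    apply: continuous_integrable_itv => s; apply: continuousB; last exact: cst_continuous.
    exact: cont_u (pw_gt0 n) s.
  rewrite (le_trans (ler_wpM2l _ (le_normr_Rintegral _ iB))) ?exprn_ge0//.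
  apply: (@le_trans _ _ (2 ^+ n * \int[mu]_(s in `[a, a + pw n]) cst (2 * c n) s)).
    rewrite ler_wpM2l ?exprn_ge0//; apply: le_Rintegral => //.
      exact: integrable_norm iB.
    move=> s; rewrite /= in_itv/= => /andP[s1 s2].
    by apply: (tangential_increment0 cp dB); rewrite ler_norml; lra.
  by rewrite Icst mulrCA pw_mul2X mulr1.
by rewrite (le_trans (ler_distD _ _ _) (le_trans (lerD h1 h2) _))//; lra.
Qed.

End Averages.

End Strip.

(** * Deviations of a harmonic function over a grid *)

Definition deviates (R : realType) (u : R -> R -> R) n K (e t : R) :=
  [exists k : 'I_K.+1, e < `|u (pw (n + k)) t - u (pw n) t|].

Section StripCount.
Context {R : realType}.
Local Notation mu := (@lebesgue_measure R).
Variables (c : nat -> R).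
Hypothesis c0 : forall n, 0 <= c n.
Hypothesis cD : forall m n, (m <= n)%N -> c n <= c m.
Variables u v A B : R -> R -> R.
Hypothesis cp : conjugate_pair u v A B.
Hypothesis dB : derivative_bound c A B.
Local Notation pw := (@pw R).

Let cont_u y : 0 < y -> continuous (u y).
Proof.
move=> y0; apply: (@is_derive_continuous _ _ (fun t => - B y t)) => t.
by have [] := cp t y0.
Qed.

Lemma arc_integral_cat y a b d : 0 < y -> a <= b <= d ->
  arc_integral u y a d = arc_integral u y a b + arc_integral u y b d.
Proof.
move=> y0 /andP[ab bd]; have int a' b' : mu.-integrable `[a', b'] (EFin \o u y).
  by apply: continuous_integrable_itv; exact: cont_u.
apply/eqP; rewrite -subr_eq0 opprD addrA subr_eq0; apply/eqP.
rewrite /arc_integral.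
have := @Rintegral_itvB R (u y) (BLeft a) (BRight d) b (int a d).
rewrite !bnd_simp => /(_ ab bd) ->.
rewrite Rintegral_itv_obnd_cbnd//; apply: integrableS (int b d) => //.
exact: subset_itv_oc_cc.
Qed.

(** The averages of [u] over dyadic arcs, taken at one fixed small height, form
a dyadic martingale with increments at most [17 c n]; they differ from [u]
itself at the height of the arc by at most [8 c n <= e], so a deviation of [u]
by [3 e] forces one of the martingale by [e]. *)
Lemma strip_count n0 K e : 0 < e -> 8 * c n0 <= e ->
  (\sum_(l < 2 ^ K) deviates u n0 K (3 * e)%R (l%:R * pw (n0 + K)%N)%R)%:R
    * e ^+ 2 <=
  2 ^+ K * \sum_(k < K) (17 * c (n0 + k)) ^+ 2.
Proof.
move=> e0 ce; pose N := (n0 + K)%N.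
pose M n i := 2 ^+ n * arc_integral u (pw N) (i%:R * pw n) (i%:R * pw n + pw n).
have Mclose n i t : (n <= N)%N -> i%:R * pw n <= t <= i%:R * pw n + pw n ->
    `|M n i - u (pw n) t| <= 8 * c n.
  by move=> nN it; rewrite /M -(subnKC nN); apply: (arc_average_close c0 cD cp dB).
(* All the averages are taken at height [pw N], so that those over the two
   halves of an arc add up exactly. *)
have mart n i : (n < N)%N -> M n i *+ 2 = M n.+1 i.*2 + M n.+1 i.*2.+1.
  move=> nN; rewrite /M.
  rewrite (@arc_integral_cat _ _ (i%:R * pw n + pw n.+1)); last 2 first.
  - exact: pw_gt0.
  - by have := @pwS R n; have := @pw_gt0 R n.+1; lra.
  have l0 : i.*2%:R * pw n.+1 = i%:R * pw n :> R.
    by rewrite (@pwS R n) -muln2 natrM; ring.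
  have l1 : i.*2.+1%:R * pw n.+1 = i%:R * pw n + pw n.+1 :> R.
    by rewrite -[i.*2.+1%:R]natr1 mulrDl mul1r l0.
  have l2 : i%:R * pw n + pw n.+1 + pw n.+1 = i%:R * pw n + pw n :> R.
    by rewrite (@pwS R n); ring.
  by rewrite l0 l1 l2 exprSr -mulrnAl -mulrDr mulr_natr.
have incr n i : (n < N)%N -> `|M n.+1 i.*2 - M n i| <= 17 * c n.
  move=> nN; have p0 := @pw_gt0 R n; have p1 := @pw_gt0 R n.+1.
  have E : i.*2%:R * pw n.+1 = i%:R * pw n.
    by rewrite (@pwS R n) -muln2 natrM; ring.
  have h1 := Mclose n i (i%:R * pw n) (ltnW nN) ltac:(lra).
  have h2 := Mclose n.+1 i.*2 (i%:R * pw n) nN ltac:(lra).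
  have h3 : `|u (pw n.+1) (i%:R * pw n) - u (pw n) (i%:R * pw n)| <= c n.
    by apply: (radial_increment c0 cp dB); rewrite ?lexx ?pw_le.
  have h4 := cD (leqnSn n).
  rewrite (le_trans (ler_distD (u (pw n.+1) (i%:R * pw n)) _ _))//.
  rewrite (le_trans (lerD h2 (ler_distD (u (pw n) (i%:R * pw n)) _ _)))//.
  by rewrite [X in _ + (_ + X)]distrC; lra.
have := @dyadic_maximal_inequality R M (fun n => 17 * c n) (M n0 0%N) e (ltW e0)
  N mart incr K n0 0%N (leqnn _).
rewrite mul0n mul1n subrr expr0n add0r big_mkord; apply: le_trans.
rewrite ler_wpM2r ?sqr_ge0// ler_nat; apply: leq_sum => l _.
have [/existsP[k ek]|] := boolP (deviates _ _ _ _ _); last by [].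
suff -> : escapes M (M n0 0%N) e n0 K l by [].
apply/existsP; exists k; rewrite ltNge; apply/negP => small.
have kK : (k <= K)%N by rewrite -ltnS.
pose i := (l %/ 2 ^ (K - k))%N; pose t := l%:R * pw N.
have pN n : (n <= N)%N -> pw n = 2 ^+ (N - n) * pw N.
  move=> nN; have -> : pw N = pw n * pw (N - n) by rewrite /pw -exprD subnKC.
  by rewrite mulrCA pw_mul2X mulr1.
have tN n (nN : (n <= N)%N) (i' := (l %/ 2 ^ (N - n))%N) :
    i'%:R * pw n <= t <= i'%:R * pw n + pw n.
  rewrite (pN n nN) -[X in _ <= _ <= _ + X]mul1r -mulrDl natr1 !mulrA -!natrX -!natrM.
  rewrite /t !(ler_pM2r (pw_gt0 N)) !ler_nat leq_trunc_div/=.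
  by rewrite ltnW// ltn_ceil// expn_gt0.
have h1 := Mclose (n0 + k)%N i t ltac:(by rewrite leq_add2l) _.
have {}h1 := h1 ltac:(by have := tN (n0 + k)%N; rewrite /N subnDl leq_add2l; apply).
have h2 := Mclose n0 0%N t (leq_addr _ _) _.
have l0 : (l %/ 2 ^ K = 0)%N by rewrite divn_small.
have {}h2 := h2 ltac:(by have := tN n0 (leq_addr _ _); rewrite /N addKn l0).
have := cD (leq_addr k n0) => ck.
move: ek; rewrite ltNge => /negP; apply.
rewrite -/N -/t distrC.
rewrite (le_trans (ler_distD (M n0 0%N) _ _))// [X in X + _]distrC.
rewrite (le_trans (lerD h2 (ler_distD (M (n0 + k)%N i) _ _)))//.
by rewrite [X in _ + (X + _)]distrC; move: small; rewrite -/i; lra.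
Qed.

End StripCount.

(** * Holomorphic functions in polar coordinates *)

Section DerivativeApprox.
Context {R : realType}.

Lemma is_derive_approx (f : R -> R) (x D : R) : is_derive x 1 f D ->
  forall e : R, 0 < e -> exists2 r : R, 0 < r &
    forall h, `|h| < r -> `|f (x + h) - f x - h * D| <= e * `|h|.
Proof.
move=> [df dE] e e0; have /derivable1_diffP df' := df.
have /nbhs_ballP[r /= r0 rP] := differentiable_approx df' e0.
exists r => // h hr; have := rP h; rewrite /ball/= sub0r normrN => /(_ hr).
have -> : 'd f x h = h * D.
  by rewrite -dE deriveE// -[in LHS](mulr1 h) -[h * 1]/(h *: (1 : R)) linearZ.
by rewrite [h + x]addrC.
Qed.

Lemma approx_is_derive (f : R -> R) (x D : R) :
  (forall e : R, 0 < e -> exists2 r : R, 0 < r &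
    forall h, `|h| < r -> `|f (x + h) - f x - h * D| <= e * `|h|) ->
  is_derive x 1 f D.
Proof.
move=> fP.
have cv : h^-1 *: (f (h *: 1 + x) - f x) @[h --> 0^'] --> D.
  apply/cvgrPdist_le => e e0; have [r r0 rP] := fP e e0.
  near=> h; have h0 : h != 0 by near: h; exact: nbhs_dnbhs_neq.
  have hr : `|h| < r by near: h; apply: dnbhs0_lt.
  have := rP h hr; rewrite -[h *: 1]/(h * 1) mulr1 [h + x]addrC.
  have hi : 0 < `|h^-1| by rewrite normr_gt0 invr_eq0.
  rewrite -(ler_pM2l hi) -normrM => le; rewrite distrC.
  rewrite [X in `|X|](_ : _ = h^-1 * (f (x + h) - f x - h * D)); last first.
    by rewrite [in RHS]mulrBr mulKf.
  by rewrite (le_trans le)// mulrCA -normrM mulVf// normr1 mulr1.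
apply: DeriveDef; first by apply/cvg_ex; exists D.
exact: cvg_lim.
Unshelve. all: by end_near. Qed.

End DerivativeApprox.

Section PathDerivative.
Context {R : realType} {d : nat}.
Local Notation V := 'rV[R[i]]_d.

(** Chain rule along a path [l s *: zeta] in a complex line, from the epsilon
form of the gradient. *)
Lemma path_derivative_approx (f : V -> R[i]) (zeta : V) (lr li : R -> R)
    (s a b : R) c :
  has_gradient f ((lr s +i* li s)%C *: zeta) c ->
  is_derive s 1 lr a -> is_derive s 1 li b ->
  forall e : R, 0 < e -> exists2 r : R, 0 < r & forall h, `|h| < r ->
    normc (f ((lr (s + h) +i* li (s + h))%C *: zeta) -
      f ((lr s +i* li s)%C *: zeta) - h%:C%C * ((a +i* b)%C * grad_dot c zeta))
    <= e * `|h|.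
Proof.
move=> fc dr di e e0.
pose lam x := (lr x +i* li x)%C; pose p : R[i] := (a +i* b)%C.
pose E := enorm zeta + 1; pose P := normc p + 1; pose G := normc (grad_dot c zeta) + 1.
have E0 : 0 < E by rewrite ltr_wpDl ?enorm_ge0.
have P0 : 0 < P by rewrite ltr_wpDl ?normc_ge0.
have G0 : 0 < G by rewrite ltr_wpDl ?normc_ge0.
pose e1 := Num.min 1 (e / 2 / G) / 2.
have m0 : 0 < Num.min 1 (e / 2 / G) by rewrite lt_min ltr01 !divr_gt0.
have e10 : 0 < e1 by rewrite divr_gt0.
pose e2 := e / 2 / (P * E).
have e20 : 0 < e2 by rewrite !divr_gt0// mulr_gt0.
have [r1 r10 r1P] := is_derive_approx dr e10.
have [r2 r20 r2P] := is_derive_approx di e10.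
have [r3 r30 r3P] := fc _ e20.
exists (Num.min (Num.min r1 r2) (r3 / (P * E))).
  by rewrite !lt_min r10 r20 divr_gt0// mulr_gt0.
move=> h; rewrite !lt_min => /andP[/andP[hr1 hr2] hr3].
have lamh : normc (lam (s + h) - lam s - h%:C%C * p) <= 2 * e1 * `|h|.
  rewrite (le_trans (normc_leD _))// -mulrA mulr_natl mulr2n lerD//.
    by move: (r1P h hr1); rewrite /lam /p /= mul0r subr0.
  by move: (r2P h hr2); rewrite /lam /p /= mul0r addr0.
have e1E : 2 * e1 = Num.min 1 (e / 2 / G) by rewrite /e1 mulrC divfK ?pnatr_eq0.
have e11 : 2 * e1 <= 1 by rewrite e1E ge_min lexx.
have e1e : 2 * e1 * G <= e / 2.
  by rewrite e1E -ler_pdivlMr// ge_min lexx orbT.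
have lamP : normc (lam (s + h) - lam s) <= P * `|h|.
  rewrite -[X in normc X](subrK (h%:C%C * p)) (le_trans (le_normcD _ _))//.
  rewrite normcM normc_real /P mulrDl mul1r addrC mulrC lerD//.
  by rewrite (le_trans lamh)// ler_piMl.
have zP : enorm (lam (s + h) *: zeta - lam s *: zeta) <= P * E * `|h|.
  rewrite -scalerBl enormZ mulrAC (le_trans (ler_wpM2r (enorm_ge0 _) lamP))//.
  by rewrite ler_wpM2l ?mulr_ge0 ?(ltW P0)// /E lerDl.
have := r3P (lam (s + h) *: zeta).
rewrite -/(lam s) (le_lt_trans zP); last by rewrite mulrC -ltr_pdivlMr ?mulr_gt0.
move=> /(_ isT) fle.
have lamle : normc ((lam (s + h) - lam s - h%:C%C * p) * grad_dot c zeta) <= e / 2 * `|h|.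
  rewrite normcM (le_trans (ler_wpM2r (normc_ge0 _) lamh))//.
  rewrite mulrAC ler_wpM2r// (le_trans _ e1e)// ler_wpM2l ?e1E ?(ltW m0)//.
  by rewrite /G lerDl.
rewrite (_ : f _ - _ - _ = (f (lam (s + h) *: zeta) - f (lam s *: zeta) -
    grad_dot c (lam (s + h) *: zeta - lam s *: zeta)) +
    (lam (s + h) - lam s - h%:C%C * p) * grad_dot c zeta); last first.
  have -> : grad_dot c (lam (s + h) *: zeta - lam s *: zeta) =
      (lam (s + h) - lam s) * grad_dot c zeta.
    rewrite -scalerBl /grad_dot mulr_sumr; apply: eq_bigr => j _.
    by rewrite mxE mulrA.
  by rewrite /p /lam; ring.
have -> : e * `|h| = e / 2 * `|h| + e / 2 * `|h| by rewrite -mulrDl -splitr.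
rewrite (le_trans (le_normcD _ _))// lerD//.
rewrite (le_trans fle)// (le_trans (ler_wpM2l (ltW e20) zP))//.
by rewrite mulrA /e2 divfK// gt_eqF// mulr_gt0.
Qed.

Lemma is_derive_path (f : V -> R[i]) (zeta : V) (lr li : R -> R)
    (s a b : R) c :
  has_gradient f ((lr s +i* li s)%C *: zeta) c ->
  is_derive s 1 lr a -> is_derive s 1 li b ->
  is_derive s 1 (fun x => complex.Re (f ((lr x +i* li x)%C *: zeta)))
    (complex.Re ((a +i* b)%C * grad_dot c zeta)) /\
  is_derive s 1 (fun x => complex.Im (f ((lr x +i* li x)%C *: zeta)))
    (complex.Im ((a +i* b)%C * grad_dot c zeta)).
Proof.
move=> fc dr di; have ap := path_derivative_approx fc dr di.
split; apply: approx_is_derive => e e0; have [r r0 rP] := ap e e0;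
    exists r => // h hr; apply: le_trans (rP h hr).
- by rewrite (le_trans _ (normc_Re _))// !raddfB /= Re_mulr_real.
- by rewrite (le_trans _ (normc_Im _))// !raddfB /= Im_mulr_real.
Qed.

End PathDerivative.

Section Polar.
Context {R : realType} {d : nat}.
Local Notation V := 'rV[R[i]]_d.

Definition cis (t : R) : R[i] := (cos t +i* sin t)%C.

Lemma normc_cis t : normc (cis t) = 1.
Proof. by rewrite /normc /= cos2Dsin2 sqrtr1. Qed.

Definition polar (y t : R) : R[i] := (expR (- y) * cos t +i* (expR (- y) * sin t))%C.

Lemma polarE y t : polar y t = (expR (- y))%:C%C * cis t.
Proof. by apply: complex_ext => /=; ring. Qed.

Lemma normc_polar y t : normc (polar y t) = expR (- y).
Proof.
by rewrite polarE normcM normc_cis mulr1 normc_real ger0_norm// expR_ge0.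
Qed.

Lemma is_derive_polar_y (y t : R) :
  is_derive y 1 (fun y => expR (- y) * cos t) (- (expR (- y) * cos t)) /\
  is_derive y 1 (fun y => expR (- y) * sin t) (- (expR (- y) * sin t)).
Proof.
have dE : is_derive y 1 (fun y => expR (- y)) (- expR (- y)).
  have := @is_derive1_comp R expR -%R y _ _ (is_derive_expR _) (is_deriveNid _ _).
  by rewrite mulrN1.
have key k : is_derive y 1 (fun y => expR (- y) * k) (- (expR (- y) * k)).
  have := @is_deriveZ _ _ _ (fun y => expR (- y)) k y 1 _ dE.
  rewrite (_ : k \*: _ = (fun y => expR (- y) * k)); last first.
    by apply/funext => x; rewrite /= mulrC.
  by rewrite (_ : k *: _ = - (expR (- y) * k))// scalerN -[k *: _]/(k * _) mulrC.
by split; exact: key.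
Qed.

Lemma is_derive_polar_t (y t : R) :
  is_derive t 1 (fun t => expR (- y) * cos t) (- (expR (- y) * sin t)) /\
  is_derive t 1 (fun t => expR (- y) * sin t) (expR (- y) * cos t).
Proof.
split; last exact: is_deriveZ.
by rewrite -mulrN; exact: is_deriveZ.
Qed.

Variables (f : V -> R[i]) (zeta : V).
Hypothesis hf : holomorphic_ball f.
Hypothesis zeta1 : enorm zeta = 1.

Lemma unit_ball_polar y t : 0 < y -> unit_ball (polar y t *: zeta).
Proof.
by move=> y0; rewrite /unit_ball/= enormZ zeta1 mulr1 normc_polar expR_lt1 oppr_lt0.
Qed.

(** Along [- y + i t] the point [exp (- y + i t) zeta] moves with derivative
itself, so the holomorphic function obtained from [f] has derivative
[radial_derivative f]; its real and imaginary parts are thus conjugate. *)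
Lemma conjugate_pair_polar :
  conjugate_pair (fun y t => complex.Re (f (polar y t *: zeta)))
    (fun y t => complex.Im (f (polar y t *: zeta)))
    (fun y t => complex.Re (radial_derivative f (polar y t *: zeta)))
    (fun y t => complex.Im (radial_derivative f (polar y t *: zeta))).
Proof.
move=> y t y0; have [c fc ->] := differentiable_has_gradient (hf (unit_ball_polar t y0)).
have dl : grad_dot c (polar y t *: zeta) = polar y t * grad_dot c zeta.
  by rewrite /grad_dot mulr_sumr; apply: eq_bigr => j _; rewrite mxE mulrA.
have [yr yi] := is_derive_polar_y y t; have [tr ti] := is_derive_polar_t y t.
have [y1 y2] := @is_derive_path R d f zeta _ _ y _ _ c fc yr yi.
have [t1 t2] := @is_derive_path R d f zeta _ _ t _ _ c fc tr ti.
have ey : (- (expR (- y) * cos t) +i* - (expR (- y) * sin t))%C * grad_dot c zeta =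
    - (polar y t * grad_dot c zeta).
  by rewrite -[RHS]mulNr; congr (_ * _); apply: complex_ext.
have et : (- (expR (- y) * sin t) +i* (expR (- y) * cos t))%C * grad_dot c zeta =
    (0 +i* 1)%C * (polar y t * grad_dot c zeta).
  by rewrite mulrA; congr (_ * _); apply: complex_ext => /=; ring.
have e1 : complex.Re ((0 +i* 1)%C * (polar y t * grad_dot c zeta)) =
    - complex.Im (polar y t * grad_dot c zeta).
  by rewrite Re_mulc /=; ring.
have e2 : complex.Im ((0 +i* 1)%C * (polar y t * grad_dot c zeta)) =
    complex.Re (polar y t * grad_dot c zeta).
  by rewrite Im_mulc /=; ring.
rewrite ey !raddfN in y1 y2; rewrite et e1 in t1; rewrite et e2 in t2.
by rewrite dl; split.
Qed.

End Polar.

(** * Measure of the oscillation on the sphere *)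

Section SphereMeasurability.
Context {R : realType} {d : nat}.
Local Notation V := 'rV[R[i]]_d.

Lemma measurable_sphere :
  measurable ([set z : V | enorm z = 1] : set (borel_space R d)).
Proof.
rewrite -[X in measurable X]setCK; apply: measurableC.
apply: sub_sigma_algebra; rewrite openE => z /eqP zN1.
have e0 : 0 < `|enorm z - 1| by rewrite normr_gt0 subr_eq0.
apply/nbhs_enormP; exists `|enorm z - 1| => // z' zz' /= z'1.
have h1 := ler_enorm_distD z' z 0; have h2 := ler_enorm_distD z z' 0.
move: zz'; rewrite ltNge => /negP; apply.
rewrite !subr0 in h1 h2; rewrite enormBC in h1.
by rewrite ler_norml; apply/andP; split; lra.
Qed.

(** On the sphere the set coincides with an open set: continuity at the points
of the sphere puts them in the interior of the set where [h > a]. *)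
Lemma measurable_sphere_gt (h : V -> R) (a : R) :
  (forall z, enorm z = 1 -> forall e : R, 0 < e -> exists2 r : R, 0 < r &
     forall z', enorm (z' - z) < r -> `|h z' - h z| < e) ->
  measurable ([set z : V | enorm z = 1 /\ a < h z] : set (borel_space R d)).
Proof.
move=> hc.
rewrite (_ : mkset _ = [set z : V | enorm z = 1] `&`
    interior ([set z : V | a < h z])).
  apply: measurableI; first exact: measurable_sphere.
  by apply: sub_sigma_algebra; exact: open_interior.
apply/seteqP; split => z /= [z1].
  move=> az; split => //; apply/nbhs_enormP.
  have e0 : 0 < h z - a by rewrite subr_gt0.
  have [r r0 rP] := hc z z1 _ e0; exists r => // z' /rP.
  by rewrite ltr_norml => /andP[]; rewrite /=; lra.
by move=> /interior_subset.
Qed.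

Lemma holomorphic_scaled_continuous (f : V -> R[i]) (a : R[i]) :
  holomorphic_ball f -> normc a < 1 ->
  forall z, enorm z = 1 -> forall e : R, 0 < e -> exists2 r : R, 0 < r &
     forall z', enorm (z' - z) < r -> normc (f (a *: z') - f (a *: z)) < e.
Proof.
move=> hf a1 z z1 e e0.
have az : unit_ball (a *: z) by rewrite /unit_ball/= enormZ z1 mulr1.
have [r r0 rP] := differentiable_continuous_enorm (hf _ az) e0.
exists r => // z' zz'; apply: rP; rewrite -scalerBr enormZ (le_lt_trans _ zz')//.
by rewrite ler_piMl ?enorm_ge0// ltW.
Qed.

End SphereMeasurability.

(** The sum of the probabilities is the expectation of the number of sets to
which a point belongs. *)
Lemma sum_probability_le d (T : measurableType d) (R : realType)
    (P : probability T R) n (A : 'I_n -> set T) (b : R) :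
  (forall i, measurable (A i)) ->
  (forall x, (\sum_i (x \in A i))%:R <= b) ->
  (\sum_i P (A i) <= b%:E)%E.
Proof.
move=> mA Ab.
have -> : (\sum_i P (A i) = \int[P]_x \sum_i (\1_(A i) x)%:E)%E.
  rewrite ge0_integral_sum//; last first.
    by move=> i; apply/measurable_EFinP; exact: measurable_indic.
  by apply: eq_bigr => i _; rewrite integral_indic// setIT.
apply: (@le_trans _ _ (\int[P]_x (cst b%:E x))%E); last first.
  by rewrite integral_cst// -[leRHS]mule1 lee_wpmul2l ?probability_le1// lee_fin (le_trans _ (Ab point)).
apply: ge0_le_integral => //.
- by move=> x _; apply: sume_ge0 => i _; rewrite lee_fin.
- apply: emeasurable_sum => i; apply/measurable_EFinP; exact: measurable_indic.
- move=> x _; rewrite sumEFin lee_fin (le_trans _ (Ab x))// natr_sum.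
  by apply: ler_sum => i _; rewrite indicE.
Qed.

Section BlochBound.
Context {R : realType} {d : nat}.
Local Notation V := 'rV[R[i]]_d.
Variables (w : R -> R).
Hypothesis w_gt0 : forall t, 0 < t <= 1 -> 0 < w t.

Lemma bloch_space_bound (f : V -> R[i]) : bloch_space w f ->
  exists2 C : R, 0 <= C & forall z, unit_ball z ->
    normc (radial_derivative f z) <= C * (w (1 - enorm z) / (1 - enorm z)).
Proof.
move=> [hf]; rewrite /bloch_norm; set S := [set _ | _ in _]; move=> fin.
have Soo : (ereal_sup S < +oo)%E.
  by move: fin; case: (ereal_sup S) => [r _||_] //; rewrite ltry.
have S0 : S (normc (radial_derivative f 0) * (1 - enorm (0 : V)) / w (1 - enorm (0 : V)))%:E.
  by exists 0 => //; rewrite /unit_ball/= enorm0.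
have := ereal_sup_ubound S0; case E : (ereal_sup S) Soo => [C| |] // _.
rewrite lee_fin => C0; exists C.
  rewrite (le_trans _ C0)// enorm0 subr0 mulr1 divr_ge0 ?normc_ge0// ltW// w_gt0//.
  by rewrite ltr01 lexx.
move=> z bz; have z1 : 0 < 1 - enorm z by rewrite subr_gt0.
have wz : 0 < w (1 - enorm z) by rewrite w_gt0// z1 lerBlDr lerDl enorm_ge0.
have : S (normc (radial_derivative f z) * (1 - enorm z) / w (1 - enorm z))%:E by exists z.
move=> /ereal_sup_ubound; rewrite E lee_fin ler_pdivrMr// => h.
by rewrite mulrA ler_pdivlMr.
Qed.

Hypothesis w_incr : {in `]0, 1] &, {homo w : s t / s <= t}}.

Lemma expRN_le (y : R) : 0 <= y <= 1 -> expR (- y) <= 1 - y / 2.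
Proof.
move=> /andP[y0 y1]; have h := expR_ge1Dx y; have E0 := expR_ge0 (- y).
have E1 : expR (- y) * expR y = 1 by rewrite -expRD addNr expR0.
have Ey : expR (- y) * (1 + y) <= 1 by rewrite -[leRHS]E1 ler_wpM2l.
apply: (@le_trans _ _ (expR (- y) * ((1 + y) * (1 - y / 2)))).
  by rewrite ler_peMr//; nra.
by rewrite mulrA ler_piMl//; lra.
Qed.

(** At height [y] the point has norm [exp (- y)], at distance between [y / 2]
and [y] from the sphere for [y <= 1]; monotonicity of [w] then bounds
[w (1 - |z|) / (1 - |z|)] by [2 w (y) / y]. *)
Lemma derivative_bound_polar (f : V -> R[i]) (C : R) zeta : 0 <= C ->
  (forall z, unit_ball z ->
    normc (radial_derivative f z) <= C * (w (1 - enorm z) / (1 - enorm z))) ->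
  enorm zeta = 1 ->
  derivative_bound (fun n => 2 * C * w (pw n))
    (fun y t => complex.Re (radial_derivative f (polar y t *: zeta)))
    (fun y t => complex.Im (radial_derivative f (polar y t *: zeta))).
Proof.
move=> C0 fC z1.
have bnd y t : 0 < y -> normc (radial_derivative f (polar y t *: zeta)) <=
    C * (w (1 - expR (- y)) / (1 - expR (- y))).
  move=> y0; have := fC _ (unit_ball_polar z1 t y0).
  by rewrite enormZ z1 mulr1 normc_polar.
have RI y t M : normc (radial_derivative f (polar y t *: zeta)) <= M ->
  `|complex.Re (radial_derivative f (polar y t *: zeta))| <= M /\
  `|complex.Im (radial_derivative f (polar y t *: zeta))| <= M.
  by move=> h; split; apply: le_trans h; [exact: normc_Re|exact: normc_Im].
have e01 (y : R) : 0 < y -> 0 < 1 - expR (- y) <= 1.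
  by move=> y0; rewrite subr_gt0 expR_lt1 oppr_lt0 y0 lerBlDr lerDl expR_ge0.
split=> [l l0|n y t /andP[y1 y2]].
  exists (C * (w 1 / (1 - expR (- l)))) => y t ly; have y0 := lt_trans l0 ly.
  apply: RI; apply: (le_trans (bnd y t y0)); rewrite ler_wpM2l//.
  have /andP[ey0 ey1] := e01 y y0; have /andP[el0 el1] := e01 l l0.
  apply: ler_pM => //; first by rewrite ltW// w_gt0// ey0.
  - by rewrite invr_ge0 ltW.
  - by apply: w_incr; rewrite ?in_itv/= ?ltr01 ?lexx ?ey0.
  - by rewrite lef_pV2 ?posrE// lerB// ler_expR lerN2 ltW.
have y0 : 0 < y := lt_le_trans (pw_gt0 _) y1.
have p1 : pw n <= 1 :> R by have := @pw_le R 0 n isT; rewrite [X in _ <= X]expr0.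
apply: RI; apply: (le_trans (bnd y t y0)).
have -> : 2 * C * w (pw n) * 2 ^+ n.+1 = C * (2 * w (pw n) * 2 ^+ n.+1) by ring.
rewrite ler_wpM2l//.
have /andP[ey0 ey1] := e01 y y0.
have ele := @expRN_le y ltac:(lra); have ege := expR_ge1Dx (- y).
have wle : w (1 - expR (- y)) <= w (pw n).
  apply: w_incr; rewrite ?in_itv/= ?ey0 ?pw_gt0//; lra.
have wge : 0 < w (1 - expR (- y)) by rewrite w_gt0// ey0.
rewrite ler_pdivrMr//.
have X : 1 <= 2 ^+ n.+2 * (1 - expR (- y)).
  apply: (@le_trans _ _ (2 ^+ n.+2 * pw n.+2)); first by rewrite pw_mul2X.
  by rewrite ler_wpM2l ?exprn_ge0//; have := @pwS R n.+1; lra.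
rewrite (le_trans wle)// -[leLHS]mulr1.
rewrite [leRHS](_ : _ = w (pw n) * (2 ^+ n.+2 * (1 - expR (- y)))); last first.
  by rewrite (exprS _ n.+1); ring.
by rewrite ler_wpM2l// (le_trans _ wle)// ltW.
Qed.

End BlochBound.

Section RadialLimitsAE.
Context {R : realType} {d : nat}.
Local Notation V := 'rV[R[i]]_d.
Local Notation sigma := (sphere_measure R d).
Variables (f : V -> R[i]) (c : nat -> R).
Hypothesis hf : holomorphic_ball f.
Hypothesis c0 : forall n, 0 <= c n.
Hypothesis cD : forall m n, (m <= n)%N -> c n <= c m.
Hypothesis fc : forall zeta, enorm zeta = 1 -> derivative_bound c
  (fun y t => complex.Re (radial_derivative f (polar y t *: zeta)))
  (fun y t => complex.Im (radial_derivative f (polar y t *: zeta))).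

(** By rotation invariance only [t = 0] matters for a measure estimate; the
angle is what the counting estimate averages over. *)
Let g b (zeta : V) (y t : R) := cpart b (f (polar y t *: zeta)).

Lemma polar_cis (y t : R) : polar y t = polar y 0 * cis t.
Proof. by rewrite !polarE -mulrA; congr (_ * _); rewrite /cis cos0 sin0 mul1r. Qed.

Lemma g_cis b zeta y t : g b zeta y t = g b (cis t *: zeta) y 0.
Proof. by rewrite /g scalerA -polar_cis. Qed.

Definition oscillation b n K e : set (borel_space R d) :=
  [set zeta : V | enorm zeta = 1 /\ deviates (g b zeta) n K e 0].

Lemma measurable_oscillation b n K e : measurable (oscillation b n K e).
Proof.
rewrite (_ : oscillation b n K e = \bigcup_(k in [set k | (k <= K)%N])
  [set z : V | enorm z = 1 /\ e < `|g b z (pw (n + k)) 0 - g b z (pw n) 0|]).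
  apply: bigcup_measurable => k _; apply: measurable_sphere_gt => z z1 r r0.
  have r2 : 0 < r / 2 by rewrite divr_gt0.
  have pc m : normc (polar (pw m) 0) < 1 :> R.
    by rewrite normc_polar expR_lt1 oppr_lt0 pw_gt0.
  have [r3 r30 r3P] := holomorphic_scaled_continuous hf (pc (n + k)%N) z1 r2.
  have [r4 r40 r4P] := holomorphic_scaled_continuous hf (pc n) z1 r2.
  exists (Num.min r3 r4); first by rewrite lt_min r30.
  move=> z'; rewrite lt_min => /andP[/r3P h3 /r4P h4].
  rewrite (le_lt_trans (ler_dist_dist _ _))//.
  have := le_lt_trans (cpart_norm b _) h3; have := le_lt_trans (cpart_norm b _) h4.
  rewrite !cpartB /g => l1 l2.
  set x := cpart _ _ in l2 *; set x' := cpart _ _ in l2 *.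
  set y := cpart _ _ in l1 *; set y' := cpart _ _ in l1 *.
  rewrite (_ : _ - _ = (x - x') - (y - y')); last by ring.
  by rewrite (le_lt_trans (ler_normB _ _))// [r]splitr ltrD.
apply/seteqP; split => z /=.
  by move=> [z1 /existsP[k ek]]; exists k => //=; rewrite -ltnS.
move=> [k /= kK [z1 ek]]; split => //; apply/existsP.
by exists (Ordinal (kK : (k < K.+1)%N)).
Qed.

Lemma conjugate_pair_part b zeta : enorm zeta = 1 ->
  exists v A B, conjugate_pair (g b zeta) v A B /\ derivative_bound c A B.
Proof.
move=> z1; have cp := conjugate_pair_polar hf z1; have dB := fc z1.
case: b; last first.
  do 3 eexists; split; first exact: conjugate_pair_sym cp.
  exact: derivative_bound_sym dB.
by do 3 eexists; split; [exact: cp|exact: dB].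
Qed.

(** The rotations of the sphere by the angles [l * 2 ^- (n + K)] all preserve
[sigma], so the estimate holding on average over them holds for [sigma]. *)
Lemma oscillation_le b n K e : 0 < e -> 8 * c n <= e ->
  (sigma (oscillation b n K (3 * e)) <=
   (e ^- 2 * \sum_(k < K) (17 * c (n + k)) ^+ 2)%:E)%E.
Proof.
move=> e0 ce; set S := \sum_(k < K) _; set O := oscillation _ _ _ _.
pose A (l : 'I_(2 ^ K)) : set (borel_space R d) :=
  [set z : V | O (cis (l%:R * pw (n + K)) *: z)].
have mO : measurable O by exact: measurable_oscillation.
have e20 : 0 < e ^+ 2 by rewrite exprn_gt0.
have S0 : 0 <= S by apply: sumr_ge0 => k _; exact: sqr_ge0.
have dev_cis z t : deviates (g b z) n K (3 * e) t =
    deviates (g b (cis t *: z)) n K (3 * e) 0.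
  by rewrite /deviates; apply: eq_existsb => k; rewrite !(g_cis b z _ t).
have count z : (\sum_l (z \in A l))%:R <= 2 ^+ K * (S / e ^+ 2).
  rewrite mulrA ler_pdivlMr//.
  have [z1|z1] := eqVneq (enorm z) 1; last first.
    rewrite big1 ?mul0r ?mulr_ge0 ?exprn_ge0// => l _.
    rewrite memNset// => -[]; rewrite enormZ normc_cis mul1r.
    by move=> /eqP; rewrite (negPf z1).
  have [v [A' [B' [cp dB]]]] := conjugate_pair_part b z1.
  apply: le_trans (@strip_count _ _ c0 cD _ _ _ _ cp dB n K e e0 ce).
  rewrite ler_wpM2r ?(ltW e20)// ler_nat; apply: leq_sum => l _.
  by case: (boolP (_ \in _)) => // /set_mem[_]; rewrite -dev_cis => ->.
have := @sum_probability_le _ _ R sigma (2 ^ K) A _ _ count.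
rewrite (eq_bigr (fun=> sigma O)) => [|l _]; last first.
  exact: sphere_measure_rotation (normc_cis _) mO.
have fO : sigma O \is a fin_num by rewrite fin_num_measure.
rewrite -(fineK fO) sumEFin sumr_const card_ord -[_ *+ (2 ^ K)]mulr_natl natrX !lee_fin => h.
have := h _; rewrite ler_pM2l ?exprn_gt0// mulrC; apply => l.
exact: measurable_scale.
Qed.

End RadialLimitsAE.

(** * The weight integral and geometric scales *)

Section Weight.
Context {R : realType}.
Local Notation mu := (@lebesgue_measure R).
Variables (w : R -> R).
Hypothesis w_gt0 : forall t, 0 < t <= 1 -> 0 < w t.
Hypothesis w_incr : {in `]0, 1] &, {homo w : s t / s <= t}}.

(** Monotone functions are measurable because their superlevel sets are
intervals. *)
Lemma measurable_fun_superlevel_interval (D : set R) (f : R -> R) :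
  measurable D ->
  (forall a, is_interval [set t | D t /\ a < f t]) -> measurable_fun D f.
Proof.
move=> mD fi; apply: (measurability _ (RGenOInfty.measurableE R)) => //.
move=> _ [_ [a ->] <-]; rewrite (_ : _ `&` _ = [set t | D t /\ a < f t]).
  exact: is_interval_measurable.
by apply/seteqP; split => t /=; rewrite in_itv/= andbT.
Qed.

Let phi t := (w t ^+ 2 / t)%:E.

Lemma measurable_weight : measurable_fun (`]0, 1]%classic : set R) phi.
Proof.
apply/measurable_EFinP; apply: measurable_funM.
  apply: measurable_funX; apply: measurable_fun_superlevel_interval => //.
  move=> a x y /= [xD ax] [yD ay] z /andP[xz zy].
  have zD : z \in `]0, 1].
    move: xD yD; rewrite !in_itv/= => /andP[x0 _] /andP[_ y1].
    by rewrite (lt_le_trans x0 xz) (le_trans zy y1).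
  by split => //; rewrite (lt_le_trans ax)// w_incr.
apply: measurable_fun_superlevel_interval => //.
move=> a x y /= [xD ax] [yD ay] z /andP[xz zy].
move: xD yD; rewrite !in_itv/= => /andP[x0 _] /andP[y0 y1].
have z0 := lt_le_trans x0 xz; split; first by rewrite z0 (le_trans zy y1).
by rewrite (lt_le_trans ay)// lef_pV2 ?posrE.
Qed.

Lemma weight_ge0 (t : R) : 0 < t <= 1 -> (0 <= phi t)%E.
Proof. by move=> /andP[t0 _]; rewrite lee_fin divr_ge0 ?sqr_ge0// ltW. Qed.

Let sub1 (x y : R) : 0 < x -> y <= 1 ->
  `[x, y]%classic `<=` (`]0, 1]%classic : set R).
Proof.
move=> x0 y1 t /=; rewrite !in_itv/= => /andP[xt ty].
by rewrite (lt_le_trans x0 xt) (le_trans ty y1).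
Qed.

Lemma weight_integral_split (x y : R) : 0 < x -> x <= y -> y <= 1 ->
  weight_integral w x = (\int[mu]_(t in `[x, y[) phi t + weight_integral w y)%E.
Proof.
move=> x0 xy y1; rewrite /weight_integral.
rewrite (@itv_bndbnd_setU _ _ _ (BLeft y)) ?bnd_simp//.
have E : `[x, y[ `|` `[y, 1] = `[x, 1]%classic :> set R.
  by rewrite -(@itv_bndbnd_setU _ _ _ (BLeft y)) ?bnd_simp.
rewrite ge0_integral_setU//.
- by rewrite E; apply: measurable_funS measurable_weight => //; exact: sub1.
- by rewrite E => t /(sub1 x0 (lexx _)) /=; rewrite in_itv; exact: weight_ge0.
- apply/disj_setPS => t /= []; rewrite !in_itv/= => /andP[_ ty] /andP[yt _].
  by move: ty; rewrite ltNge yt.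
Qed.

Lemma weight_integral_ge0 (x : R) : 0 < x -> (0 <= weight_integral w x)%E.
Proof.
move=> x0; apply: integral_ge0 => t /(sub1 x0 (lexx _)) /=.
by rewrite in_itv; exact: weight_ge0.
Qed.

Let msub (x y : R) : 0 < x -> y <= 1 ->
  measurable_fun (`[x, y[%classic : set R) phi.
Proof.
move=> x0 y1; apply: measurable_funS measurable_weight => // t txy.
by apply: (sub1 x0 y1); exact: subset_itv_co_cc txy.
Qed.

Lemma weight_integral_piece (x y : R) : 0 < x -> x <= y -> y <= 1 ->
  ((w x ^+ 2 / y * (y - x))%:E <= \int[mu]_(t in `[x, y[) phi t <=
   (w y ^+ 2 / x * (y - x))%:E)%E.
Proof.
move=> x0 xy y1; have y0 := lt_le_trans x0 xy.
have cst_int k : (\int[mu]_(t in `[x, y[) (k%:E) = (k * (y - x))%:E)%E.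
  rewrite integral_cst//= lebesgue_measure_itv/= lte_fin.
  case: ltP => // yx; have -> : y = x by apply/eqP; rewrite eq_le xy yx.
  by rewrite subrr mulr0 mule0.
have wx0 : 0 < w x by rewrite w_gt0// x0 (le_trans xy).
have wy0 : 0 < w y by rewrite w_gt0// y0.
have tin t : `[x, y[%classic t -> [/\ 0 < t, x <= t, t <= y & t <= 1].
  rewrite /= in_itv/= => /andP[xt ty].
  by rewrite (lt_le_trans x0 xt) xt ltW//= (le_trans (ltW ty)).
apply/andP; split; rewrite -cst_int; apply: ge0_le_integral => //.
- by move=> t _; rewrite lee_fin divr_ge0 ?sqr_ge0// ltW.
- exact: msub.
- move=> t /tin[t0 xt ty t1]; rewrite lee_fin ler_pM ?sqr_ge0 ?invr_ge0 ?(ltW y0)//.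
    rewrite lerXn2r ?nnegrE ?(ltW wx0)//; last by apply: w_incr; rewrite ?in_itv/= ?x0 ?t0 ?(le_trans xy y1).
    by rewrite ltW// w_gt0// t0.
  by rewrite lef_pV2 ?posrE.
- by move=> t /tin[t0 _ _ t1]; apply: weight_ge0; rewrite t0.
- exact: msub.
- move=> t /tin[t0 xt ty t1]; have wt0 : 0 < w t by rewrite w_gt0// t0.
  rewrite lee_fin ler_pM ?sqr_ge0 ?invr_ge0 ?(ltW t0)//.
    rewrite lerXn2r ?nnegrE ?(ltW wt0) ?(ltW wy0)//.
    by apply: w_incr; rewrite ?in_itv/= ?y0 ?t0.
  by rewrite lef_pV2 ?posrE.
Qed.

Lemma weight_integral_decr (x y : R) : 0 < x -> x <= y -> y <= 1 ->
  (weight_integral w y <= weight_integral w x)%E.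
Proof.
move=> x0 xy y1; rewrite (weight_integral_split x0 xy y1) leeDr//.
have /andP[h _] := weight_integral_piece x0 xy y1; apply: le_trans h.
by rewrite lee_fin mulr_ge0 ?subr_ge0// divr_ge0 ?sqr_ge0// ltW// (lt_le_trans x0).
Qed.

(** The integral increases as [x] decreases to [0], so the limit is a
supremum. *)
Lemma weight_integral_lim :
  lim (weight_integral w x @[x --> 0^'+]) =
  ereal_sup (weight_integral w @` [set` `]0, 1[]).
Proof.
apply/cvg_lim => //.
apply: (@nonincreasing_at_right_cvge _ _ 0 (BLeft 1)); first by rewrite bnd_simp.
move=> x y; rewrite !in_itv/= => /andP[x0 _] /andP[_ y1] xy.
exact: weight_integral_decr (ltW y1).
Qed.

Variable q : R.
Hypothesis q1 : 1 < q.
Let x n := q^-1 ^+ n.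
Let q0 : 0 < q. Proof. exact: lt_trans q1. Qed.
Let x0 n : 0 < x n. Proof. by rewrite exprn_gt0// invr_gt0. Qed.
Let xS n : x n.+1 = x n / q. Proof. by rewrite /x exprSr. Qed.
Let xle n : x n.+1 <= x n.
Proof. by rewrite xS ler_pdivrMr// ler_peMr ?(ltW (x0 n))// ltW. Qed.
Let x1 n : x n <= 1.
Proof. by elim: n => [|n ih]; rewrite ?expr0// (le_trans (xle n)). Qed.

(** Over one ratio, from [x k.+1] to [x k], the integral of [1 / t] is between
[1 - q^-1] and [q - 1], and [w] lies between its values at the end points; the
integral thus compares with a geometric sum in both directions. *)
Lemma weight_sum_le n :
  ((\sum_(k < n) (1 - q^-1) * w (x k.+1) ^+ 2)%:E <= weight_integral w (x n))%E.
Proof.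
elim: n => [|n ih]; first by rewrite big_ord0 weight_integral_ge0.
rewrite big_ord_recr/= EFinD addeC (weight_integral_split (x0 n.+1) (xle n) (x1 n)).
rewrite leeD//; have /andP[h _] := weight_integral_piece (x0 n.+1) (xle n) (x1 n).
apply: le_trans h; rewrite lee_fin xS le_eqVlt; apply/orP; left; apply/eqP.
have := x0 n; have := q0; move: (x n) => t t0 qq0.
by field; rewrite !gt_eqF.
Qed.

Lemma weight_sum_ge n :
  (weight_integral w (x n) <= (\sum_(k < n) (q - 1) * w (x k) ^+ 2)%:E)%E.
Proof.
elim: n => [|n ih].
  rewrite big_ord0 /x expr0 /weight_integral.
  by rewrite set_itv1 integral_set1.
rewrite big_ord_recr/= EFinD addeC (weight_integral_split (x0 n.+1) (xle n) (x1 n)).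
rewrite leeD//; have /andP[_ h] := weight_integral_piece (x0 n.+1) (xle n) (x1 n).
apply: (le_trans h); rewrite lee_fin xS le_eqVlt; apply/orP; left; apply/eqP.
have := x0 n; have := q0; move: (x n) => t t0 qq0.
by field; rewrite !gt_eqF.
Qed.

Lemma weight_sum_bounded :
  (lim (weight_integral w x @[x --> 0^'+]) < +oo)%E ->
  exists M, forall n, \sum_(k < n) w (x k) ^+ 2 <= M.
Proof.
rewrite weight_integral_lim; set S := ereal_sup _ => Soo.
have le n : ((\sum_(k < n) (1 - q^-1) * w (x k.+1) ^+ 2)%:E <= S)%E.
  case: n => [|n].
    rewrite big_ord0 (@le_trans _ _ (weight_integral w (2^-1)))//.
      by rewrite weight_integral_ge0.
    by apply: ereal_sup_ubound; exists (2^-1) => //=; rewrite in_itv/=; lra.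
  apply: (le_trans (weight_sum_le n.+1)); apply: ereal_sup_ubound.
  exists (x n.+1) => //=; rewrite in_itv/= x0 (lt_le_trans _ (x1 n))//.
  by rewrite xS ltr_pdivrMr// ltr_pMr.
have S0 := le 0%N; rewrite big_ord0 in S0.
case: S Soo S0 le => [s| |]// _ _ le.
have q'0 : 0 < 1 - q^-1 by rewrite subr_gt0 invf_lt1.
exists (w 1 ^+ 2 + s / (1 - q^-1)) => -[|n].
  rewrite big_ord0 addr_ge0 ?sqr_ge0// divr_ge0 ?(ltW q'0)//.
  by have := le 0%N; rewrite big_ord0 lee_fin.
rewrite big_ord_recl; apply: lerD; first by rewrite /x expr0.
by have := le n; rewrite lee_fin -mulr_sumr mulrC -ler_pdivlMr.
Qed.

Lemma weight_sum_unbounded :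
  lim (weight_integral w x @[x --> 0^'+]) = +oo%E ->
  forall M, exists n, M < \sum_(k < n) w (x k) ^+ 2.
Proof.
rewrite weight_integral_lim => Soo M.
have q'0 : 0 < q - 1 by rewrite subr_gt0.
have : (((q - 1) * M)%:E < ereal_sup (weight_integral w @` [set` `]0%R, 1%R[]))%E.
  by rewrite Soo ltry.
move=> /ereal_sup_gt[_ [t /= tI <-] Mt].
have /andP[t0 t1] : 0 < t < 1 by rewrite in_itv/= in tI.
have [n xn] : exists n, x n <= t.
  have qi : `|q^-1| < 1 by rewrite ger0_norm ?invf_lt1// ltW// invr_gt0.
  have /cvgr0_norm_lt/(_ t t0)[n _ /(_ n (leqnn _)) /=] := cvg_expr qi.
  by rewrite ger0_norm ?(ltW (x0 n))// => /ltW; exists n.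
exists n; rewrite -(ltr_pM2l q'0) -lte_fin (lt_le_trans Mt)//.
rewrite mulr_sumr (le_trans _ (weight_sum_ge n))//.
exact: weight_integral_decr (x0 n) xn (ltW t1).
Qed.

End Weight.

(** * Existence of radial limits *)

Section RealSequences.
Context {R : realType}.

(** The limit along the [2 ^- n] exists by completeness; the values in between
follow since the [c n] tend to [0]. *)
Lemma dyadic_limit (G : R -> R) (c : nat -> R) :
  (forall e, 0 < e -> exists n, forall m, (n <= m)%N -> c m <= e) ->
  (forall n y, pw n.+1 <= y <= pw n -> `|G y - G (pw n)| <= c n) ->
  (forall e, 0 < e -> exists n, forall k, `|G (pw (n + k)) - G (pw n)| <= e) ->
  exists l : R, forall e : R, 0 < e -> exists2 n, (0 < n)%N &
    forall y, 0 < y <= pw n -> `|G y - l| < e.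
Proof.
move=> c_small osc cauchyG.
have : cvg (G (pw n) @[n --> \oo]).
  apply: cauchy_cvg; apply: cauchy_exP => e e0.
  have [n nP] := cauchyG (e / 2) ltac:(by rewrite divr_gt0).
  exists (G (pw n)); exists n => // m /= nm.
  rewrite /ball/= distrC -(subnKC nm) (le_lt_trans (nP _))//.
  by rewrite ltr_pdivrMr// ltr_pMr// ltr1n.
move=> /cvg_ex[l Gl]; exists l => e e0.
have e20 : 0 < e / 2 by rewrite divr_gt0.
have /cvgrPdist_lt/(_ _ e20)[n1 _ n1P] := Gl.
have [n2 n2P] := c_small _ e20.
exists (maxn n1 n2).+1 => // y /andP[y0 yn].
have [k /= yk] : exists k, pw k.+1 <= y.
  have qi : `|2^-1 : R| < 1 by rewrite ger0_norm ?invf_lt1 ?ltr1n.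
  have /cvgr0_norm_lt/(_ y y0)[k _ /(_ k.+1 (leqnSn _)) /=] := cvg_expr qi.
  by rewrite ger0_norm ?exprn_ge0// => /ltW; exists k.
pose N := (maxn n1 n2).+1.
have ex : exists m, pw (N + m).+1 <= y.
  by exists k; rewrite (le_trans _ yk)// pw_le// ltnS leq_addl.
have [i ym mmin] := ex_minnP ex.
have yle : y <= pw (N + i).
  case: i ym mmin => [|i] ym mmin; first by rewrite addn0.
  by rewrite leNgt; apply/negP; rewrite addnS => /ltW/mmin; rewrite ltnn.
have nm : (maxn n1 n2 < N + i)%N by rewrite leq_addr.
move: (N + i)%N ym yle nm => m ym yle nm.
rewrite (le_lt_trans (ler_distD (G (pw m)) _ _))// [e]splitr ler_ltD//.
  rewrite (le_trans (osc m y _)) ?ym//; apply: n2P.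
  by rewrite (leq_trans (leq_maxr n1 n2))// ltnW.
by rewrite distrC; apply: n1P => /=; rewrite (leq_trans (leq_maxl n1 n2))// ltnW.
Qed.

End RealSequences.

Section RadialLimit.
Context {R : realType} {d : nat}.
Local Notation V := 'rV[R[i]]_d.

Lemma has_radial_limit_polar (f : V -> R[i]) (zeta : V) :
  (forall b, exists l : R, forall e : R, 0 < e -> exists2 n, (0 < n)%N &
    forall y, 0 < y <= pw n -> `|cpart b (f (polar y 0 *: zeta)) - l| < e) ->
  has_radial_limit f zeta.
Proof.
move=> H; have [l1 l1P] := H true; have [l2 l2P] := H false.
apply/cvg_ex; exists (l1 +i* l2)%C => A /nbhs_normcP[e e0 sA].
have e20 : 0 < e / 2 by rewrite divr_gt0.
have [n1 _ n1P] := l1P _ e20; have [n2 _ n2P] := l2P _ e20.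
pose y0 : R := Num.min (pw n1) (pw n2).
have y00 : 0 < y0 by rewrite lt_min !pw_gt0.
suff : \forall r \near (1 : R)^'-, A (f (r%:C%C *: zeta)) by [].
near=> r; apply: sA.
have r1 : r < 1 by near: r; exact: nbhs_left_lt.
have ry : expR (- y0) < r.
  by near: r; apply: nbhs_left_gt; rewrite expR_lt1 oppr_lt0.
have r0 : 0 < r by apply: lt_trans ry; exact: expR_gt0.
pose y := - ln r.
have ey : expR (- y) = r by rewrite opprK lnK.
have yy : 0 < y <= y0.
  rewrite oppr_gt0 ln_lt0 ?r0//= -lerN2 opprK -ler_expR lnK//.
  exact: ltW.
have -> : r%:C%C = polar y 0.
  by rewrite polarE ey; rewrite /cis cos0 sin0 mulr1.
case/andP: yy => yp; rewrite /y0 le_min => /andP[h1 h2].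
rewrite (le_lt_trans (normc_leD _))// [e]splitr ltrD//.
  by have := n1P y; rewrite yp h1 raddfB /=; apply.
by have := n2P y; rewrite yp h2 raddfB /=; apply.
Unshelve. all: by end_near.
Qed.

End RadialLimit.

Section RadialLimitsAE.
Context {R : realType} {d : nat}.
Local Notation V := 'rV[R[i]]_d.
Local Notation sigma := (sphere_measure R d).
Variables (f : V -> R[i]) (c : nat -> R).
Hypothesis hf : holomorphic_ball f.
Hypothesis c0 : forall n, 0 <= c n.
Hypothesis cD : forall m n, (m <= n)%N -> c n <= c m.
Hypothesis fc : forall zeta, enorm zeta = 1 -> derivative_bound c
  (fun y t => complex.Re (radial_derivative f (polar y t *: zeta)))
  (fun y t => complex.Im (radial_derivative f (polar y t *: zeta))).
Variable B : R.
Hypothesis csum : forall n, \sum_(k < n) c k ^+ 2 <= B.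

Let c_small e : 0 < e -> exists n, forall m, (n <= m)%N -> c m <= e.
Proof.
move=> e0; have [N NP] := @sum_bounded_tail R (fun n => c n ^+ 2) B (e ^+ 2)
  (fun n => sqr_ge0 _) csum (exprn_gt0 _ e0).
exists N => m Nm; have := NP 1%N; rewrite big_ord1 addn0 => cN.
by rewrite (le_trans (cD Nm))// -(ler_sqr _ _) ?nnegrE ?c0// ltW.
Qed.

(** Failure of the Cauchy condition along the radii [exp (- 2 ^- n)], for the
precision [e]. *)
Definition oscillating b e : set (borel_space R d) :=
  \bigcap_n \bigcup_K oscillation f b n K e.

(** By [oscillation_le] the measure of the oscillation beyond level [n] is at
most a tail of the convergent sum of the [c k ^ 2]. *)
Lemma oscillating_null b (e : R) : 0 < e -> sigma.-negligible (oscillating b (3 * e)).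
Proof.
move=> e0; exists (oscillating b (3 * e)).
have mU n : measurable (\bigcup_K oscillation f b n K (3 * e)).
  by apply: bigcup_measurable => K _; exact: measurable_oscillation.
have mO : measurable (oscillating b (3 * e)).
  by apply: bigcap_measurable => // n _.
split => //; apply/eqP; rewrite eq_le measure_ge0 andbT.
apply/lee_addgt0Pr => eta eta0; rewrite add0e.
have h0 : 0 < eta * e ^+ 2 / 17 ^+ 2 by rewrite divr_gt0// mulr_gt0// exprn_gt0.
have [N1 N1P] := @sum_bounded_tail R (fun n => c n ^+ 2) B _
  (fun n => sqr_ge0 _) csum h0.
have [N2 N2P] := c_small (divr_gt0 e0 (ltr0n _ 8)).
pose n := (N1 + N2)%N.
apply: (@le_trans _ _ (sigma (\bigcup_K oscillation f b n K (3 * e)))).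
  by apply: le_measure; rewrite ?inE//; exact: bigcap_inf.
have nd : nondecreasing_seq (fun K => oscillation f b n K (3 * e)).
  move=> K L KL; apply/subsetPset => z [z1 /existsP[k ek]]; split => //.
  apply/existsP; exists (widen_ord (KL : (K.+1 <= L.+1)%N) k).
  exact: ek.
have cvO := @nondecreasing_cvg_mu _ _ _ sigma _
  (fun K => measurable_oscillation hf b n K (3 * e)) (mU n) nd.
rewrite -(cvg_lim _ cvO)//.
apply: lime_le.
  apply: ereal_nondecreasing_is_cvgn => K L KL.
  apply: le_measure; rewrite ?inE; [exact: measurable_oscillation..|].
  exact/subsetPset/nd.
apply: nearW => K /=.
have ce : 8 * c n <= e.
  by rewrite mulrC -ler_pdivlMr// N2P// leq_addl.
apply: (le_trans (oscillation_le hf c0 cD fc b K e0 ce)).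
rewrite lee_fin mulrC ler_pdivrMr ?exprn_gt0//.
under eq_bigr do rewrite exprMn.
rewrite -mulr_sumr mulrC -ler_pdivlMr ?exprn_gt0//.
apply: le_trans (N1P (N2 + K)%N).
rewrite [leRHS]big_split_ord/= ler_wpDl ?sumr_ge0// => [k _|]; first exact: sqr_ge0.
by apply: ler_sum => k _; rewrite addnA.
Qed.

Lemma radial_limits_ae :
  {ae sigma, forall z, unit_sphere z -> has_radial_limit f z}.
Proof.
pose Z := \bigcup_j (oscillating true (3 * j.+1%:R^-1) `|`
  oscillating false (3 * j.+1%:R^-1)).
apply: (@negligibleS _ _ _ _ Z); last first.
  apply: negligible_bigcup => j; have j0 : 0 < j.+1%:R^-1 :> R by rewrite invr_gt0.
  by apply: negligibleU; exact: oscillating_null.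
move=> z /=; apply: contra_notP => nZ z1.
apply: has_radial_limit_polar => b.
have nO j : ~ oscillating b (3 * j.+1%:R^-1) z.
  by move=> Oz; apply: nZ; exists j => //; case: b Oz; [left|right].
have [v [A' [B' [cp dB]]]] := conjugate_pair_part hf fc b z1.
apply: (@dyadic_limit R _ c).
- exact: c_small.
- move=> n y yn; apply: (radial_increment c0 cp dB 0 yn).
  by rewrite lexx pw_le.
- move=> e e0.
  have [j je] : exists j : nat, 3 * j.+1%:R^-1 <= e.
    have [j] := ltr_add_invr (ltac:(by rewrite divr_gt0) : 0 < e / 3 :> R).
    rewrite add0r => je; exists j.
    by rewrite mulrC -ler_pdivlMr// ltW.
  have /existsNP[n] := nO j; move=> /not_implyP[_ nU].
  exists n => k; apply: le_trans je; rewrite leNgt; apply/negP => big.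
  apply: nU; exists k => //; split => //; apply/existsP; exists ord_max.
  exact: big.
Qed.

End RadialLimitsAE.

Section PartOne.
Context {R : realType} {d : nat}.
Variables (w : R -> R).
Hypothesis w_gt0 : forall t, 0 < t <= 1 -> 0 < w t.
Hypothesis w_incr : {in `]0, 1] &, {homo w : s t / s <= t}}.

(** The weights [w (2 ^- n)], up to a constant, are the [c n] of
[radial_limits_ae], and they are square-summable since the integral is
finite. *)
Theorem bloch_radial_limits (f : 'rV[R[i]]_d -> R[i]) :
  (lim (weight_integral w x @[x --> 0^'+]) < +oo)%E -> bloch_space w f ->
  {ae sphere_measure R d, forall z, unit_sphere z -> has_radial_limit f z}.
Proof.
move=> I0 fB; have hf := fB.1; have [C C0 fC] := bloch_space_bound w_gt0 fB.
have [M wM] := weight_sum_bounded w_gt0 w_incr (ltr1n R 2) I0.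
have pw01 n : 0 < (pw n : R) <= 1.
  by rewrite pw_gt0; have := @pw_le R 0 n isT; rewrite [X in _ <= X]expr0.
have wpw n : 0 < w (pw n) by exact: w_gt0.
apply: (@radial_limits_ae _ _ f (fun n => 2 * C * w (pw n)) hf _ _ _ ((2 * C) ^+ 2 * M)).
- by move=> n; rewrite !mulr_ge0// ltW.
- move=> m n mn; rewrite ler_wpM2l ?mulr_ge0//; apply: w_incr; rewrite ?in_itv/= ?pw01//.
  exact: pw_le.
- by move=> zeta z1; exact: derivative_bound_polar.
- move=> n; under eq_bigr do rewrite exprMn.
  by rewrite -mulr_sumr ler_wpM2l ?sqr_ge0//; exact: wM.
Qed.

End PartOne.

(** * Distance between circles *)

Section ProjectiveDistance.
Context {R : realType} {d : nat}.
Local Notation V := 'rV[R[i]]_d.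
Implicit Types z u w : V.

(** The distance between the circles [e^(i t) z] and [e^(i t) w]. *)
Definition pdist z w : R := Num.sqrt (2 - 2 * normc (cdot z w)).

Lemma pdist_ge0 z w : 0 <= pdist z w.
Proof. exact: sqrtr_ge0. Qed.

Lemma cdot_unit_le1 z w : enorm z = 1 -> enorm w = 1 -> normc (cdot z w) <= 1.
Proof. by move=> z1 w1; have := cauchy_schwarz z w; rewrite z1 w1 mulr1. Qed.

Lemma sqr_pdist z w : enorm z = 1 -> enorm w = 1 ->
  pdist z w ^+ 2 = 2 - 2 * normc (cdot z w).
Proof. by move=> z1 w1; rewrite sqr_sqrtr//; have := cdot_unit_le1 z1 w1; lra. Qed.

(** The minimizing phase is that of the product [cdot z w]. *)
Lemma pdist_phase z w : enorm z = 1 -> enorm w = 1 ->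
  exists2 l : R[i], normc l = 1 & enorm (z - l *: w) = pdist z w.
Proof.
move=> z1 w1; set c := cdot z w.
have [l l1 lc] : exists2 l : R[i], normc l = 1 & conjc l * c = (normc c)%:C%C.
  have [c0|c0] := eqVneq c 0.
    by exists 1; rewrite ?normc1// c0 mulr0 normc0.
  have nc0 : normc c != 0 by apply: contra c0 => /eqP/eq0_normc ->.
  exists ((normc c)^-1%:C%C * c).
    by rewrite normcM normc_real ger0_norm ?invr_ge0 ?normc_ge0// mulVf.
  rewrite (_ : conjc _ = (normc c)^-1%:C%C * conjc c); last first.
    by case: (c) => a b; apply: complex_ext => /=; ring.
  have -> : (normc c)^-1%:C%C * conjc c * c = ((normc c)^-1 * normc c ^+ 2)%:C%C.
    by rewrite sqr_normcE; case: (c) => a b; apply: complex_ext => /=; ring.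
  by rewrite expr2 mulKf.
exists l => //; apply/eqP; rewrite -(@eqrXn2 _ 2)// ?enorm_ge0 ?pdist_ge0//.
rewrite sqr_pdist// sqr_enormB enormZ l1 z1 w1 !mul1r expr1n cdotZr -/c lc /=.
by apply/eqP; ring.
Qed.

Lemma pdist_le z w (l : R[i]) : enorm z = 1 -> enorm w = 1 -> normc l = 1 ->
  pdist z w <= enorm (z - l *: w).
Proof.
move=> z1 w1 l1; rewrite -(ler_sqr) ?nnegrE ?pdist_ge0 ?enorm_ge0//.
rewrite sqr_pdist// sqr_enormB enormZ l1 z1 w1 !mul1r expr1n cdotZr.
have := normc_Re (conjc l * cdot z w); rewrite normcM normc_conj l1 mul1r.
by rewrite ler_norml => /andP[_]; lra.
Qed.

Lemma pdist_le_enorm z w : enorm z = 1 -> enorm w = 1 -> pdist z w <= enorm (z - w).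
Proof. by move=> z1 w1; have := pdist_le z1 w1 (@normc1 R); rewrite scale1r. Qed.

Lemma pdistC z w : pdist z w = pdist w z.
Proof. by rewrite /pdist (cdotC z w) normc_conj. Qed.

Lemma pdist_triangle z u w : enorm z = 1 -> enorm u = 1 -> enorm w = 1 ->
  pdist z w <= pdist z u + pdist u w.
Proof.
move=> z1 u1 w1; have [l l1 <-] := pdist_phase z1 u1.
have [k k1 <-] := pdist_phase u1 w1.
have lk1 : normc (l * k) = 1 by rewrite normcM l1 k1 mulr1.
rewrite (le_trans (pdist_le z1 w1 lk1))//.
rewrite (le_trans (ler_enorm_distD (l *: u) _ _))// lerD2l.
by rewrite -scalerA -scalerBr enormZ l1 mul1r.
Qed.

(** The power of a product of unit vectors is a Gaussian in [pdist]: a peak of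
width [n ^- 1/2] around the circle of [w]. *)
Lemma normc_cdot_exp z w n : enorm z = 1 -> enorm w = 1 ->
  normc (cdot z w) ^+ n <= expR (- (n%:R * (pdist z w ^+ 2 / 2))).
Proof.
move=> z1 w1; rewrite -mulrN expRM_natl lerXn2r ?nnegrE ?normc_ge0 ?expR_ge0//.
have := expR_ge1Dx (- (pdist z w ^+ 2 / 2)); apply: le_trans.
by rewrite sqr_pdist//; lra.
Qed.

Lemma normc_cdot_bernoulli z w n : enorm z = 1 -> enorm w = 1 ->
  1 - n%:R * (pdist z w ^+ 2 / 2) <= normc (cdot z w) ^+ n.
Proof.
move=> z1 w1; have c1 := cdot_unit_le1 z1 w1; have c0 := normc_ge0 (cdot z w).
have -> : pdist z w ^+ 2 / 2 = 1 - normc (cdot z w) by rewrite sqr_pdist//; lra.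
move: (normc _) c0 c1 => x x0 x1; elim: n => [|n ih]; first by rewrite mul0r subr0 expr0.
rewrite exprS -natr1; have : x * (1 - n%:R * (1 - x)) <= x * x ^+ n by rewrite ler_wpM2l.
have : 0 <= n%:R * ((1 - x) * (1 - x)) :> R.
  by rewrite !mulr_ge0// subr_ge0.
by lra.
Qed.

(** On vectors whose [j]th coordinate is real and bounded below, the phase is
determined by that coordinate, so [pdist] dominates the distance. *)
Definition in_chart (j : 'I_d) z :=
  enorm z = 1 /\ exists2 x : R, d%:R^-1 <= x & z 0 j = x%:C%C.

Lemma chart_dist j z w : in_chart j z -> in_chart j w ->
  enorm (z - w) <= (1 + 2 * d%:R) * pdist z w.
Proof.
move=> [z1 [x xd zx]] [w1 [y yd wy]].
have d0 : 0 < d%:R^-1 :> R by rewrite invr_gt0 ltr0n (leq_ltn_trans _ (ltn_ord j)).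
have [l l1 ls] := pdist_phase z1 w1; set s := pdist z w in ls *.
have x0 : 0 < x := lt_le_trans d0 xd; have y0 : 0 < y := lt_le_trans d0 yd.
have h1 : normc (x%:C%C - l * y%:C%C) <= s.
  by rewrite -ls; have := normc_coord (z - l *: w) j; rewrite !mxE zx wy.
have h2 : normc (x%:C%C - y%:C%C) <= s.
  rewrite -rmorphB normc_real; apply: le_trans h1.
  have n1 := le_normcD (x%:C%C - l * y%:C%C) (l * y%:C%C).
  have n2 := le_normcD (l * y%:C%C - x%:C%C) x%:C%C.
  rewrite !subrK normcM l1 mul1r !normc_real !gtr0_norm// in n1 n2.
  by rewrite normcBC in n2; rewrite ler_norml; apply/andP; split; lra.
have h3 : normc (l - 1) * d%:R^-1 <= 2 * s.
  apply: (@le_trans _ _ (normc (l - 1) * normc y%:C%C)).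
    by rewrite normc_real gtr0_norm// ler_wpM2l// normc_ge0.
  rewrite -normcM mulrBl mul1r (le_trans (ler_normc_distD x%:C%C _ _))//.
  by rewrite normcBC; lra.
have h4 : normc (l - 1) <= 2 * d%:R * s.
  by move: h3; rewrite ler_pdivrMr ?[2 * s * _]mulrAC// -invr_gt0.
rewrite (le_trans (ler_enorm_distD (l *: w) _ _))// ls mulrDl mul1r lerD2l.
by rewrite -[X in _ - X]scale1r -scalerBl enormZ w1 mulr1.
Qed.

(** Some coordinate has modulus at least [1 / d]; a rotation makes it real. *)
Lemma exists_chart z : (0 < d)%N -> enorm z = 1 ->
  exists j, exists2 l : R[i], normc l = 1 & in_chart j (l *: z).
Proof.
move=> d0 z1; have dR : 0 < d%:R :> R by rewrite ltr0n.
have [j jd] : exists j, d%:R^-1 <= normc (z 0 j).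
  apply/not_existsP => H; have := enorm_le_sum z; rewrite z1 leNgt => /negP; apply.
  apply: (@lt_le_trans _ _ (\sum_(j < d) d%:R^-1)); last first.
    by rewrite sumr_const card_ord -[_ *+ d]mulr_natl divff// gt_eqF.
  apply: ltr_sum => [|j _]; last by rewrite ltNge; apply/negP.
  by apply/hasP; exists (Ordinal d0) => //; rewrite mem_index_enum.
have zj0 : 0 < normc (z 0 j) by apply: lt_le_trans jd; rewrite invr_gt0.
exists j, ((normc (z 0 j))^-1%:C%C * conjc (z 0 j)).
  by rewrite normcM normc_conj normc_real ger0_norm ?invr_ge0 ?ltW// mulVf// gt_eqF.
split; first by rewrite enormZ z1 mulr1 normcM normc_conj normc_real ger0_norm ?invr_ge0 ?ltW// mulVf// gt_eqF.
exists (normc (z 0 j)) => //; rewrite !mxE.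
have -> : (normc (z 0 j))^-1%:C%C * conjc (z 0 j) * z 0 j =
    ((normc (z 0 j))^-1 * normc (z 0 j) ^+ 2)%:C%C.
  by rewrite sqr_normcE; case: (z 0 j) => a b; apply: complex_ext => /=; ring.
by rewrite expr2 mulKf// gt_eqF.
Qed.

End ProjectiveDistance.

(** * Separated cells *)

Definition natdist (a b : nat) : nat := (a - b + (b - a))%N.

Section SparseGeometricSum.
Context {R : realType}.
Variables (tau : R) (Q : nat).
Hypothesis tau01 : 0 < tau < 1.

Lemma sum_geometric_right a M :
  (\sum_(l < M | (a <= l)%N) tau ^+ (l - a)) * (1 - tau) <= 1.
Proof.
have /andP[t0 t1] := tau01.
suff : (\sum_(l < M | (a <= l)%N) tau ^+ (l - a)) * (1 - tau) <= 1 - tau ^+ (M - a).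
  by move=> h; apply: (le_trans h); rewrite lerBlDr lerDl exprn_ge0// ltW.
elim: M => [|M ih]; first by rewrite big_ord0 mul0r sub0n expr0 subrr.
rewrite big_mkcond big_ord_recr/= -big_mkcond/= mulrDl.
case: leqP => aM; last first.
  rewrite mul0r addr0 (le_trans ih)// lerB//.
  by have -> : (M.+1 - a = M - a)%N by lia.
by rewrite subSn// exprS; lra.
Qed.

Lemma sum_geometric_left a M :
  (\sum_(l < M | (l <= a)%N) tau ^+ (a - l)) * (1 - tau) <= 1.
Proof.
have /andP[t0 t1] := tau01.
suff : (\sum_(l < M | (l <= a)%N) tau ^+ (a - l)) * (1 - tau) <= tau ^+ (a.+1 - M).
  by move=> h; apply: (le_trans h); rewrite exprn_ile1// ltW.
elim: M => [|M ih]; first by rewrite big_ord0 mul0r exprn_ge0// ltW.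
rewrite big_mkcond big_ord_recr/= -big_mkcond/= mulrDl.
case: leqP => aM; last first.
  rewrite mul0r addr0 (le_trans ih)//.
  by have -> : (a.+1 - M.+1 = a.+1 - M)%N by lia.
rewrite subSS; rewrite subSn// in ih; rewrite exprS in ih; lra.
Qed.

(** Geometric decay around [a], restricted to [a] and the points at distance at
least [Q] from it: the one-dimensional profile of a separated family of
peaks. *)
Definition sparse_weight (a l : nat) : R :=
  if (l == a) || (Q <= natdist l a)%N then tau ^+ natdist l a else 0.

Lemma sum_sparse_weight a M : (0 < Q)%N ->
  \sum_(l < M) sparse_weight a l <= 1 + 2 * tau ^+ Q / (1 - tau).
Proof.
move=> Q0; have /andP[t0 t1] := tau01; have s0 : 0 < 1 - tau by rewrite subr_gt0.
have te n : 0 <= tau ^+ n by rewrite exprn_ge0// ltW.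
have h1 := sum_geometric_right (a + Q) M.
have h2 : (\sum_(l < M | (l + Q <= a)%N) tau ^+ (a - Q - l)) * (1 - tau) <= 1.
  case: (leqP Q a) => [Qa|aQ].
    have := sum_geometric_left (a - Q) M.
    by rewrite (eq_bigl (fun l : 'I_M => (l + Q <= a)%N))// => l; lia.
  by rewrite big1 ?mul0r// => l; lia.
apply: (@le_trans _ _ (\sum_(l < M) ((l == a :> nat)%:R +
    tau ^+ Q * ((if (a + Q <= l)%N then tau ^+ (l - (a + Q)) else 0) +
      (if (l + Q <= a)%N then tau ^+ (a - Q - l) else 0))))).
  apply: ler_sum => l _; rewrite /sparse_weight.
  have [->|la] := eqVneq (l : nat) a.
    rewrite /= /natdist subnn expr0 lerDl mulr_ge0// addr_ge0//.
      by case: ifP.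
    by case: ifP.
  rewrite /= add0r; case: leqP => [Ql|_]; last first.
    by rewrite mulr_ge0// addr_ge0//; case: ifP.
  have [al|al] := leqP a l.
    have -> : (a + Q <= l)%N by rewrite /natdist in Ql; lia.
    have -> : (l + Q <= a)%N = false by lia.
    have E : natdist l a = (Q + (l - (a + Q)))%N by rewrite /natdist in Ql *; lia.
    by rewrite addr0 -exprD -E.
  have -> : (a + Q <= l)%N = false by lia.
  have -> : (l + Q <= a)%N by rewrite /natdist in Ql; lia.
  have E : natdist l a = (Q + (a - Q - l))%N by rewrite /natdist in Ql *; lia.
  by rewrite add0r -exprD -E.
rewrite big_split /= lerD//.
  rewrite (eq_bigr (fun l : 'I_M => if l == a :> nat then 1 else 0)); last first.
    by move=> l _; case: eqP.
  by rewrite -big_mkcond (big_ord1_eq _ (fun=> 1)); case: ifP.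
rewrite -mulr_sumr big_split/= -!big_mkcond/= ler_pdivlMr//.
rewrite [2 * _]mulrC -mulrA ler_wpM2l// mulrDl; lra.
Qed.

End SparseGeometricSum.

(** Bernoulli's inequality, read as an upper bound for [(1 + e) ^ N] when [N e]
is small. *)
Lemma pow_near1 (R : realType) (e : R) N : 0 <= e ->
  (1 + e) ^+ N * (1 - N%:R * e) <= 1.
Proof.
move=> e0; elim: N => [|N ih]; first by rewrite expr0 mul0r subr0 mul1r.
apply: le_trans ih; rewrite exprSr -mulrA ler_wpM2l ?exprn_ge0 ?addr_ge0//.
have : 0 <= N%:R * (e * e) by rewrite !mulr_ge0.
have : 0 <= e * e by rewrite mulr_ge0.
by rewrite -natr1; lra.
Qed.

Section Cells.
Context {R : realType} {d : nat}.
Local Notation V := 'rV[R[i]]_d.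
Local Notation P := ('I_d * bool)%type.
Implicit Types z w : V.

Definition real_coord (p : P) z : R := cpart p.2 (z 0 p.1).

Lemma sqr_enorm_coords z : enorm z ^+ 2 = \sum_p real_coord p z ^+ 2.
Proof.
rewrite sqr_enorm -(pair_bigA _ (fun j b => real_coord (j, b) z ^+ 2))/=.
by apply: eq_bigr => j _; rewrite big_bool sqr_normcE.
Qed.

Lemma real_coordB p z w : real_coord p (z - w) = real_coord p z - real_coord p w.
Proof. by rewrite /real_coord !mxE cpartB. Qed.

Lemma real_coord_le p z : `|real_coord p z| <= enorm z.
Proof. by rewrite (le_trans (cpart_norm _ _))// normc_coord. Qed.

Lemma card_coords : #|{: P}| = (2 * d)%N.
Proof. by rewrite card_prod card_ord card_bool mulnC. Qed.

Variable m : nat.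
Hypothesis m0 : (0 < m)%N.
Hypothesis d0 : (0 < d)%N.

(** Cubes of side [1 / (4 d m)]. *)
Definition cell_count := (8 * d * m).+1.
Let N : R := (4 * d * m)%:R.

Let N0 : 0 < N.
Proof. by rewrite ltr0n !muln_gt0 d0 m0. Qed.

Definition cell z : {ffun P -> 'I_cell_count} :=
  [ffun p => inord (Num.truncn ((real_coord p z + 1) * N))].

Lemma cellP p z : enorm z = 1 ->
  (cell z p)%:R <= (real_coord p z + 1) * N < (cell z p).+1%:R.
Proof.
move=> z1; rewrite ffunE; have := real_coord_le p z; rewrite z1 ler_norml => /andP[h1 h2].
have x0 : 0 <= (real_coord p z + 1) * N by rewrite mulr_ge0 ?(ltW N0)//; lra.
rewrite inordK ?truncn_itv// /cell_count ltnS -(ler_nat R).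
rewrite (le_trans (_ : _ <= (real_coord p z + 1) * N))//.
  by have /andP[] := truncn_itv x0.
have -> : (8 * d * m)%:R = 2 * N :> R by rewrite /N -natrM; congr _%:R; lia.
by rewrite ler_wpM2r ?(ltW N0)//; lra.
Qed.

Lemma same_cell_dist z w : enorm z = 1 -> enorm w = 1 -> cell z = cell w ->
  enorm (z - w) <= (2 * d)%:R / N.
Proof.
move=> z1 w1 zw; have D0 : 0 <= (2 * d)%:R / N by rewrite divr_ge0// ltW.
rewrite -(ler_sqr) ?nnegrE ?enorm_ge0// sqr_enorm_coords.
have c p : real_coord p (z - w) ^+ 2 <= N^-1 ^+ 2.
  rewrite real_coordB -[leLHS]real_normK ?num_real// lerXn2r ?nnegrE ?invr_ge0 ?(ltW N0)//.
  have := cellP p z1; have := cellP p w1; rewrite zw -natr1 => /andP[h1 h2] /andP[h3 h4].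
  rewrite -[N^-1]mul1r ler_pdivlMr// -{1}(gtr0_norm N0) -normrM ler_norml.
  by apply/andP; split; lra.
apply: (@le_trans _ _ (\sum_(p : P) N^-1 ^+ 2)); first exact: ler_sum.
rewrite sumr_const card_coords -[_ *+ (2 * d)]mulr_natl exprMn ler_wpM2r ?sqr_ge0//.
by rewrite expr2 ler_peMr// ler1n muln_gt0 d0.
Qed.

Lemma natdist_cell p z w : enorm z = 1 -> enorm w = 1 ->
  (natdist (cell z p) (cell w p))%:R <= N * `|real_coord p z - real_coord p w| + 1.
Proof.
move=> z1 w1; have := cellP p z1; have := cellP p w1.
rewrite -!natr1 => /andP[h1 h2] /andP[h3 h4].
rewrite -{1}(gtr0_norm N0) -normrM.
have [le1|le1] := leqP (cell w p) (cell z p).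
  rewrite (_ : natdist _ _ = (cell z p - cell w p)%N); last by rewrite /natdist; lia.
  rewrite natrB//.
  by have := ler_norm (N * (real_coord p z - real_coord p w)); lra.
rewrite (_ : natdist _ _ = (cell w p - cell z p)%N); last by rewrite /natdist; lia.
rewrite natrB ?(ltnW le1)// -normrN.
by have := ler_norm (- (N * (real_coord p z - real_coord p w))); lra.
Qed.

(** Two numbers whose cells are [D >= 2] apart differ by at least [D - 1], hence
[D / 2], cell widths; and [D <= D ^ 2] makes the bound linear in [D]. *)
Lemma coord_separation p z w : enorm z = 1 -> enorm w = 1 ->
  (natdist (cell z p) (cell w p) = 0 \/ 2 <= natdist (cell z p) (cell w p))%N ->
  (natdist (cell z p) (cell w p))%:R / (4 * N ^+ 2) <= real_coord p (z - w) ^+ 2.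
Proof.
move=> z1 w1 [->|ge2]; first by rewrite mul0r sqr_ge0.
have := natdist_cell p z1 w1; rewrite real_coordB -[X in _ -> _ <= X]real_normK ?num_real//.
set D := natdist _ _ in ge2 *; set a := `|_| => h.
have D2 : 2 <= D%:R :> R by rewrite ler_nat.
have a0 : 0 <= a by exact: normr_ge0.
rewrite ler_pdivrMr ?mulr_gt0 ?exprn_gt0//.
have -> : a ^+ 2 * (4 * N ^+ 2) = (2 * (N * a)) ^+ 2 by ring.
have : D%:R <= 2 * (N * a) by lra.
by set t := 2 * _ => Dt; rewrite expr2; nra.
Qed.

End Cells.

(** * Peak polynomials *)

Section PeakFamilies.
Context {R : realType} {d : nat}.
Local Notation V := 'rV[R[i]]_d.
Local Notation P := ('I_d * bool)%type.
Variables (m Q : nat).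
Hypothesis d0 : (0 < d)%N.
Hypothesis m0 : (0 < m)%N.
Hypothesis Qbig : (4 * d * (1 + 2 * d) + 2 <= Q)%N.
Local Notation cells := {ffun P -> 'I_(@cell_count d m)}.
Let K : R := 1 + 2 * d%:R.
(** Rate of decay per cell: with cells of side [1 / (4 d m)], degree at least
[m ^ 2], the chart constant [1 + 2 d] and a factor [2] in the distance, the
constant is [2 * 4 * 16 * 2 * 2 = 512]. *)
Definition peak_decay : R := expR (- (8 * 8 * 8 * d%:R ^+ 2 * (1 + 2 * d%:R) ^+ 2)^-1).
Local Notation tau := peak_decay.

Let dR : 0 < d%:R :> R. Proof. by rewrite ltr0n. Qed.
Let mR : 0 < m%:R :> R. Proof. by rewrite ltr0n. Qed.
Let K0 : 0 < K. Proof. by rewrite /K addr_gt0// mulr_gt0. Qed.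

Lemma peak_decay01 : 0 < tau < 1.
Proof.
rewrite expR_gt0 expR_lt1 oppr_lt0 invr_gt0 !mulr_gt0// exprn_gt0//.
Qed.

(** The cells met by the [j]th chart, split into classes modulo [Q] so that two
cells of a class differ by at least [Q] in some coordinate, and in every
coordinate where they differ. *)
Definition in_family (j : 'I_d) (rho : {ffun P -> 'I_Q}) (k : cells) : bool :=
  `[< exists z : V, in_chart j z /\ cell m z = k >] &&
  [forall p, (k p %% Q == rho p)%N].

Definition representative (j : 'I_d) (k : cells) : V :=
  xget 0 [set z | in_chart j z /\ cell m z = k].

Lemma representativeP j rho k : in_family j rho k ->
  in_chart j (representative j k) /\ cell m (representative j k) = k.
Proof.
by move=> /andP[/asboolP[z zk] _]; rewrite /representative; case: xgetP => [x _|/(_ z)].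
Qed.

Lemma family_separated j rho k k' p : in_family j rho k -> in_family j rho k' ->
  (natdist (k p) (k' p) = 0 \/ Q <= natdist (k p) (k' p))%N.
Proof.
move=> /andP[_ /forallP/(_ p)/eqP h] /andP[_ /forallP/(_ p)/eqP h'].
move: (nat_of_ord (k p)) (nat_of_ord (k' p)) h h' => a b h h'.
have Q0 : (0 < Q)%N by rewrite (leq_trans _ Qbig)// addn_gt0 orbT.
rewrite /natdist; have ab : a = b %[mod Q] by rewrite h h'.
have [->|neq] := eqVneq a b; first by left; rewrite subnn.
right; have [lt|lt] : (a < b \/ b < a)%N by lia.
  have /eqP E : (Q %| b - a)%N by rewrite -eqn_mod_dvd 1?ltnW//; apply/eqP.
  have := dvdn_leq (_ : (0 < b - a)%N) (introT eqP E); rewrite subn_gt0 => /(_ lt); lia.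
have /eqP E : (Q %| a - b)%N by rewrite -eqn_mod_dvd 1?ltnW//; apply/eqP.
have := dvdn_leq (_ : (0 < a - b)%N) (introT eqP E); rewrite subn_gt0 => /(_ lt); lia.
Qed.

Let N2 : ((4 * d * m)%:R : R) ^+ 2 = 16 * d%:R ^+ 2 * m%:R ^+ 2.
Proof. by rewrite !natrM; ring. Qed.

(** The peak is at most a Gaussian of the distance from [z], which may be
replaced by half the distance from [representative k0]; a Gaussian is a product
over the coordinates, and separated cells make each factor geometric. *)
Lemma peak_term_le j rho k0 k z n : enorm z = 1 -> (m ^ 2 <= n)%N ->
  in_family j rho k0 -> in_family j rho k ->
  pdist (representative j k0) (representative j k) <=
    2 * pdist z (representative j k) ->
  normc (cdot z (representative j k)) ^+ n <=
    \prod_p sparse_weight tau Q (k0 p) (k p).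
Proof.
move=> z1 mn f0 fk; have [c0 k0E] := representativeP f0.
have [ck kE] := representativeP fk.
set z0 := representative j k0 in c0 k0E *; set y := representative j k in ck kE *.
move=> le; have y1 := ck.1; have z01 := c0.1.
have wE p : sparse_weight tau Q (k0 p) (k p) = tau ^+ natdist (k p) (k0 p).
  rewrite /sparse_weight; have [D0|->] := family_separated p fk f0.
    have -> : k p = k0 p :> nat by move: D0; rewrite /natdist; lia.
    by rewrite eqxx.
  by rewrite orbT.
under eq_bigr do rewrite wE.
rewrite prodrXr /peak_decay -expRM_natl; apply: (le_trans (normc_cdot_exp n z1 y1)).
rewrite ler_expR mulrN lerN2.
set S := (\sum_p _)%N; set D := pdist z y in le *.
have D0 : 0 <= D by exact: pdist_ge0.
have h1 : S%:R / (4 * (16 * d%:R ^+ 2 * m%:R ^+ 2)) <= enorm (y - z0) ^+ 2.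
  rewrite sqr_enorm_coords natr_sum mulr_suml; apply: ler_sum => p _.
  rewrite -N2 -kE -k0E; apply: coord_separation => //.
  rewrite kE k0E; have [->|Qd] := family_separated p fk f0; [by left|right].
  by apply: leq_trans Qd; rewrite (leq_trans _ Qbig)// leq_addl.
have h2 : enorm (y - z0) <= 2 * K * D.
  rewrite (le_trans (chart_dist ck c0))//.
  apply: (@le_trans _ _ (K * (2 * D))); last by rewrite mulrCA mulrA.
  by rewrite ler_wpM2l ?(ltW K0)// pdistC.
have h3 : enorm (y - z0) ^+ 2 <= (2 * K * D) ^+ 2.
  by rewrite lerXn2r ?nnegrE ?enorm_ge0// !mulr_ge0 ?(ltW K0).
have h4 := le_trans h1 h3.
have nm : m%:R ^+ 2 <= n%:R :> R by rewrite -natrX ler_nat.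
apply: (@le_trans _ _ (m%:R ^+ 2 * (D ^+ 2 / 2))); last first.
  by rewrite ler_wpM2r// divr_ge0// sqr_ge0.
have X0 : 0 < 4 * (16 * d%:R ^+ 2 * m%:R ^+ 2) :> R by rewrite !mulr_gt0// exprn_gt0.
have Y0 : 0 < 8 * 8 * 8 * d%:R ^+ 2 * K ^+ 2 by rewrite !mulr_gt0// exprn_gt0.
rewrite (ler_pdivrMr _ _ X0) in h4; rewrite -/K (ler_pdivrMr _ _ Y0).
apply: (le_trans h4); rewrite le_eqVlt; apply/orP; left; apply/eqP; by field.
Qed.

(** Mass, in one coordinate, of the weights outside the central cell. *)
Definition peak_error : R := 2 * tau ^+ Q / (1 - tau).

(** A sum over cells of products over coordinates is a product over coordinates
of sums, each at most [1 + peak_error]; removing the central cell removes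
[1]. *)
Lemma peak_sum_le j rho k0 z n : enorm z = 1 -> (m ^ 2 <= n)%N ->
  in_family j rho k0 ->
  (forall k, in_family j rho k -> k != k0 ->
     pdist (representative j k0) (representative j k) <=
     2 * pdist z (representative j k)) ->
  \sum_(k | in_family j rho k && (k != k0))
     normc (cdot z (representative j k)) ^+ n <=
  (1 + peak_error) ^+ (2 * d) - 1.
Proof.
move=> z1 mn f0 near0.
have w0 a l : 0 <= sparse_weight tau Q a l.
  by rewrite /sparse_weight; case: ifP => // _; rewrite exprn_ge0// expR_ge0.
apply: (@le_trans _ _ (\sum_(k | k != k0) \prod_p sparse_weight tau Q (k0 p) (k p))).
  rewrite big_mkcondl; apply: ler_sum => k kk0; case: ifP => fk.
    by apply: (@peak_term_le j rho) => //; exact: near0.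
  by apply: prodr_ge0.
have sumD1 (F : cells -> R) : \sum_(k | k != k0) F k = \sum_k F k - F k0.
  by rewrite [X in _ = X - _](bigD1 k0)//= addrAC subrr add0r.
rewrite sumD1 [X in _ - X <= _]big1; last first.
  by move=> p _; rewrite /sparse_weight eqxx/= /natdist subnn expr0.
rewrite lerD2r -(bigA_distr_bigA (fun p l => sparse_weight tau Q (k0 p) (nat_of_ord l))).
rewrite -card_coords -prodr_const; apply: ler_prod => p _.
rewrite sumr_ge0//=; apply: sum_sparse_weight; first exact: peak_decay01.
by rewrite (leq_trans _ Qbig)// addn_gt0 orbT.
Qed.

Definition peak_polynomial j rho n (z : V) : R[i] :=
  \sum_(k | in_family j rho k) cdot z (representative j k) ^+ n.

Lemma normc_cdotXn (z w : V) n : normc (cdot z w ^+ n) = normc (cdot z w) ^+ n.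
Proof. exact: normcXn. Qed.

(** The central cell is taken to be the one whose representative is closest to
the point: by the triangle inequality the distance from it to any other
representative is at most twice the distance from the point to the latter. *)
Lemma peak_polynomial_le j rho n z : enorm z = 1 -> (m ^ 2 <= n)%N ->
  normc (peak_polynomial j rho n z) <= (1 + peak_error) ^+ (2 * d).
Proof.
move=> z1 mn; rewrite (le_trans (ler_normc_sum _ _ _))//.
have [[k1 f1]|none] := pselect (exists k, in_family j rho k); last first.
  have e0 : 0 <= peak_error.
    have /andP[t0 t1] := peak_decay01.
    by rewrite divr_ge0 ?mulr_ge0 ?exprn_ge0 ?subr_ge0 ?(ltW t0) ?(ltW t1).
  rewrite big1 ?exprn_ge0 ?addr_ge0// => k fk; case: none; by exists k.
have [k0 f0 k0min] := @arg_minP _ _ _ k1 (in_family j rho)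
  (fun k => pdist z (representative j k)) f1.
rewrite (bigD1 k0)//= -lerBrDl.
under eq_bigr do rewrite normc_cdotXn.
have [c0 _] := representativeP f0.
apply: (@le_trans _ _ ((1 + peak_error) ^+ (2 * d) - 1)).
  apply: peak_sum_le => // k fk _; have [ck _] := representativeP fk.
  rewrite (le_trans (pdist_triangle c0.1 z1 ck.1))// pdistC mulr_natl mulr2n lerD2r.
  exact: k0min.
rewrite lerB// normc_cdotXn exprn_ile1// ?normc_ge0//.
by rewrite cdot_unit_le1//; exact: c0.1.
Qed.

(** The central cell is the cell of the point itself, whose peak is at least
[3 / 4] there; the other peaks add up to at most [(1 + peak_error) ^ (2 d) - 1],
since separated cells are far from a point that is close to its own
representative. *)
Lemma peak_polynomial_ge j z : in_chart j z ->
  exists rho, forall n, (m ^ 2 <= n <= 2 * m ^ 2)%N -> 7 / 4 - (1 + peak_error) ^+ (2 * d) <=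
    normc (peak_polynomial j rho n z).
Proof.
move=> cz; have z1 := cz.1.
have Q0 : (0 < Q)%N by rewrite (leq_trans _ Qbig)// addn_gt0 orbT.
pose k0 := cell m z.
exists [ffun p => Ordinal (ltn_pmod (k0 p) Q0)]; set rho := finfun _ => n /andP[mn n2m].
have f0 : in_family j rho k0.
  apply/andP; split; first by apply/asboolP; exists z.
  by apply/forallP => p; rewrite [rho p]ffunE.
have [c0 c0E] := representativeP f0; set z0 := representative j k0 in c0 c0E *.
pose N : R := (4 * d * m)%:R.
have N0 : 0 < N by rewrite ltr0n !muln_gt0 d0 m0.
have zz0 : pdist z z0 <= (2 * d)%:R / N.
  rewrite (le_trans (pdist_le_enorm z1 c0.1))//.
  by apply: same_cell_dist => //; exact: c0.1.
rewrite /peak_polynomial (bigD1 k0)//= -/z0; set rest := \sum_(_ | _) _.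
have restle : normc rest <= (1 + peak_error) ^+ (2 * d) - 1.
  rewrite (le_trans (ler_normc_sum _ _ _))//.
  under eq_bigr do rewrite normc_cdotXn.
  apply: peak_sum_le => // k fk kk0; have [ck ckE] := representativeP fk.
  rewrite -/z0; set y := representative j k in ck ckE *.
  have [p kp] : exists p, k p != k0 p.
    apply/existsP; move: kk0; apply: contraR; rewrite negb_exists => /forallP kk0.
    by apply/eqP/ffunP => p; apply/eqP; move: (kk0 p); rewrite negbK.
  have Qp : (Q <= natdist (cell m y p) (cell m z0 p))%N.
    rewrite ckE c0E; have [D0|//] := family_separated p fk f0.
    by move: kp; rewrite -val_eqE /=; move: D0; rewrite /natdist; lia.
  have h1 := natdist_cell m0 d0 p ck.1 c0.1.
  have h2 : Q%:R <= N * (K * pdist z0 y) + 1.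
    apply: (@le_trans _ _ (natdist (cell m y p) (cell m z0 p))%:R).
      by rewrite ler_nat.
    rewrite (le_trans h1)// lerD2r ler_wpM2l ?(ltW N0)// -real_coordB.
    by rewrite (le_trans (real_coord_le _ _))// pdistC; exact: chart_dist ck c0.
  have h3 : (4 * d%:R * K + 2 : R) <= Q%:R.
    have : ((4 * d * (1 + 2 * d) + 2)%:R : R) <= Q%:R by rewrite ler_nat.
    by rewrite natrD !natrM natrD natrM.
  have h4 : 2 * ((2 * d)%:R / N) <= pdist z0 y.
    rewrite mulrA ler_pdivrMr// natrM mulrC -(ler_pM2r K0) -mulrA [_ * K]mulrC.
    by rewrite mulrC; lra.
  have h5 := pdist_triangle c0.1 z1 ck.1; rewrite (pdistC z0 z) in h5.
  by lra.
have main : 3 / 4 <= normc (cdot z z0 ^+ n).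
  rewrite normc_cdotXn; apply: le_trans (normc_cdot_bernoulli n z1 c0.1).
  have p0 : 0 <= pdist z z0 by exact: pdist_ge0.
  have pz2 : pdist z z0 ^+ 2 <= ((2 * d)%:R / N) ^+ 2.
    by rewrite lerXn2r ?nnegrE// (le_trans p0).
  have n2 : n%:R <= 2 * m%:R ^+ 2 :> R by rewrite -natrX -natrM ler_nat.
  have : n%:R * (pdist z z0 ^+ 2 / 2) <= 2 * m%:R ^+ 2 * (((2 * d)%:R / N) ^+ 2 / 2).
    by apply: ler_pM => //; rewrite ?divr_ge0 ?sqr_ge0// ler_wpM2r.
  have -> : 2 * m%:R ^+ 2 * (((2 * d)%:R / N) ^+ 2 / 2) = 4^-1.
    rewrite expr_div_n /N N2 natrM; have := dR; have := mR.
    by move: (m%:R) (d%:R) => a b a0 b0; field; rewrite !gt_eqF.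
  by lra.
have := le_normcD (cdot z z0 ^+ n + rest) (- rest); rewrite addrK normcN.
by lra.
Qed.

End PeakFamilies.

(** The error decreases geometrically in [Q], for a rate depending on [d]
alone. *)
Lemma exists_peak_modulus (R : realType) d : (0 < d)%N ->
  exists Q, (4 * d * (1 + 2 * d) + 2 <= Q)%N /\
    (1 + @peak_error R d Q) ^+ (2 * d) <= 5 / 4.
Proof.
move=> d0; have /andP[t0 t1] := @peak_decay01 R d d0.
set tau := peak_decay in t0 t1 *.
have s0 : 0 < 1 - tau by rewrite subr_gt0.
have N0 : 0 < (2 * d)%:R :> R by rewrite ltr0n muln_gt0.
(* This makes [2 d * peak_error] at most [1 / 5], hence the power at most
   [1 / (1 - 1 / 5)]. *)
pose dl := (1 - tau) / 10 / (2 * d)%:R.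
have dl0 : 0 < dl by rewrite !divr_gt0.
have nt : `|tau| < 1 by rewrite gtr0_norm.
have /cvgr0_norm_lt/(_ dl dl0)[n _ /(_ n (leqnn _)) /=] := cvg_expr nt.
rewrite gtr0_norm ?exprn_gt0// => tn.
exists (n + (4 * d * (1 + 2 * d) + 2))%N; split; first exact: leq_addl.
set Q := (n + _)%N.
have tQ : tau ^+ Q <= dl.
  by rewrite (le_trans _ (ltW tn))// ler_wiXn2l ?(ltW t0) ?(ltW t1)// leq_addr.
have e0 : 0 <= @peak_error R d Q.
  by rewrite divr_ge0 ?(ltW s0)// mulr_ge0// exprn_ge0// ltW.
have Ne : (2 * d)%:R * @peak_error R d Q <= 5^-1.
  rewrite /peak_error -/tau mulrA ler_pdivrMr// mulrCA.
  apply: (@le_trans _ _ (2 * ((2 * d)%:R * dl))).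
    by rewrite ler_wpM2l// ler_wpM2l// ltW.
  have -> : (2 * d)%:R * dl = (1 - tau) / 10 by rewrite /dl mulrC divfK// gt_eqF.
  by lra.
have := pow_near1 (2 * d) e0; set X := (1 + _) ^+ _ => XN.
have X0 : 0 <= X by rewrite exprn_ge0// addr_ge0.
have : X * (1 - 5^-1) <= X * (1 - (2 * d)%:R * @peak_error R d Q).
  by rewrite ler_wpM2l// lerB.
by lra.
Qed.

(** There is one polynomial for each chart and each class of residues modulo
[Q], so their number does not depend on [m]; sparseness of a class keeps the
peaks of its polynomial apart, and any point is close to a peak of the
polynomial of its own cell, for a chart that contains it after rotation. *)
Lemma exists_peak_polynomials (R : realType) d : (0 < d)%N ->
  exists J (Z : nat -> 'I_J -> seq 'rV[R[i]]_d), forall m, (0 < m)%N ->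
  [/\ forall i zeta, zeta \in Z m i -> enorm zeta = 1,
      forall i, (size (Z m i) <= (8 * d * m).+1 ^ (2 * d))%N,
      forall i n z, (m ^ 2 <= n)%N -> enorm z = 1 ->
        normc (\sum_(zeta <- Z m i) cdot z zeta ^+ n) <= 2 &
      forall z, enorm z = 1 -> exists i, forall n, (m ^ 2 <= n <= 2 * m ^ 2)%N ->
        2^-1 <= normc (\sum_(zeta <- Z m i) cdot z zeta ^+ n)].
Proof.
move=> d0; have [Q [Qbig eQ]] := exists_peak_modulus R d0.
pose I : finType := ('I_d * {ffun 'I_d * bool -> 'I_Q})%type.
pose Z m (i : 'I_#|I|) : seq 'rV[R[i]]_d :=
  [seq representative (enum_val i).1 k | k : {ffun 'I_d * bool -> 'I_(@cell_count d m)}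
    <- enum [pred k | @in_family R d m Q (enum_val i).1 (enum_val i).2 k]].
exists #|I|, Z => m m0.
have ZE i n z : \sum_(zeta <- Z m i) cdot z zeta ^+ n =
    peak_polynomial m (enum_val i).1 (enum_val i).2 n z.
  by rewrite big_map big_enum.
split.
- move=> i zeta /mapP[k]; rewrite mem_enum => fk ->.
  by have [[]] := representativeP fk.
- move=> i; rewrite size_map -cardE (leq_trans (max_card _))//.
  by rewrite card_ffun card_coords card_ord.
- move=> i n z mn z1; rewrite ZE (le_trans (peak_polynomial_le d0 m0 Qbig _ _ z1 mn))//.
  by rewrite (le_trans eQ)//; lra.
- move=> z z1; have [j [l l1 lz]] := exists_chart d0 z1.
  have [rho rhoP] := peak_polynomial_ge d0 m0 Qbig lz.
  exists (enum_rank (j, rho)) => n mn; rewrite ZE enum_rankK/=.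
  have := rhoP n mn.
  have -> : peak_polynomial m j rho n (l *: z) = l ^+ n * peak_polynomial m j rho n z.
    rewrite /peak_polynomial mulr_sumr; apply: eq_bigr => k _.
    by rewrite cdotZl exprMn.
  by rewrite normcM normcXn l1 expr1n mul1r; lra.
Qed.

(** * A Sidon set of degrees *)

Section Degrees.
Variable J : nat.
Hypothesis J0 : (0 < J)%N.
Local Open Scope nat_scope.

Definition degree_base := 2 ^ (J + 2).

Definition block_scale b := degree_base ^ b.+1.

(** Index [k] is in block [k %/ J], all of whose degrees are comparable to
[block_scale (k %/ J) ^ 2]; the term [2 ^ (k %% J)] makes the differences
within a block distinct. The ratio [degree_base] is large enough, in terms of
[J], to keep the blocks apart. *)
Definition degree k := block_scale (k %/ J) ^ 2 + 4 * 2 ^ (k %% J) * (degree_base ^ (k %/ J)) ^ 2.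

Lemma block_scale_gt0 b : 0 < block_scale b.
Proof. by rewrite expn_gt0 expn_gt0. Qed.

Lemma block_scaleS b : block_scale b.+1 ^ 2 = degree_base ^ 2 * block_scale b ^ 2.
Proof. by rewrite /block_scale [degree_base ^ b.+2]expnS expnMn. Qed.

Lemma degree_base_gt1 : 1 < degree_base.
Proof. by rewrite /degree_base addn2 !expnS; have := expn_gt0 2 J; lia. Qed.

Lemma block_scale_growth b : 4 * block_scale b ^ 2 <= 2 * block_scale b.+1 ^ 2.
Proof. by rewrite block_scaleS; have := degree_base_gt1; nia. Qed.

Let small_term k : 16 * 2 ^ (k %% J) <= degree_base ^ 2.
Proof.
have : 2 ^ (k %% J) <= 2 ^ J by rewrite leq_exp2l// ltnW// ltn_pmod.
have : 0 < 2 ^ J by rewrite expn_gt0.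
by rewrite /degree_base addn2 !expnS expn0 muln1; nia.
Qed.

Lemma degree_bounds k :
  block_scale (k %/ J) ^ 2 <= degree k <= 2 * block_scale (k %/ J) ^ 2.
Proof.
rewrite /degree leq_addr/= mul2n -addnn leq_add2l /block_scale [degree_base ^ _.+1]expnS expnMn.
by rewrite leq_mul2r; apply/orP; right; have := small_term k; lia.
Qed.

Let X b := (degree_base ^ b) ^ 2.
Let X0 b : 0 < X b. Proof. by rewrite !expn_gt0. Qed.

Let degE k : degree k = degree_base ^ 2 * X (k %/ J) + 4 * (2 ^ (k %% J) * X (k %/ J)).
Proof. by rewrite /degree /block_scale [degree_base ^ _.+1]expnS expnMn mulnA. Qed.

Let lower k b : k %/ J < b -> degree k <= 2 * X b.
Proof.
move=> kb; have /andP[_ h] := degree_bounds k; apply: (leq_trans h).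
by rewrite leq_mul2l /= leq_exp2r// leq_pexp2l// expn_gt0.
Qed.

Let same_block k m : m < k -> k %/ J = m %/ J ->
  2 * (2 ^ (m %% J) * X (k %/ J)) <= 2 ^ (k %% J) * X (k %/ J).
Proof.
move=> mk E; rewrite mulnA -expnS leq_mul2r; apply/orP; right.
rewrite leq_exp2l//; move: mk; rewrite {1}(divn_eq k J) {1}(divn_eq m J) E.
by rewrite ltn_add2l.
Qed.

Let q64 : 64 <= degree_base ^ 2.
Proof.
have : 2 <= 2 ^ J by rewrite -{1}(expn1 2) leq_exp2l.
by rewrite /degree_base addn2 !expnS expn0 muln1; nia.
Qed.

Let pos k b : X b <= 2 ^ (k %% J) * X b.
Proof. by rewrite leq_pmull// expn_gt0. Qed.

Lemma degree_mono m k : m < k -> degree m < degree k.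
Proof.
move=> mk; have [E|neq] := eqVneq (k %/ J) (m %/ J).
  have := same_block mk E; rewrite !degE -E; have := pos m (k %/ J); have := X0 (k %/ J); lia.
have lt : m %/ J < k %/ J by rewrite ltn_neqAle eq_sym neq leq_div2r// ltnW.
have := lower lt; rewrite (degE k); have := X0 (k %/ J); have := q64; nia.
Qed.

Lemma degree_gt0 k : 0 < degree k.
Proof. by have /andP[h _] := degree_bounds k; rewrite (leq_trans _ h)// expn_gt0 block_scale_gt0. Qed.

Let no_relation k l m j : m < k -> j < k -> degree k + degree l = degree m + degree j -> False.
Proof.
move=> mk jk E; set b := k %/ J.
have mb : m %/ J <= b by rewrite leq_div2r// ltnW.
have jb : j %/ J <= b by rewrite leq_div2r// ltnW.
have Xb := X0 b; have qX : 64 * X b <= degree_base ^ 2 * X b by rewrite leq_mul2r q64 orbT.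
have pk := pos k b.
move: mb jb; rewrite [m %/ J <= b]leq_eqVlt [j %/ J <= b]leq_eqVlt => /predU1P[mb|mb] /predU1P[jb|jb].
- have hm := same_block mk (esym mb); have hj := same_block jk (esym jb).
  have sk : 16 * (2 ^ (k %% J) * X b) <= degree_base ^ 2 * X b.
    by rewrite mulnA leq_mul2r small_term orbT.
  rewrite (degE k) (degE m) (degE j) mb jb -/b in E.
  have [lb|] := leqP b (l %/ J).
    have : block_scale b ^ 2 <= degree l.
      have /andP[h _] := degree_bounds l; apply: leq_trans h.
      by rewrite leq_exp2r// leq_pexp2l ?expn_gt0// ltnS.
    rewrite /block_scale [degree_base ^ _.+1]expnS expnMn -/(X b).
    have [lb'|lb'] := eqVneq (l %/ J) b.
      by rewrite (degE l) lb' in E *; have := pos l b; rewrite -/b in hm hj; lia.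
    have lt : b < l %/ J by rewrite ltn_neqAle eq_sym lb' lb.
    have : block_scale b.+1 ^ 2 <= degree l.
      have /andP[h _] := degree_bounds l; apply: leq_trans h.
      by rewrite leq_exp2r// leq_pexp2l ?expn_gt0.
    rewrite block_scaleS /block_scale [degree_base ^ b.+1]expnS expnMn -/(X b).
    by have := q64; rewrite -/b in hm hj; nia.
  by move=> /lower; rewrite -/b in hm hj; lia.
- have hm := same_block mk (esym mb); have := lower jb.
  by rewrite (degE k) (degE m) mb -/b in E *; rewrite -/b in hm; have := pos m b; lia.
- have hj := same_block jk (esym jb); have := lower mb.
  by rewrite (degE k) (degE j) jb -/b in E *; rewrite -/b in hj; have := pos j b; lia.
- by have := lower mb; have := lower jb; rewrite (degE k) -/b in E *; lia.
Qed.

Let degree_inj k m : degree k = degree m -> k = m.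
Proof.
move=> E; have [/degree_mono|/degree_mono|//] := ltngtP k m; rewrite E ltnn//.
Qed.

(** The degrees form a Sidon set. In [degree k + degree l = degree m + degree j]
the largest index must occur on both sides: two degrees of smaller index add
up to too little if one of them is in an earlier block, and otherwise
[2 ^ m + 2 ^ j <= 2 ^ k], for the indices within the block, decides. *)
Lemma degree_sidon j k l m : j < k -> l < m ->
  degree k - degree j = degree m - degree l -> j = l /\ k = m.
Proof.
move=> jk lm E; have djk := degree_mono jk; have dlm := degree_mono lm.
have E' : degree k + degree l = degree m + degree j by lia.
have [km|mk|km] := ltngtP k m.
- by case: (@no_relation m j k l km lm); lia.
- by case: (@no_relation k l m j mk jk).
- by split => //; apply: degree_inj; rewrite km in E'; lia.
Qed.

End Degrees.

(** * Series of homogeneous polynomials *)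

Section ComplexSeries.
Context {R : realType}.

(** Convergence of a complex series in terms of the real-valued modulus. *)
Definition is_csum (p : nat -> R[i]) (s : R[i]) :=
  forall e : R, 0 < e -> exists N, forall n, (N <= n)%N ->
    normc (s - \sum_(k < n) p k) <= e.

Definition csum (p : nat -> R[i]) : R[i] := xget 0 (is_csum p).

(** Weierstrass test. *)
Lemma csumP (p : nat -> R[i]) (b : nat -> R) (B : R) :
  (forall k, normc (p k) <= b k) -> (forall n, \sum_(k < n) b k <= B) ->
  is_csum p (csum p).
Proof.
move=> pb bB.
have b0 k : 0 <= b k by rewrite (le_trans _ (pb k))// normc_ge0.
have step n m : normc (\sum_(k < n + m) p k - \sum_(k < n) p k) <=
    \sum_(k < m) b (n + k)%N.
  rewrite big_split_ord/= addrAC subrr add0r (le_trans (ler_normc_sum _ _ _))//.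
  exact: ler_sum.
have conv c : cvg ((fun n => cpart c (\sum_(k < n) p k)) @ \oo).
  apply: cauchy_cvg; apply: cauchy_exP => e e0.
  have [N NP] := sum_bounded_tail b0 bB (ltac:(by rewrite divr_gt0) : 0 < e / 2).
  exists (cpart c (\sum_(k < N) p k)); exists N => // n /= Nn.
  rewrite /ball/= distrC -cpartB (le_lt_trans (cpart_norm _ _))//.
  rewrite -(subnKC Nn) (le_lt_trans (step _ _))// (le_lt_trans (NP _))//.
  by rewrite ltr_pdivrMr// ltr_pMr// ltr1n.
have /cvg_ex[x xP] := conv true; have /cvg_ex[y yP] := conv false.
suff H : is_csum p (x +i* y)%C by rewrite /csum; case: xgetP => // /(_ _ H).
move=> e e0; have e20 : 0 < e / 2 by rewrite divr_gt0.
have /cvgrPdist_le/(_ _ e20)[N1 _ N1P] := xP.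
have /cvgrPdist_le/(_ _ e20)[N2 _ N2P] := yP.
exists (maxn N1 N2) => n; rewrite geq_max => /andP[n1 n2].
rewrite (le_trans (normc_leD _))// [e]splitr lerD// raddfB/=.
  exact: N1P.
exact: N2P.
Qed.

End ComplexSeries.

Section PowerSums.
Context {R : realType} {d : nat}.
Local Notation V := 'rV[R[i]]_d.
Variables (Z : nat -> seq V) (n : nat -> nat) (a : nat -> R).
Hypothesis Z1 : forall k zeta, zeta \in Z k -> enorm zeta = 1.
Hypothesis n0 : forall k, (0 < n k)%N.
Hypothesis a0 : forall k, 0 <= a k.

Definition power_sum k (z : V) : R[i] := \sum_(zeta <- Z k) cdot z zeta ^+ n k.

Let beta (r : R) k := a k * (size (Z k))%:R * (n k)%:R ^+ 2 * r ^+ n k.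

Hypothesis beta_summable : forall r : R, 0 < r < 1 ->
  exists B, forall K, \sum_(k < K) beta r k <= B.

Definition series_fun (z : V) : R[i] := csum (fun k => (a k)%:C%C * power_sum k z).

Let sum_seq_le k (F : V -> R[i]) (C : R) :
  (forall zeta, zeta \in Z k -> normc (F zeta) <= C) ->
  normc (\sum_(zeta <- Z k) F zeta) <= (size (Z k))%:R * C.
Proof.
move=> FC; rewrite (le_trans (ler_normc_sum _ _ _))//.
rewrite -sum1_size natr_sum mulr_suml big_seq [leRHS]big_seq.
by apply: ler_sum => zeta zk; rewrite mul1r; exact: FC.
Qed.

Let cdot_le (z zeta : V) k : zeta \in Z k -> normc (cdot z zeta) <= enorm z.
Proof. by move=> /Z1 z1; have := cauchy_schwarz z zeta; rewrite z1 mulr1. Qed.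

Let nR k : 1 <= (n k)%:R :> R. Proof. by rewrite ler1n. Qed.

Lemma power_sum_le r k z : 0 < r -> enorm z <= r ->
  normc ((a k)%:C%C * power_sum k z) <= beta r k.
Proof.
move=> r0 zr; rewrite normcM normc_real ger0_norm//.
have -> : beta r k = a k * ((size (Z k))%:R * ((n k)%:R ^+ 2 * r ^+ n k)).
  by rewrite /beta; ring.
rewrite ler_wpM2l//; apply: (le_trans (sum_seq_le (C := r ^+ n k) _)) => [zeta zk|].
  rewrite normcXn lerXn2r ?nnegrE ?normc_ge0 ?(ltW r0)//.
  by rewrite (le_trans (cdot_le _ zk)).
rewrite ler_wpM2l// ler_peMl ?exprn_ge0 ?(ltW r0)//.
by rewrite exprn_ege1.
Qed.

(** Coefficients of the derivative of the [k]th term. *)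
Definition power_grad k (z : V) (j : 'I_d) : R[i] :=
  (a k)%:C%C * \sum_(zeta <- Z k) (n k)%:R * cdot z zeta ^+ (n k).-1 * conjc (zeta 0 j).

Let normc_nat m : normc (m%:R : R[i]) = m%:R.
Proof. by rewrite -(rmorph_nat (real_complex R)) normc_real normr_nat. Qed.

Lemma power_grad_le r k z j : 0 < r -> enorm z <= r ->
  normc (power_grad k z j) <= r^-1 * beta r k.
Proof.
move=> r0 zr; rewrite normcM normc_real ger0_norm//.
have -> : r^-1 * beta r k = a k * ((size (Z k))%:R * ((n k)%:R ^+ 2 * r ^+ (n k).-1)).
  have E : r ^+ n k = r * r ^+ (n k).-1 by rewrite -exprS prednK.
  rewrite /beta E; move: (r ^+ (n k).-1) => t.
  by field; rewrite gt_eqF.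
rewrite ler_wpM2l//; apply: sum_seq_le => zeta zk.
rewrite !normcM normcXn normc_nat normc_conj.
have z1 : normc (zeta 0 j) <= 1 by rewrite -(Z1 zk) normc_coord.
have cz : normc (cdot z zeta) ^+ (n k).-1 <= r ^+ (n k).-1.
  rewrite lerXn2r ?nnegrE ?normc_ge0 ?(ltW r0)//.
  by rewrite (le_trans (cdot_le _ zk)).
have c0 : 0 <= normc (cdot z zeta) ^+ (n k).-1 by rewrite exprn_ge0// normc_ge0.
rewrite -[leRHS]mulr1; apply: ler_pM => //; rewrite ?mulr_ge0// ?normc_ge0//.
apply: ler_pM => //; rewrite expr2 ler_peMl//.
Qed.

Lemma grad_dot_power_grad k z h : grad_dot (power_grad k z) h =
  (a k)%:C%C * \sum_(zeta <- Z k) (n k)%:R * cdot z zeta ^+ (n k).-1 * cdot h zeta.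
Proof.
rewrite /grad_dot /power_grad; under eq_bigr do rewrite mulrCA mulr_sumr.
rewrite -mulr_sumr exchange_big/=; congr (_ * _); apply: eq_bigr => zeta _.
by rewrite /cdot mulr_sumr; apply: eq_bigr => j _; ring.
Qed.

Lemma power_taylor r k z z' : 0 < r -> enorm z <= r -> enorm z' <= r ->
  normc ((a k)%:C%C * power_sum k z' - (a k)%:C%C * power_sum k z -
    grad_dot (power_grad k z) (z' - z)) <=
  r ^- 2 * beta r k * enorm (z' - z) ^+ 2.
Proof.
move=> r0 zr zr'; rewrite grad_dot_power_grad -!mulrBr normcM normc_real ger0_norm//.
rewrite /power_sum -!sumrB.
have -> : r ^- 2 * beta r k * enorm (z' - z) ^+ 2 =
  a k * ((size (Z k))%:R * (r ^- 2 * ((n k)%:R ^+ 2 * r ^+ n k * enorm (z' - z) ^+ 2))).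
  by rewrite /beta; ring.
rewrite ler_wpM2l//; apply: sum_seq_le => zeta zk.
rewrite cdotBl [leRHS]mulrC ler_pdivlMr ?exprn_gt0//.
apply: (le_trans (pow_taylor1 (n k) r0 (le_trans (cdot_le _ zk) zr') (le_trans (cdot_le _ zk) zr))).
rewrite ler_wpM2l ?mulr_ge0 ?exprn_ge0 ?(ltW r0)// -cdotBl.
by rewrite lerXn2r ?nnegrE ?normc_ge0 ?enorm_ge0// (cdot_le _ zk).
Qed.

Let grad z j := csum (fun k => power_grad k z j).

Let mid (z : V) : R := (1 + enorm z) / 2.

Let midP z : unit_ball z -> [/\ 0 < mid z, mid z < 1 & enorm z < mid z].
Proof.
rewrite /unit_ball/= /mid => z1; have := enorm_ge0 z; split; lra.
Qed.

Lemma series_fun_sum r z : 0 < r < 1 -> enorm z <= r ->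
  is_csum (fun k => (a k)%:C%C * power_sum k z) (series_fun z).
Proof.
move=> /andP[r0 r1] zr; have [B BP] := beta_summable (introT andP (conj r0 r1)).
by apply: (@csumP _ _ (beta r) B) => // k; exact: power_sum_le.
Qed.

Lemma series_fun_uniform r e : 0 < r < 1 -> 0 < e -> exists N, forall K z, (N <= K)%N ->
  enorm z <= r -> normc (series_fun z - \sum_(k < K) (a k)%:C%C * power_sum k z) <= e.
Proof.
move=> r01 e0; have [B BP] := beta_summable r01; have /andP[r0 _] := r01.
have b0 k : 0 <= beta r k by rewrite !mulr_ge0// ?sqr_ge0// exprn_ge0// ltW.
have e3 : 0 < e / 3 by rewrite divr_gt0.
have [N NP] := sum_bounded_tail b0 BP e3; exists N => K z NK zr.
pose P m := \sum_(k < m) (a k)%:C%C * power_sum k z.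
have tail m : (N <= m)%N -> normc (P m - P N) <= e / 3.
  move=> Nm; rewrite -(subnKC Nm) /P big_split_ord/= addrAC subrr add0r.
  rewrite (le_trans (ler_normc_sum _ _ _))// (le_trans _ (NP (m - N)%N))//.
  by apply: ler_sum => k _; exact: power_sum_le.
have [M MP] := series_fun_sum r01 zr e3.
have h1 := MP (maxn M N) (leq_maxl _ _); have h2 := tail _ (leq_maxr M N).
have h3 := tail _ NK; rewrite -/(P _) in h1 *.
have -> : series_fun z - P K = (series_fun z - P (maxn M N)) + (P (maxn M N) - P N - (P K - P N)).
  by ring.
rewrite (le_trans (le_normcD _ _))//.
have := ler_normcB (P (maxn M N) - P N) (P K - P N); lra.
Qed.

Lemma grad_sum z j : unit_ball z -> is_csum (fun k => power_grad k z j) (grad z j).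
Proof.
move=> /midP[r0 r1 zr]; have [B BP] := beta_summable (introT andP (conj r0 r1)).
apply: (@csumP _ _ (fun k => (mid z)^-1 * beta (mid z) k) ((mid z)^-1 * B)) => [k|K].
  by apply: power_grad_le => //; exact: ltW.
by rewrite -mulr_sumr ler_wpM2l// invr_ge0 ltW.
Qed.

Lemma grad_dot_sum z h e : unit_ball z -> 0 < e ->
  exists N, forall K, (N <= K)%N ->
    normc (grad_dot (grad z) h - \sum_(k < K) grad_dot (power_grad k z) h) <= e.
Proof.
move=> bz e0; have e1 : 0 < e / (d%:R * enorm h + 1).
  by rewrite divr_gt0// ltr_wpDl// mulr_ge0// enorm_ge0.
have /choice[N NP] j : exists N, forall K, (N <= K)%N ->
    normc (grad z j - \sum_(k < K) power_grad k z j) <= e / (d%:R * enorm h + 1).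
  exact: grad_sum.
exists (\max_j N j)%N => K NK.
rewrite /grad_dot exchange_big/= -sumrB (le_trans (ler_normc_sum _ _ _))//.
apply: (@le_trans _ _ (\sum_(j < d) enorm h * (e / (d%:R * enorm h + 1)))).
  apply: ler_sum => j _; rewrite -mulr_sumr -mulrBr normcM.
  apply: ler_pM; rewrite ?normc_ge0 ?normc_coord//; apply: NP.
  by rewrite (leq_trans _ NK)// leq_bigmax.
rewrite sumr_const card_ord -[_ *+ d]mulr_natl mulrA mulrCA ler_piMr ?(ltW e0)//.
by rewrite ler_pdivrMr ?mul1r ?lerDl// ltr_wpDl// mulr_ge0// enorm_ge0.
Qed.

(** The second order Taylor bounds of the terms are summable, and so bound the
remainder of the sum; the truncation errors, of three different series, are
made smaller than any [eta] at fixed [z'] before letting [eta] tend to [0]. *)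
Lemma series_fun_gradient z : unit_ball z -> has_gradient series_fun z (grad z).
Proof.
move=> bz e e0; have [r0 r1 zr] := midP bz; set r := mid z in r0 r1 zr.
have [B BP] := beta_summable (introT andP (conj r0 r1)).
have B0 : 0 <= B by have := BP 0%N; rewrite big_ord0.
pose C := r ^- 2 * B + 1.
have C0 : 0 < C by rewrite ltr_wpDl// mulr_ge0// invr_ge0 exprn_ge0// ltW.
exists (Num.min (r - enorm z) (e / C)); first by rewrite lt_min subr_gt0 zr divr_gt0.
move=> z'; rewrite lt_min => /andP[h1 h2].
have zr' : enorm z' <= r.
  by have := enormD (z' - z) z; rewrite subrK; lra.
apply: (@le_trans _ _ (C * enorm (z' - z) ^+ 2)); last first.
  rewrite expr2 mulrA ler_wpM2r ?enorm_ge0// mulrC -ler_pdivlMr//.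
  exact: ltW.
rewrite (le_trans (_ : _ <= r ^- 2 * B * enorm (z' - z) ^+ 2))//; last first.
  by rewrite ler_wpM2r ?sqr_ge0// lerDl.
apply/ler_addgt0Pr => eta eta0.
have eta3 : 0 < eta / 3 by rewrite divr_gt0.
have r01 : 0 < r < 1 by rewrite r0.
have [N1 N1P] := series_fun_sum r01 zr' eta3.
have [N2 N2P] := series_fun_sum r01 (ltW zr) eta3.
have [N3 N3P] := grad_dot_sum (z' - z) bz eta3.
pose K := (N1 + N2 + N3)%N.
have h12 : (N1 + N2 <= K)%N := leq_addr _ _.
have := N1P K (leq_trans (leq_addr _ _) h12); have := N2P K (leq_trans (leq_addl _ _) h12).
have := N3P K (leq_addl _ _).
set S1 := \sum_(k < K) (a k)%:C%C * power_sum k z'.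
set S2 := \sum_(k < K) (a k)%:C%C * power_sum k z.
set S3 := \sum_(k < K) grad_dot _ _ => l3 l2 l1.
have main : normc (S1 - S2 - S3) <= r ^- 2 * B * enorm (z' - z) ^+ 2.
  rewrite /S1 /S2 /S3 -!sumrB (le_trans (ler_normc_sum _ _ _))//.
  apply: (@le_trans _ _ (\sum_(k < K) r ^- 2 * beta r k * enorm (z' - z) ^+ 2)).
    by apply: ler_sum => k _; apply: power_taylor => //; exact: ltW.
  by rewrite -mulr_suml -mulr_sumr ler_wpM2r ?sqr_ge0// ler_wpM2l// invr_ge0 exprn_ge0// ltW.
set G := grad_dot (grad z) (z' - z) in l3 *.
have -> : series_fun z' - series_fun z - G =
    (S1 - S2 - S3) + ((series_fun z' - S1) - (series_fun z - S2) - (G - S3)) by ring.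
rewrite (le_trans (le_normcD _ _))// lerD//.
rewrite (le_trans (ler_normcB _ _))// (le_trans (lerD (ler_normcB _ _) (lexx _)))//.
lra.
Qed.

Lemma series_fun_holomorphic : holomorphic_ball series_fun.
Proof. by move=> z /series_fun_gradient/has_gradient_differentiable[]. Qed.

(** Euler's identity for the homogeneous terms. *)
Lemma radial_derivative_series z : unit_ball z ->
  is_csum (fun k => (a k * (n k)%:R)%:C%C * power_sum k z)
    (radial_derivative series_fun z).
Proof.
move=> bz e e0; have [_ ->] := has_gradient_differentiable (series_fun_gradient bz).
have [N NP] := grad_dot_sum z bz e0; exists N => K NK; apply: le_trans (NP K NK).
rewrite (_ : \sum_(k < K) _ = \sum_(k < K) grad_dot (power_grad k z) z)//.
apply: eq_bigr => k _; rewrite grad_dot_power_grad /power_sum.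
rewrite rmorphM rmorph_nat -mulrA; congr (_ * _); rewrite mulr_sumr.
by apply: eq_bigr => zeta _; rewrite -mulrA -exprSr prednK.
Qed.

End PowerSums.

(** * Lacunary Bloch functions *)

Section ElementaryBounds.
Context {R : realType}.
Implicit Types r h : R.

Lemma natmul_pow_le r n : 0 < r < 1 -> n%:R * r ^+ n * (1 - r) <= 1.
Proof.
move=> r01; have /andP[r0 r1] := r01; apply: le_trans (sum_geometric_right r01 0 n).
rewrite ler_wpM2r ?subr_ge0 ?(ltW r1)//= -{1}(card_ord n) mulr_natl -sumr_const.
by apply: ler_sum => l _; rewrite subn0 ler_wiXn2l ?(ltW r0) ?(ltW r1)// ltnW.
Qed.

(** The square root of [r] absorbs one factor [n] at a time. *)
Lemma natpow_pow_bounded p r : 0 < r < 1 -> exists C, forall n, n%:R ^+ p * r ^+ n <= C.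
Proof.
elim: p r => [|p ih] r /andP[r0 r1].
  by exists 1 => n; rewrite expr0 mul1r exprn_ile1// ltW.
have s0 : 0 < Num.sqrt r by rewrite sqrtr_gt0.
have s1 : Num.sqrt r < 1 by rewrite -[ltRHS]sqrtr1 ltr_sqrt.
have [C CP] := ih _ (introT andP (conj s0 s1)).
exists (C / (1 - Num.sqrt r)) => n.
rewrite ler_pdivlMr ?subr_gt0// -[X in X ^+ n](sqr_sqrtr (ltW r0)) -exprM mulnC exprM expr2 exprS.
set s := Num.sqrt r in s0 s1 CP *.
have -> : n%:R * n%:R ^+ p * (s ^+ n * s ^+ n) * (1 - s) =
  n%:R ^+ p * s ^+ n * (n%:R * s ^+ n * (1 - s)) by ring.
rewrite (le_trans _ (CP n))// ler_piMr ?mulr_ge0 ?exprn_ge0 ?(ltW s0)//.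
by apply: natmul_pow_le; rewrite s0.
Qed.

Lemma one_sub_pow_le h n : 0 <= h <= 1 -> (1 - h) ^+ n * (h * n%:R) ^+ 2 <= 4.
Proof.
move=> /andP[h0 h1]; set y := h * n%:R.
have y0 : 0 <= y by rewrite mulr_ge0.
have le1 : (1 - h) ^+ n <= expR (- y).
  rewrite /y mulrC -mulrN expRM_natl lerXn2r ?nnegrE ?expR_ge0 ?subr_ge0//.
  exact: expR_ge1Dx.
rewrite (le_trans (ler_wpM2r (sqr_ge0 _) le1))// expRN mulrC ler_pdivrMr ?expR_gt0//.
have -> : y = 2 * (y / 2) by field.
rewrite expRM_natl exprMn -natrX ler_wpM2l// lerXn2r ?nnegrE ?expR_ge0 ?divr_ge0//.
by rewrite (le_trans _ (expR_ge1Dx _))// lerDr.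
Qed.

(** Summing first over increasing scales [y b <= 1], then over decreasing
ones, each part is dominated by its largest term. *)
Lemma sum_two_sided_geometric (y u v T : nat -> R) (tau sigma c : R) :
  0 <= tau < 1 -> 0 < sigma < 1 -> 0 <= c ->
  (forall b, y b <= y b.+1) ->
  (forall b, 0 <= u b) -> (forall b, y b <= 1 -> u b <= 1) ->
  (forall b, 1 < y b -> v b <= c) ->
  (forall b, u b <= tau * u b.+1) -> (forall b, v b.+1 = sigma * v b) ->
  (forall b, y b <= 1 -> T b <= u b) -> (forall b, 1 < y b -> T b <= v b) ->
  (forall b, 0 <= v b) ->
  forall B, \sum_(b < B) T b <= (1 - tau)^-1 + c / (1 - sigma).
Proof.
move=> /andP[t0 t1] /andP[s0 s1] c0 ym u0 u1 vc ut vs Tu Tv v0.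
have t1' : 0 < 1 - tau by rewrite subr_gt0.
have s1' : 0 < 1 - sigma by rewrite subr_gt0.
have cs : 0 <= c / (1 - sigma) by rewrite divr_ge0// ltW.
have it : 0 < (1 - tau)^-1 by rewrite invr_gt0.
(* Below the threshold the last term controls the sum; beyond it, what is left
   of the decreasing geometric series is still available. *)
have main B : \sum_(b < B.+1) T b <= if y B <= 1 then u B / (1 - tau) else
    (1 - tau)^-1 + (c - sigma * v B) / (1 - sigma).
  elim: B => [|B ih].
    rewrite big_ord1/=; case: (leP (y 0%N) 1) => yb.
      by rewrite (le_trans (Tu _ yb))// ler_pdivlMr// ler_piMr// gerBl.
    rewrite (le_trans (Tv _ yb))// -[leLHS]add0r lerD//; first exact: ltW.
    by rewrite ler_pdivlMr//; have := vc _ yb; lra.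
  rewrite big_ord_recr/=; case: (leP (y B.+1) 1) => yb.
    have yb' := le_trans (ym B) yb; rewrite yb' in ih.
    rewrite (le_trans (lerD ih (Tu _ yb)))// ler_pdivlMr// mulrDl divfK ?gt_eqF//.
    by have := ut B; lra.
  rewrite (le_trans (lerD (lexx _) (Tv _ yb)))// vs.
  case: (leP (y B) 1) ih => yb' ih; last first.
    rewrite (le_trans (lerD ih (lexx _)))// -addrA lerD2l.
    by rewrite le_eqVlt; apply/orP; left; apply/eqP; field; rewrite gt_eqF.
  rewrite (le_trans (lerD ih (lexx _)))// lerD//.
    by rewrite ler_pdivrMr// mulVf ?gt_eqF// u1.
  by rewrite ler_pdivlMr//; have := vc _ yb; rewrite vs; lra.
case=> [|B]; first by rewrite big_ord0 addr_ge0// ltW.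
rewrite (le_trans (main B))//; case: (leP (y B) 1) => yb.
  rewrite -[leLHS]addr0 lerD// ler_pdivrMr// mulVf ?gt_eqF//.
  exact: u1.
rewrite lerD2l ler_wpM2r ?invr_ge0 ?(ltW s1')// gerBl mulr_ge0// ltW//.
Qed.

Lemma sum_divn (J : nat) (F : nat -> R) B : (0 < J)%N ->
  \sum_(k < J * B) F (k %/ J)%N = J%:R * \sum_(b < B) F b.
Proof.
move=> J0; elim: B => [|B ih]; first by rewrite muln0 !big_ord0 mulr0.
rewrite mulnS addnC big_split_ord/= ih big_ord_recr/= mulrDr; congr (_ + _).
rewrite (eq_bigr (fun=> F B)) ?sumr_const ?card_ord ?mulr_natl// => k _.
by rewrite mulnC divnMDl// divn_small// addn0.
Qed.

End ElementaryBounds.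

Section Lacunary.
Context {R : realType} {d : nat}.
Local Notation V := 'rV[R[i]]_d.
Variables (w : R -> R) (J : nat) (Z : nat -> seq V).
Hypothesis w_gt0 : forall t, 0 < t <= 1 -> 0 < w t.
Hypothesis w_incr : {in `]0, 1] &, {homo w : s t / s <= t}}.
Hypothesis J0 : (0 < J)%N.
Hypothesis Z1 : forall k zeta, zeta \in Z k -> enorm zeta = 1.
Hypothesis Z_size : forall k,
  (size (Z k) <= (8 * d * block_scale J (k %/ J)).+1 ^ (2 * d))%N.
Hypothesis Z_bound : forall k z, enorm z = 1 ->
  normc (\sum_(zeta <- Z k) cdot z zeta ^+ degree J k) <= 2.

Definition scale_ratio : R := (degree_base J)%:R ^+ 2.
(** Block [b] has degrees about [1 / scale b], and acts at distance [scale b]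
from the sphere; the coefficients of its terms are the value of [w] there. *)
Definition scale b : R := scale_ratio^-1 ^+ b.+1.
Definition lacunary_coeff k := w (scale (k %/ J)).
Definition lacunary_fun : V -> R[i] := series_fun Z (degree J) lacunary_coeff.

Lemma scale_ratio_gt1 : 1 < scale_ratio.
Proof. by rewrite exprn_egt1// ltr1n degree_base_gt1. Qed.

Let q0 : 0 < scale_ratio. Proof. exact: lt_trans scale_ratio_gt1. Qed.

Lemma scale_gt0 b : 0 < scale b.
Proof. by rewrite exprn_gt0// invr_gt0. Qed.

Lemma scale_le1 b : scale b <= 1.
Proof. by rewrite exprn_ile1 ?invr_ge0 ?(ltW q0)// invf_le1// ltW// scale_ratio_gt1. Qed.

Let scale01 b : scale b \in `]0, 1].
Proof. by rewrite in_itv/= scale_gt0 scale_le1. Qed.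

Lemma scaleV b : (scale b)^-1 = (block_scale J b ^ 2)%:R.
Proof. by rewrite /scale exprVn invrK /scale_ratio /block_scale -exprM mulnC exprM -!natrX. Qed.

Lemma lacunary_coeff_ge0 k : 0 <= lacunary_coeff k.
Proof. by rewrite ltW// w_gt0// scale_gt0 scale_le1. Qed.

Let deg0 k : (0 < degree J k)%N. Proof. exact: degree_gt0. Qed.

Let coeff_le k : lacunary_coeff k <= w 1.
Proof. by apply: w_incr; rewrite ?scale01 ?scale_le1// in_itv/= ltr01 lexx. Qed.

Let degree_ge k : (k <= degree J k)%N.
Proof. by elim: k => // k ih; rewrite (leq_ltn_trans ih)// degree_mono. Qed.

Lemma lacunary_summable (r : R) : 0 < r < 1 -> exists B, forall K,
  \sum_(k < K) lacunary_coeff k * (size (Z k))%:R * (degree J k)%:R ^+ 2 * r ^+ degree J k <= B.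
Proof.
move=> /andP[r0 r1].
have s0 : 0 < Num.sqrt r by rewrite sqrtr_gt0.
have s1 : Num.sqrt r < 1 by rewrite -[ltRHS]sqrtr1 ltr_sqrt.
have s01 : 0 < Num.sqrt r < 1 by rewrite s0.
have [C CP] := natpow_pow_bounded (2 * d + 2) s01.
have rE n : r ^+ n = Num.sqrt r ^+ n * Num.sqrt r ^+ n.
  by rewrite -{1}(sqr_sqrtr (ltW r0)) expr2 exprMn.
set s := Num.sqrt r in s0 s1 s01 CP rE.
pose A := (8 * d).+1%:R ^+ (2 * d) : R.
have w1 : 0 <= w 1 by rewrite ltW// w_gt0// ltr01 lexx.
have C0 : 0 <= C by rewrite (le_trans _ (CP 0%N))// mulr_ge0 ?exprn_ge0// ltW.
exists (w 1 * (A * C) / (1 - s)) => K.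
rewrite ler_pdivlMr ?subr_gt0//.
apply: (@le_trans _ _ ((\sum_(k < K) w 1 * (A * C) * s ^+ k) * (1 - s))).
  rewrite ler_wpM2r ?subr_ge0 ?(ltW s1)//; apply: ler_sum => k _.
  set n := degree J k.
  have sz : (size (Z k))%:R <= A * n%:R ^+ (2 * d).
    rewrite /A -exprMn -natrM -natrX ler_nat (leq_trans (Z_size k))//.
    case: (posnP (2 * d)) => [->|d0]; first by rewrite !expn0.
    rewrite leq_exp2r//; have /andP[h _] := degree_bounds J0 k.
    have := block_scale_gt0 J (k %/ J); rewrite -/n in h *; nia.
  have n0 m : 0 <= n%:R ^+ m :> R by rewrite exprn_ge0.
  have sm m : 0 <= s ^+ m by rewrite exprn_ge0// ltW.
  have A0 : 0 <= A by rewrite exprn_ge0.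
  rewrite rE; apply: (@le_trans _ _ (w 1 * (A * n%:R ^+ (2 * d)) * n%:R ^+ 2 * (s ^+ n * s ^+ n))).
    rewrite ler_wpM2r ?mulr_ge0// ler_wpM2r//.
    by apply: ler_pM; rewrite ?lacunary_coeff_ge0 ?coeff_le.
  have -> : w 1 * (A * n%:R ^+ (2 * d)) * n%:R ^+ 2 * (s ^+ n * s ^+ n) =
      w 1 * (A * (n%:R ^+ (2 * d + 2) * s ^+ n)) * s ^+ n.
    by rewrite exprD; ring.
  apply: ler_pM; rewrite ?mulr_ge0//.
    by rewrite ler_wpM2l// ler_wpM2l.
  by rewrite ler_wiXn2l ?(ltW s0) ?(ltW s1)// degree_ge.
rewrite -mulr_sumr -mulrA ler_piMr// ?mulr_ge0// ?exprn_ge0//.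
by have := sum_geometric_right s01 0 K; under eq_bigr do rewrite subn0.
Qed.

(** Homogeneity extends the bound on the sphere to the ball. *)
Lemma lacunary_power_sum_le k z :
  normc (power_sum Z (degree J) k z) <= 2 * enorm z ^+ degree J k.
Proof.
have [/enorm_eq0 ->|z0] := eqVneq (enorm z) 0.
  rewrite /power_sum big1 ?normc0 ?enorm0 ?mulr_ge0 ?exprn_ge0// => zeta _.
  by rewrite -(scale0r 0) cdotZl mul0r expr0n gtn_eqF.
have ez : 0 < enorm z by rewrite lt_def z0 enorm_ge0.
have -> : z = (enorm z)%:C%C *: ((enorm z)^-1%:C%C *: z).
  by rewrite scalerA -rmorphM/= mulfV// scale1r.
set u := _ *: z; have u1 : enorm u = 1.
  by rewrite /u enormZ normc_real ger0_norm ?invr_ge0 ?(ltW ez)// mulVf.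
rewrite /power_sum; under eq_bigr do rewrite cdotZl exprMn.
rewrite -mulr_sumr normcM normcXn normc_real enormZ u1 mulr1 normc_real.
rewrite !ger0_norm ?(ltW ez)// mulrC ler_wpM2r ?exprn_ge0 ?(ltW ez)//.
exact: Z_bound.
Qed.

Variable eps : R.
Hypothesis eps_gt0 : 0 < eps.
Hypothesis w_decr : {in `]0, 1] &, {homo (fun t => w t / t `^ (1 - eps)) :
  s t / s <= t >-> t <= s}}.

(** Put [y = h / scale b]. For [y <= 1] the comparison of [w] at [h] and at
[scale b] given by the decrease of [w t / t ^ (1 - eps)] bounds the normalized
term by [y ^ eps]. For [y > 1] monotonicity of [w] bounds it by
[y (1 - h) ^ (y / h) <= 4 / y]. Both bounds are geometric in [b]. *)
Lemma block_derivative_bound : exists C, forall h B, 0 < h <= 1 ->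
  \sum_(b < B) w (scale b) / scale b * (1 - h) ^+ (block_scale J b ^ 2) <= C * (w h / h).
Proof.
have e1 : 1 `^ eps = 1 :> R by rewrite powR1.
pose tau := (scale_ratio `^ eps)^-1; pose sigma := scale_ratio^-1.
have qe0 : 0 < scale_ratio `^ eps by rewrite powR_gt0.
have tau01 : 0 <= tau < 1.
  rewrite invr_ge0 (ltW qe0) invf_lt1//= -e1.
  by rewrite gt0_ltr_powR ?nnegrE ?(ltW q0)// scale_ratio_gt1.
have sig01 : 0 < sigma < 1 by rewrite invr_gt0 q0 invf_lt1// scale_ratio_gt1.
exists ((1 - tau)^-1 + 4 / (1 - sigma)) => h B /andP[h0 h1].
have h01 : h \in `]0, 1] by rewrite in_itv/= h0.
have wh : 0 < w h by rewrite w_gt0// h0.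
have wx b : 0 < w (scale b) by rewrite w_gt0// scale_gt0 scale_le1.
have x0 b : scale b != 0 by rewrite gt_eqF// scale_gt0.
pose y b := h / scale b.
have y0 b : 0 < y b by rewrite divr_gt0// scale_gt0.
have yS b : y b.+1 = scale_ratio * y b.
  by rewrite /y /scale exprS invfM invrK; ring.
have r01 b : 0 <= (1 - h) ^+ (block_scale J b ^ 2) <= 1.
  by rewrite exprn_ge0 ?subr_ge0// exprn_ile1// ?subr_ge0// gerBl ltW.
rewrite -[leRHS]mulrC -ler_pdivrMl ?divr_gt0// mulr_sumr.
apply: (@sum_two_sided_geometric _ y (fun b => y b `^ eps) (fun b => 4 / y b)
  (fun b => (w h / h)^-1 * (w (scale b) / scale b * (1 - h) ^+ (block_scale J b ^ 2)))
  tau sigma 4) => //.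
- by move=> b; rewrite yS ler_peMl ?(ltW (y0 b))// ltW// scale_ratio_gt1.
- by move=> b; rewrite powR_ge0.
- by move=> b yb; rewrite -e1 ge0_ler_powR ?nnegrE ?(ltW eps_gt0)// ltW.
- by move=> b yb; rewrite ler_pdivrMr// ler_peMr// ltW.
- by move=> b; rewrite yS powRM ?(ltW q0) ?(ltW (y0 b))// mulrA mulVf ?gt_eqF// mul1r.
- by move=> b; rewrite yS invfM mulrCA.
- move=> b yb; have hx : h <= scale b by rewrite -[leRHS]mul1r -ler_pdivrMr// scale_gt0.
  have := w_decr h01 (scale01 b) hx.
  have powE t : 0 < t -> t `^ (1 - eps) = t / t `^ eps.
    by move=> t0; rewrite powRB ?powRr1 ?(ltW t0)// (gt_eqF t0) implybT.
  rewrite !powE ?scale_gt0//.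
  have he : 0 < h `^ eps by rewrite powR_gt0.
  have xe : 0 < scale b `^ eps by rewrite powR_gt0// scale_gt0.
  have E : y b `^ eps * scale b `^ eps = h `^ eps.
    by rewrite -powRM ?(ltW (y0 b)) ?(ltW (scale_gt0 b))// /y divfK.
  have ye := powR_ge0 (y b) eps; move: (y b `^ eps) E ye => Y E ye.
  move=> hw; rewrite !invf_div !mulrA ler_pdivrMr ?scale_gt0// mulrAC ler_pdivlMr ?scale_gt0// -E in hw.
  rewrite ler_pdivrMl ?divr_gt0//.
  have /andP[r0 r1] := r01 b; apply: (@le_trans _ _ (w (scale b) / scale b)).
    by rewrite ler_piMr// divr_ge0 ?(ltW (wx b)) ?(ltW (scale_gt0 b)).
  rewrite ler_pdivrMr ?scale_gt0// -(ler_pM2r xe) -(ler_pM2r h0) (le_trans hw)//.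
  by rewrite le_eqVlt; apply/orP; left; apply/eqP; field; rewrite gt_eqF.
- move=> b yb; have hx : scale b <= h.
    by move: yb; rewrite ltr_pdivlMr ?scale_gt0// mul1r; exact: ltW.
  have ww : w (scale b) <= w h by apply: w_incr.
  have h01' : 0 <= h <= 1 by rewrite (ltW h0).
  have := one_sub_pow_le (block_scale J b ^ 2) h01'; rewrite -scaleV -/(y b).
  have /andP[] := r01 b; move: (_ ^+ (_ ^ 2)%N) => r r0 _ hr.
  rewrite ler_pdivlMr// (le_trans _ hr)//.
  have -> : (w h / h)^-1 * (w (scale b) / scale b * r) * y b =
      (w (scale b) / w h) * (r * y b ^+ 2).
    by rewrite /y; field; rewrite x0 !gt_eqF.
  have ry : 0 <= r * y b ^+ 2 by rewrite mulr_ge0// sqr_ge0.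
  by rewrite ler_piMl// ler_pdivrMr// mul1r.
- by move=> b; rewrite divr_ge0// ltW.
Qed.

(** At distance [h] from the sphere the [k]th term of the radial derivative is
at most [4] times the term of its block in [block_derivative_bound], and a
block has [J] terms. *)
Lemma lacunary_bloch : bloch_space w lacunary_fun.
Proof.
split; first exact: (series_fun_holomorphic Z1 deg0 lacunary_coeff_ge0 lacunary_summable).
have [C CP] := block_derivative_bound.
suff bound z : unit_ball z -> normc (radial_derivative lacunary_fun z) <=
    4 * J%:R * C * (w (1 - enorm z) / (1 - enorm z)).
  rewrite /bloch_norm lte_add_pinfty// ?ltry//.
  apply: (@le_lt_trans _ _ (4 * J%:R * C)%:E); last exact: ltry.
  apply: ub_ereal_sup => _ [z bz <-]; rewrite lee_fin.
  have z1 : 0 < 1 - enorm z by rewrite subr_gt0.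
  have wz : 0 < w (1 - enorm z) by rewrite w_gt0// z1 lerBlDr lerDl enorm_ge0.
  rewrite ler_pdivrMr// -ler_pdivlMr// -mulrA; exact: bound.
move=> bz; set h := 1 - enorm z.
have h01 : 0 < h <= 1 by rewrite subr_gt0 bz lerBlDr lerDl enorm_ge0.
apply/ler_addgt0Pr => e e0.
have [N NP] := radial_derivative_series Z1 deg0 lacunary_coeff_ge0 lacunary_summable bz e0.
have NJ : (N <= J * N)%N by rewrite leq_pmull.
have := NP _ NJ; set S := \sum_(k < J * N) _ => lS.
rewrite -(subrK S (radial_derivative _ _)) (le_trans (le_normcD _ _))// addrC lerD//.
rewrite (le_trans (ler_normc_sum _ _ _))//.
apply: (@le_trans _ _ (\sum_(k < J * N) 4 *
    (w (scale (k %/ J)) / scale (k %/ J) * (1 - h) ^+ (block_scale J (k %/ J) ^ 2)))).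
  apply: ler_sum => k _; have /andP[lo hi] := degree_bounds J0 k.
  rewrite normcM normc_real ger0_norm ?mulr_ge0 ?lacunary_coeff_ge0//.
  rewrite scaleV /lacunary_coeff.
  have w0 : 0 < w (scale (k %/ J)) by rewrite w_gt0// scale_gt0 scale_le1.
  have := lacunary_power_sum_le k z; set W := normc _ => leW.
  have rE : 1 - h = enorm z by rewrite /h; ring.
  have pw : enorm z ^+ degree J k <= enorm z ^+ (block_scale J (k %/ J) ^ 2).
    by rewrite ler_wiXn2l ?enorm_ge0// ltW.
  have deg : (degree J k)%:R <= 2 * (block_scale J (k %/ J) ^ 2)%:R :> R.
    by rewrite -natrM ler_nat.
  rewrite rE; set n := (degree J k)%:R in deg *; set m := (block_scale _ _ ^ 2)%:R in deg *.
  set p := enorm z ^+ _ in pw.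
  have p0 : 0 <= p by rewrite exprn_ge0// enorm_ge0.
  have -> : 4 * (w (scale (k %/ J)) * m * enorm z ^+ (block_scale J (k %/ J) ^ 2)) =
    w (scale (k %/ J)) * (2 * m) * (2 * enorm z ^+ (block_scale J (k %/ J) ^ 2)) by ring.
  apply: ler_pM; rewrite ?mulr_ge0 ?normc_ge0 ?(ltW w0)//.
    by rewrite ler_wpM2l ?(ltW w0).
  by rewrite (le_trans leW)// ler_wpM2l.
rewrite -mulr_sumr (sum_divn (fun b => w (scale b) / scale b * (1 - h) ^+ (block_scale J b ^ 2)))//.
by rewrite !mulrA -(mulrA (_ * _)) -(mulrA (_ * _)) ler_wpM2l ?mulr_ge0// CP.
Qed.

End Lacunary.

(** * Integrals over the sphere and orthogonality *)

Lemma cisX (R : realType) (t : R) n : cis t ^+ n = cis (n%:R * t).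
Proof.
elim: n => [|n ih]; first by rewrite expr0 mul0r /cis cos0 sin0.
by rewrite exprS ih -natr1 mulrDl mul1r /cis cosD sinD; simpc; congr (_ +i* _)%C; ring.
Qed.

Section SphereIntegral.
Context {R : realType} {d : nat}.
Local Notation V := 'rV[R[i]]_d.
Local Notation sigma := (sphere_measure R d).
Local Notation S := ([set z : V | enorm z = 1] : set (borel_space R d)).
Implicit Types (g h : V -> R) (F G : V -> R[i]).

(** A class of functions closed under the ring operations, all of whose
members are integrable: the measure is finite, and the bound holds on the
sphere, where the integrals are taken. *)
Definition bounded_measurable g :=
  measurable_fun setT (g : borel_space R d -> R) /\
  exists C : R, forall z, enorm z = 1 -> `|g z| <= C.

Definition sphere_integral g : R := \int[sigma]_(z in S) (g : borel_space R d -> R) z.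

Let sigmaS : (sigma S < +oo)%E.
Proof. by rewrite (le_lt_trans (probability_le1 _ measurable_sphere))// ltry. Qed.

Lemma bounded_measurable_integrable g : bounded_measurable g ->
  sigma.-integrable S (EFin \o (g : borel_space R d -> R)).
Proof.
move=> [mg [C CP]]; apply: measurable_bounded_integrable => //; first exact: measurable_sphere.
  exact: measurable_funTS.
by exists C; split => [|x Cx z /CP h]; [exact: num_real|exact: le_trans h (ltW Cx)].
Qed.

Lemma bounded_measurable_cst c : bounded_measurable (fun=> c).
Proof. by split; [exact: measurable_cst|exists `|c|]. Qed.

Lemma bounded_measurableD g h : bounded_measurable g -> bounded_measurable h ->
  bounded_measurable (fun z => g z + h z).
Proof.
move=> [mg [C CP]] [mh [D DP]]; split; first exact: measurable_funD.
by exists (C + D) => z z1; rewrite (le_trans (ler_normD _ _))// lerD ?CP ?DP.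
Qed.

Lemma bounded_measurableM g h : bounded_measurable g -> bounded_measurable h ->
  bounded_measurable (fun z => g z * h z).
Proof.
move=> [mg [C CP]] [mh [D DP]]; split; first exact: measurable_funM.
by exists (C * D) => z z1; rewrite normrM ler_pM ?CP ?DP.
Qed.

Lemma bounded_measurableZ c g : bounded_measurable g ->
  bounded_measurable (fun z => c * g z).
Proof. exact/bounded_measurableM/bounded_measurable_cst. Qed.

Lemma bounded_measurable_sum I (s : seq I) (P : pred I) (g : I -> V -> R) :
  (forall i, bounded_measurable (g i)) ->
  bounded_measurable (fun z => \sum_(i <- s | P i) g i z).
Proof.
move=> bg; elim: s => [|i s ih].
  by under eq_fun do rewrite big_nil; exact: bounded_measurable_cst.
under eq_fun do rewrite big_cons; case: (P i) => //.
exact: bounded_measurableD.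
Qed.

Lemma bounded_measurable_indic (A : set (borel_space R d)) : measurable A ->
  bounded_measurable (\1_A : V -> R).
Proof.
move=> mA; split; first exact: measurable_indic.
by exists 1 => z _; rewrite indicE normr_nat; case: (_ \in _).
Qed.

Lemma bounded_measurable_continuous g (C : R) :
  (forall z e, 0 < e -> exists2 r : R, 0 < r &
     forall z', enorm (z' - z) < r -> `|g z' - g z| < e) ->
  (forall z, enorm z = 1 -> `|g z| <= C) -> bounded_measurable g.
Proof.
move=> gc gC; split; last by exists C.
apply: (measurability _ (RGenOInfty.measurableE R)) => // _ [_ [a ->] <-].
rewrite setTI; apply: sub_sigma_algebra; rewrite openE => z /=.
rewrite in_itv/= andbT => az; have e0 : 0 < g z - a by rewrite subr_gt0.
have [r r0 rP] := gc z _ e0.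
apply/nbhs_enormP; exists r => // z' /rP; rewrite ltr_norml/= in_itv/= andbT => /andP[].
by lra.
Qed.

Lemma eq_sphere_integral g h : (forall z, enorm z = 1 -> g z = h z) ->
  sphere_integral g = sphere_integral h.
Proof. by move=> gh; apply: eq_Rintegral => z; rewrite inE; exact: gh. Qed.

Lemma sphere_integralD g h : bounded_measurable g -> bounded_measurable h ->
  sphere_integral (fun z => g z + h z) = sphere_integral g + sphere_integral h.
Proof.
by move=> bg bh; apply: RintegralD; [exact: measurable_sphere|exact: bounded_measurable_integrable..].
Qed.

Lemma sphere_integralZ c g : bounded_measurable g ->
  sphere_integral (fun z => c * g z) = c * sphere_integral g.
Proof.
by move=> bg; apply: RintegralZl; [exact: measurable_sphere|exact: bounded_measurable_integrable].
Qed.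

Lemma sphere_integral_sum I (s : seq I) (P : pred I) (g : I -> V -> R) :
  (forall i, bounded_measurable (g i)) ->
  sphere_integral (fun z => \sum_(i <- s | P i) g i z) =
  \sum_(i <- s | P i) sphere_integral (g i).
Proof.
move=> bg; elim: s => [|i s ih].
  rewrite big_nil -[RHS](mul0r (sphere_integral (fun=> 0))) -sphere_integralZ; last first.
    exact: bounded_measurable_cst.
  by apply: eq_sphere_integral => z _; rewrite big_nil mul0r.
rewrite big_cons -ih; under [LHS]eq_sphere_integral do rewrite big_cons.
by case: (P i) => //; rewrite sphere_integralD//; exact: bounded_measurable_sum.
Qed.

Lemma sphere_integral_le g h : bounded_measurable g -> bounded_measurable h ->
  (forall z, enorm z = 1 -> g z <= h z) -> sphere_integral g <= sphere_integral h.
Proof.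
move=> bg bh gh; rewrite /sphere_integral; apply: le_Rintegral => //.
- exact: measurable_sphere.
- exact: bounded_measurable_integrable.
- exact: bounded_measurable_integrable.
Qed.

Lemma sphere_integral_cst_le c : 0 <= c -> sphere_integral (fun=> c) <= c.
Proof.
move=> c0; have mS := @measurable_sphere R d.
rewrite /sphere_integral Rintegral_cst// ler_piMr// -lee_fin fineK ?fin_num_measure//.
exact: probability_le1.
Qed.

Lemma sphere_integral_indic (A : set (borel_space R d)) : measurable A -> A `<=` S ->
  sphere_integral (\1_A : V -> R) = fine (sigma A).
Proof.
move=> mA AS; rewrite /sphere_integral /Rintegral integral_indic//.
  by rewrite (_ : A `&` _ = A)//; apply/setIidl.
exact: measurable_sphere.
Qed.

(** A name for the rotation, to which the structure of measurable function can
be attached. *)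
Definition scale_map (u : R[i]) (z : borel_space R d) : borel_space R d := u *: (z : V).

Lemma measurable_scale_map u : measurable_fun setT (scale_map u).
Proof. by move=> _ A mA; rewrite setTI; exact: measurable_scale. Qed.

HB.instance Definition _ u :=
  isMeasurableFun.Build _ _ _ _ (scale_map u) (measurable_scale_map u).

Lemma sphere_integral_rotation u g : normc u = 1 -> bounded_measurable g ->
  sphere_integral (fun z => g (u *: z)) = sphere_integral g.
Proof.
move=> u1 bg; have mS := @measurable_sphere R d; have [mg [C CP]] := bg.
have phiS : scale_map u @^-1` S = S.
  by apply/seteqP; split => z; rewrite /= /scale_map enormZ u1 mul1r.
have bgu : bounded_measurable (fun z => g (u *: z)).
  split; first exact: measurableT_comp mg (measurable_scale_map u).
  by exists C => z z1; apply: CP; rewrite enormZ u1 mul1r.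
have E : (\int[sigma]_(z in S) ((g : borel_space R d -> R) z)%:E =
    \int[pushforward sigma (scale_map u)]_(z in S) ((g : borel_space R d -> R) z)%:E)%E.
  by apply: eq_measure_integral => A mA _; exact/esym/sphere_measure_rotation.
congr fine; rewrite E integral_pushforward ?phiS//.
- exact/measurable_EFinP.
- exact: bounded_measurable_integrable.
Qed.

Definition bounded_measurableC F := forall b, bounded_measurable (fun z => cpart b (F z)).

Lemma bounded_measurableC_cst c : bounded_measurableC (fun=> c).
Proof. by move=> b; exact: bounded_measurable_cst. Qed.

Lemma bounded_measurableCD F G : bounded_measurableC F -> bounded_measurableC G ->
  bounded_measurableC (fun z => F z + G z).
Proof.
move=> bF bG b; rewrite (_ : (fun z => _) = fun z => cpart b (F z) + cpart b (G z)).
  exact: bounded_measurableD.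
by apply/funext => z; case: b; rewrite /cpart raddfD.
Qed.

Lemma bounded_measurableC_conj F : bounded_measurableC F ->
  bounded_measurableC (fun z => conjc (F z)).
Proof.
move=> bF b.
rewrite (_ : (fun z => _) = fun z => (if b then 1 else -1) * cpart b (F z)).
  exact: bounded_measurableZ.
by apply/funext => z; case: b; rewrite /cpart; case: (F z) => x y /=; rewrite ?mul1r ?mulN1r.
Qed.

Lemma bounded_measurableCM F G : bounded_measurableC F -> bounded_measurableC G ->
  bounded_measurableC (fun z => F z * G z).
Proof.
move=> bF bG; have M b b' := bounded_measurableM (bF b) (bG b').
case.
- rewrite (_ : (fun z => _) = fun z => cpart true (F z) * cpart true (G z) +
    - 1 * (cpart false (F z) * cpart false (G z))).
    exact/bounded_measurableD/bounded_measurableZ.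
  by apply/funext => z; rewrite /cpart Re_mulc; ring.
- rewrite (_ : (fun z => _) = fun z => cpart true (F z) * cpart false (G z) +
    (cpart false (F z) * cpart true (G z))).
    exact: bounded_measurableD.
  by apply/funext => z; rewrite /cpart Im_mulc; ring.
Qed.

Lemma bounded_measurableC_exp F n : bounded_measurableC F ->
  bounded_measurableC (fun z => F z ^+ n).
Proof.
move=> bF; elim: n => [|n ih]; first exact: bounded_measurableC_cst.
by under eq_fun do rewrite exprS; exact: bounded_measurableCM.
Qed.

Lemma bounded_measurableC_sum I (s : seq I) (F : I -> V -> R[i]) :
  (forall i, bounded_measurableC (F i)) ->
  bounded_measurableC (fun z => \sum_(i <- s) F i z).
Proof.
move=> bF; elim: s => [|i s ih].
  by under eq_fun do rewrite big_nil; exact: bounded_measurableC_cst.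
by under eq_fun do rewrite big_cons; exact: bounded_measurableCD.
Qed.

Lemma bounded_measurableC_cdot zeta : bounded_measurableC (fun z => cdot z zeta).
Proof.
apply: bounded_measurableC_sum => j; apply: bounded_measurableCM; last first.
  exact: bounded_measurableC_cst.
move=> b; apply: (@bounded_measurable_continuous _ 1) => [z e e0|z z1].
  exists e => // z' zz'; rewrite -cpartB (le_lt_trans (cpart_norm _ _))//.
  by rewrite (le_lt_trans _ zz')//; have := normc_coord (z' - z) j; rewrite !mxE.
by rewrite (le_trans (cpart_norm _ _))// -z1 normc_coord.
Qed.

Lemma bounded_measurableC_power_sum (Z : nat -> seq V) (n : nat -> nat) k :
  bounded_measurableC (power_sum Z n k).
Proof.
apply: bounded_measurableC_sum => zeta.
exact/bounded_measurableC_exp/bounded_measurableC_cdot.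
Qed.

(** Rotating by [u] multiplies [G] by [u ^ (p - q)], which is [-1] for a
suitable [u], while the measure is invariant. *)
Lemma sphere_integral_bihomogeneous G p q : p != q -> bounded_measurableC G ->
  (forall u z, normc u = 1 -> G (u *: z) = u ^+ p * conjc u ^+ q * G z) ->
  sphere_integral (fun z => complex.Re (G z)) = 0.
Proof.
move=> pq bG hG.
have [u u1 uN] : exists2 u : R[i], normc u = 1 & u ^+ p * conjc u ^+ q = -1.
  have root m : (0 < m)%N -> exists2 v : R[i], normc v = 1 & v ^+ m = -1.
    move=> m0; exists (cis (pi / m%:R)); first exact: normc_cis.
    by rewrite cisX mulrC divfK ?pnatr_eq0 -?lt0n// /cis cospi sinpi; simpc.
  have unit (v : R[i]) : normc v = 1 -> v * conjc v = 1.
    move=> v1; have := sqr_normcE v; rewrite v1 expr1n; case: (v) => x y /= e.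
    by apply/eqP; rewrite eq_complex/= mulrN opprK -!expr2 -e eqxx/=; apply/eqP; ring.
  have [qp|qp|E] := ltngtP q p; last by rewrite E eqxx in pq.
    have [v v1 vN] := root (p - q)%N ltac:(by rewrite subn_gt0).
    exists v => //; rewrite -(subnK (ltnW qp)) exprD vN -mulrA -exprMn unit//.
    by rewrite expr1n mulr1.
  have [v v1 vN] := root (q - p)%N ltac:(by rewrite subn_gt0).
  exists (conjc v); first by rewrite normc_conj.
  rewrite conjcK -(subnK (ltnW qp)) exprD vN mulrCA -exprMn [_ * v]mulrC unit//.
  by rewrite expr1n mulr1.
have := sphere_integral_rotation u1 (bG true).
rewrite (_ : sphere_integral _ = - sphere_integral (fun z => complex.Re (G z))).
  by rewrite /cpart; lra.
rewrite -mulN1r -sphere_integralZ; last exact: (bG true).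
by apply: eq_sphere_integral => z _; rewrite /cpart hG// uN !mulN1r; case: (G z).
Qed.

(** The integral of the square of [c g - \sum_i a_i phi_i], where [a_i] is the
integral of [g phi_i], is nonnegative. *)
Lemma sphere_bessel (I : finType) (P : pred I) (phi : I -> V -> R) g (c : R) :
  0 < c -> bounded_measurable g -> (forall i, bounded_measurable (phi i)) ->
  (forall i j, P i -> P j -> i != j -> sphere_integral (fun z => phi i z * phi j z) = 0) ->
  (forall i, sphere_integral (fun z => phi i z * phi i z) <= c) ->
  \sum_(i | P i) sphere_integral (fun z => g z * phi i z) ^+ 2 <=
  c * sphere_integral (fun z => g z * g z).
Proof.
move=> c0 bg bphi ortho nphi; set a := fun i => sphere_integral (fun z => g z * phi i z).
rewrite -/(\sum_(i | P i) a i ^+ 2); set T := \sum_(i | P i) _.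
have bgg := bounded_measurableM bg bg; have bgp i := bounded_measurableM bg (bphi i).
have bpp i j := bounded_measurableM (bphi i) (bphi j).
pose F z := c ^+ 2 * (g z * g z) + (- 2 * c * (\sum_(i | P i) a i * (g z * phi i z)) +
   \sum_(i | P i) \sum_(j | P j) a i * a j * (phi i z * phi j z)).
have b1 : bounded_measurable (fun z => \sum_(i | P i) a i * (g z * phi i z)).
  by apply: bounded_measurable_sum => i; exact: bounded_measurableZ.
have b2 i : bounded_measurable (fun z => \sum_(j | P j) a i * a j * (phi i z * phi j z)).
  by apply: bounded_measurable_sum => j; exact: bounded_measurableZ.
have b3 : bounded_measurable (fun z => \sum_(i | P i) \sum_(j | P j) a i * a j * (phi i z * phi j z)).
  by apply: bounded_measurable_sum => i.
have FE : sphere_integral F = c ^+ 2 * sphere_integral (fun z => g z * g z) +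
    (- 2 * c * T + \sum_(i | P i) a i ^+ 2 * sphere_integral (fun z => phi i z * phi i z)).
  rewrite sphere_integralD ?sphere_integralZ//; try exact: bounded_measurableZ; last first.
    by apply: bounded_measurableD => //; exact: bounded_measurableZ.
  rewrite sphere_integralD ?sphere_integralZ//; last exact: bounded_measurableZ.
  congr (_ + (_ * _ + _)).
    rewrite sphere_integral_sum => [|i]; last exact: bounded_measurableZ.
    by apply: eq_bigr => i _; rewrite sphere_integralZ.
  rewrite sphere_integral_sum//; apply: eq_bigr => i Pi.
  rewrite sphere_integral_sum => [|j]; last exact: bounded_measurableZ.
  rewrite (bigD1 i)//= sphere_integralZ// -expr2 big1 ?addr0// => j /andP[Pj ji].
  by rewrite sphere_integralZ// ortho 1?eq_sym// mulr0.
have F0 : 0 <= sphere_integral F.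
  rewrite -[leLHS](mul0r (sphere_integral (fun=> 0))) -sphere_integralZ; last first.
    exact: bounded_measurable_cst.
  apply: sphere_integral_le; first exact/bounded_measurableZ/bounded_measurable_cst.
    apply: bounded_measurableD; first exact: bounded_measurableZ.
    by apply: bounded_measurableD => //; exact: bounded_measurableZ.
  move=> z _; rewrite mul0r.
  have -> : F z = (c * g z - \sum_(i | P i) a i * phi i z) ^+ 2.
    have -> : (c * g z - \sum_(i | P i) a i * phi i z) ^+ 2 = c ^+ 2 * (g z * g z) +
      (- 2 * c * (g z * \sum_(i | P i) a i * phi i z) +
       (\sum_(i | P i) a i * phi i z) * \sum_(i | P i) a i * phi i z) by ring.
    rewrite /F; congr (_ + (_ * _ + _)).
      by rewrite mulr_sumr; apply: eq_bigr => i _; rewrite mulrCA.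
    rewrite mulr_suml; apply: eq_bigr => i _; rewrite mulr_sumr.
    by apply: eq_bigr => j _; ring.
  exact: sqr_ge0.
have le2 : \sum_(i | P i) a i ^+ 2 * sphere_integral (fun z => phi i z * phi i z) <= c * T.
  by rewrite /T mulr_sumr; apply: ler_sum => i _; rewrite [leRHS]mulrC ler_wpM2l// sqr_ge0.
rewrite -(ler_pM2l c0); rewrite FE in F0; lra.
Qed.

End SphereIntegral.

(** * Square sums on a set of boundedness *)

Section TriangularSums.
Context {R : realType}.

Lemma sqr_normc_sum (X : nat -> R[i]) m :
  normc (\sum_(k < m) X k) ^+ 2 = \sum_(k < m) normc (X k) ^+ 2 +
    2 * \sum_(k < m) \sum_(j < k) complex.Re (X j * conjc (X k)).
Proof.
elim: m => [|m ih]; first by rewrite !big_ord0 normc0 expr0n mulr0 addr0.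
rewrite !big_ord_recr/=; set Y := \sum_(k < m) X k in ih *.
have -> : \sum_(j < m) complex.Re (X j * conjc (X m)) = complex.Re (Y * conjc (X m)).
  by rewrite mulr_suml raddf_sum.
rewrite !mulrDr addrACA -ih !sqr_normcE.
by case: (Y) => x y; case: (X m) => x' y' /=; ring.
Qed.

(** Cauchy-Schwarz over the pairs, using that the sum of the
[b j ^ 2 * b k ^ 2] over [j < k] is at most the square of that of the
[b k ^ 2]. *)
Lemma off_diagonal_le (b : nat -> R) (c : nat -> nat -> R) (eta : R) m :
  0 < eta -> 0 < \sum_(k < m) b k ^+ 2 ->
  \sum_(k < m) \sum_(j < k) c j k ^+ 2 <= eta ^+ 2 ->
  - (\sum_(k < m) \sum_(j < k) b j * b k * c j k) <= eta * \sum_(k < m) b k ^+ 2.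
Proof.
move=> eta0; set T := \sum_(k < m) b k ^+ 2 => T0 cle.
have tri : \sum_(k < m) \sum_(j < k) b j ^+ 2 * b k ^+ 2 <= T ^+ 2.
  rewrite expr2 {2}/T mulr_sumr; apply: ler_sum => k _.
  rewrite -mulr_suml ler_wpM2r ?sqr_ge0// /T (big_ord_widen _ (fun j => b j ^+ 2) (ltnW (ltn_ord k))).
  rewrite [leLHS]big_mkcond; apply: ler_sum => j _; case: ifP => // _; exact: sqr_ge0.
clearbody T; have e2 : 0 < 2 * eta * T by rewrite !mulr_gt0.
rewrite -(ler_pM2l e2).
apply: (@le_trans _ _ (eta ^+ 2 * (\sum_(k < m) \sum_(j < k) b j ^+ 2 * b k ^+ 2) +
   T ^+ 2 * \sum_(k < m) \sum_(j < k) c j k ^+ 2)).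
  rewrite mulrN -mulNr !mulr_sumr -big_split/=; apply: ler_sum => k _.
  rewrite !mulr_sumr -big_split/=; apply: ler_sum => j _.
  have := sqr_ge0 (eta * (b j * b k) + T * c j k); move=> h.
  by rewrite -subr_ge0; apply: le_trans h _; rewrite le_eqVlt; apply/orP; left; apply/eqP; ring.
have -> : 2 * eta * T * (eta * T) = eta ^+ 2 * T ^+ 2 + T ^+ 2 * eta ^+ 2 by ring.
by rewrite lerD// ler_wpM2l// sqr_ge0.
Qed.

(** The sums over the pairs below [K] increase with [K] and are bounded. *)
Lemma pair_tail (c : nat -> nat -> R) (C eta : R) : 0 < eta ->
  (forall K, \sum_(k < K) \sum_(j < k) c j k ^+ 2 <= C) ->
  exists N0, forall N m, (N0 <= N)%N ->
    \sum_(k < m) \sum_(j < k) c (N + j)%N (N + k)%N ^+ 2 <= eta.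
Proof.
move=> eta0 cC; pose P K := \sum_(k < K) \sum_(j < k) c j k ^+ 2.
have Pnd : {homo P : m n / (m <= n)%N >-> m <= n}.
  move=> m n mn; rewrite -(subnKC mn) /P big_split_ord/= lerDl.
  by apply: sumr_ge0 => k _; apply: sumr_ge0 => j _; exact: sqr_ge0.
have [N0 N0P] := nondecreasing_bounded_tail Pnd cC eta0.
exists N0 => N m N0N; apply: le_trans (N0P (N + m)%N).
rewrite lerBrDr (le_trans (lerD (lexx _) (Pnd _ _ N0N)))// /P big_split_ord/= [leLHS]addrC lerD2l.
apply: ler_sum => k _; rewrite big_split_ord/= lerDr.
by apply: sumr_ge0 => j _; exact: sqr_ge0.
Qed.

End TriangularSums.

Lemma sum_blocks (R : realType) (F : nat -> R) J B :
  \sum_(k < J * B) F k = \sum_(b < B) \sum_(i < J) F (J * b + i)%N.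
Proof.
elim: B => [|B ih]; first by rewrite muln0 !big_ord0.
by rewrite mulnS addnC big_split_ord/= ih big_ord_recr.
Qed.

Lemma block_index J b i : (i < J)%N -> ((J * b + i) %/ J = b)%N.
Proof. by move=> iJ; rewrite mulnC divnMDl ?divn_small ?addn0// (leq_ltn_trans _ iJ). Qed.

Section Divergence.
Context {R : realType} {d : nat}.
Local Notation V := 'rV[R[i]]_d.
Local Notation sigma := (sphere_measure R d).
Local Notation S := ([set z : V | enorm z = 1] : set (borel_space R d)).
Variables (w : R -> R) (J : nat) (Z : nat -> seq V).
Hypothesis w_gt0 : forall t, 0 < t <= 1 -> 0 < w t.
Hypothesis w_incr : {in `]0, 1] &, {homo w : s t / s <= t}}.
Hypothesis J0 : (0 < J)%N.
Hypothesis Z1 : forall k zeta, zeta \in Z k -> enorm zeta = 1.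
Hypothesis Z_size : forall k,
  (size (Z k) <= (8 * d * block_scale J (k %/ J)).+1 ^ (2 * d))%N.
Hypothesis Z_bound : forall k z, enorm z = 1 ->
  normc (\sum_(zeta <- Z k) cdot z zeta ^+ degree J k) <= 2.
Hypothesis Z_peak : forall b z, enorm z = 1 -> exists2 i, (i < J)%N &
  2^-1 <= normc (\sum_(zeta <- Z (J * b + i)) cdot z zeta ^+ degree J (J * b + i)).

Local Notation W := (power_sum Z (degree J)).

Lemma power_sum_homogeneous u k z : W k (u *: z) = u ^+ degree J k * W k z.
Proof.
by rewrite /power_sum mulr_sumr; apply: eq_bigr => zeta _; rewrite cdotZl exprMn.
Qed.

(** The cross terms in the expansion of the square modulus of a sum of
[power_sum]s. *)
Definition pair_product j k (z : V) : R := complex.Re (W j z * conjc (W k z)).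

Let bW k : bounded_measurableC (W k).
Proof. exact: bounded_measurableC_power_sum. Qed.

Lemma bounded_measurable_pair_product j k : bounded_measurable (pair_product j k).
Proof. exact: (bounded_measurableCM (bW j) (bounded_measurableC_conj (bW k)) true). Qed.

(** The product of two real parts is half the sum of the real parts of
[X Y] and [X conj Y]. Both are bihomogeneous, the first with unequal degrees
because all differences of degrees have the same sign, the second because
differences of degrees determine the pair. *)
Lemma pair_product_orthogonal j k l m : (j < k)%N -> (l < m)%N -> (j, k) != (l, m) ->
  sphere_integral (fun z => pair_product j k z * pair_product l m z) = 0.
Proof.
move=> jk lm ne.
have bX := bounded_measurableCM (bW j) (bounded_measurableC_conj (bW k)).
have bY := bounded_measurableCM (bW l) (bounded_measurableC_conj (bW m)).
have djk := degree_mono J0 jk; have dlm := degree_mono J0 lm.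
have b1 := bounded_measurableCM bX bY.
have b2 := bounded_measurableCM bX (bounded_measurableC_conj bY).
have h1 : sphere_integral (fun z => complex.Re
    (W j z * conjc (W k z) * (W l z * conjc (W m z)))) = 0.
  apply: (@sphere_integral_bihomogeneous _ _ _ (degree J j + degree J l)
    (degree J k + degree J m)) => //; first by rewrite neq_ltn; apply/orP; left; lia.
  by move=> u z _; rewrite !power_sum_homogeneous !rmorphM !rmorphXn/= !exprD; ring.
have h2 : sphere_integral (fun z => complex.Re
    (W j z * conjc (W k z) * conjc (W l z * conjc (W m z)))) = 0.
  apply: (@sphere_integral_bihomogeneous _ _ _ (degree J j + degree J m)
    (degree J k + degree J l)) => //.
    apply: contra_neq ne => e; have [|-> ->//] := @degree_sidon J J0 j k l m jk lm.
    lia.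
  move=> u z _; rewrite !power_sum_homogeneous !rmorphM !rmorphXn/= !exprD !conjcK; ring.
have -> : 0 = 2^-1 * (sphere_integral (fun z => complex.Re
    (W j z * conjc (W k z) * (W l z * conjc (W m z)))) + sphere_integral (fun z => complex.Re
    (W j z * conjc (W k z) * conjc (W l z * conjc (W m z))))) by rewrite h1 h2 addr0 mulr0.
rewrite -sphere_integralD; [|exact: (b1 true)|exact: (b2 true)].
rewrite -sphere_integralZ; last by apply: bounded_measurableD; [exact: (b1 true)|exact: (b2 true)].
apply: eq_sphere_integral => z _; rewrite /pair_product.
case: (W j z * conjc (W k z)) => x y; case: (W l z * conjc (W m z)) => x' y' /=.
by field.
Qed.

Let W_le k z : enorm z = 1 -> normc (W k z) <= 2.
Proof. exact: Z_bound. Qed.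

Lemma pair_product_norm j k :
  sphere_integral (fun z => pair_product j k z * pair_product j k z) <= 16.
Proof.
apply: le_trans (sphere_integral_cst_le (ltac:(by []) : 0 <= (16 : R))).
have bp := bounded_measurable_pair_product j k.
apply: sphere_integral_le; [exact: bounded_measurableM|exact: bounded_measurable_cst|].
move=> z z1; have : `|pair_product j k z| <= 4.
  rewrite /pair_product (le_trans (normc_Re _))// normcM normc_conj.
  have -> : 4 = 2 * 2 :> R by ring.
  by rewrite ler_pM ?normc_ge0 ?W_le.
by rewrite ler_norml => /andP[]; nra.
Qed.

Variable E : set (borel_space R d).
Hypothesis mE : measurable E.
Hypothesis ES : E `<=` S.

(** Fourier coefficients of the indicator of [E] on the orthogonal system of the
[pair_product]s. *)
Definition pair_coeff j k : R := sphere_integral (fun z => \1_E z * pair_product j k z).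

Let bE : bounded_measurable (\1_E : V -> R).
Proof. exact: bounded_measurable_indic. Qed.

Lemma pair_coeff_summable K : \sum_(k < K) \sum_(j < k) pair_coeff j k ^+ 2 <= 16.
Proof.
have -> : \sum_(k < K) \sum_(j < k) pair_coeff j k ^+ 2 =
    \sum_(k < K) \sum_(j < K | (j < k)%N) pair_coeff j k ^+ 2.
  by apply: eq_bigr => k _; rewrite -(big_ord_widen _ (fun j => pair_coeff j k ^+ 2))// ltnW.
rewrite (pair_big_dep xpredT (fun k j : 'I_K => (j < k)%N))/=.
have c16 : (0 : R) < 16 by [].
apply: (le_trans (sphere_bessel c16 bE
  (fun p : 'I_K * 'I_K => bounded_measurable_pair_product p.2 p.1) _
  (fun p : 'I_K * 'I_K => pair_product_norm p.2 p.1))).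
  move=> [k j] [m l] /= jk lm ne; apply: pair_product_orthogonal => //.
  by apply: contra_neq ne => -[/val_inj -> /val_inj ->].
rewrite ler_piMr//.
apply: le_trans (sphere_integral_cst_le ler01); apply: sphere_integral_le => [| |z _].
- exact: bounded_measurableM.
- exact: bounded_measurable_cst.
- by rewrite indicE; case: (_ \in _); rewrite ?mulr1 ?mulr0.
Qed.

Local Notation A b := (w (scale J b)).
Local Notation f := (lacunary_fun w J Z).

Let a0 k : 0 <= lacunary_coeff w J k.
Proof. exact: lacunary_coeff_ge0. Qed.

Let A0 b : 0 < A b.
Proof. by apply: w_gt0; rewrite (scale_gt0 J0) (scale_le1 J0). Qed.

(** The square modulus of a partial sum, starting at block [b0], is integrated
over [E]. It is at most the square of [M + 1 + 2 * ...], where [1] accounts for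
the truncation and the last sum for the initial terms; its diagonal part is
bounded below blockwise, one of the [J] terms of each block being at least
[1 / 2]; its off-diagonal part is small by [off_diagonal_le]. *)
Lemma energy_bound (M r eta : R) b0 : 0 < r < 1 -> 0 < eta ->
  (forall z, E z -> normc (f (r%:C%C *: z)) <= M) ->
  (forall m, \sum_(k < m) \sum_(j < k) pair_coeff (J * b0 + j)%N (J * b0 + k)%N ^+ 2 <= eta ^+ 2) ->
  exists B0, forall B, (B0 <= B)%N ->
    (\sum_(b < B) A (b0 + b) ^+ 2 * r ^+ (4 * block_scale J (b0 + b) ^ 2)) / 4 *
      sphere_integral (\1_E : V -> R) <=
    (M + 1 + 2 * \sum_(k < J * b0) lacunary_coeff w J k) ^+ 2 *
      sphere_integral (\1_E : V -> R) +
    2 * eta * J%:R * \sum_(b < B) A (b0 + b) ^+ 2 * r ^+ (2 * block_scale J (b0 + b) ^ 2).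
Proof.
move=> r01 eta0 fM tail; have /andP[r0 r1] := r01.
set L := M + 1 + _; set N := (J * b0)%N in tail L *.
have deg0 k : (0 < degree J k)%N by exact: degree_gt0.
have summ := lacunary_summable w_gt0 w_incr J0 Z_size.
have [N1 N1P] := series_fun_uniform Z1 deg0 a0 summ r01 ltr01.
exists N1.+1 => B B1; set m := (J * B)%N.
have NmN1 : (N1 <= N + m)%N by rewrite /m; nia.
pose b k := lacunary_coeff w J (N + k) * r ^+ degree J (N + k).
have b_ge0 k : 0 <= b k by rewrite mulr_ge0// exprn_ge0// ltW.
pose X z k := (b k)%:C%C * W (N + k) z.
pose Off z := \sum_(k < m) \sum_(j < k) b j * b k * pair_product (N + j) (N + k) z.
pose D0 := (\sum_(b < B) A (b0 + b) ^+ 2 * r ^+ (4 * block_scale J (b0 + b) ^ 2)) / 4.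
have GE z : normc (\sum_(k < m) X z k) ^+ 2 =
    \sum_(k < m) b k ^+ 2 * normc (W (N + k) z) ^+ 2 + 2 * Off z.
  rewrite sqr_normc_sum; congr (_ + 2 * _).
    by apply: eq_bigr => k _; rewrite /X normcM normc_real exprMn ger0_norm.
  apply: eq_bigr => k _; apply: eq_bigr => j _; rewrite /X /pair_product.
  by case: (W (N + j) z) => x y; case: (W (N + k) z) => x' y' /=; ring.
have GL z : E z -> normc (\sum_(k < m) X z k) <= L.
  move=> Ez; have z1 := ES Ez; have rz : enorm (r%:C%C *: z) <= r.
    by rewrite enormZ normc_real z1 mulr1 ger0_norm// ltW.
  have h1 := N1P _ _ NmN1 rz; have h2 := fM _ Ez.
  rewrite big_split_ord/= in h1; set P := \sum_(k < N) _ in h1; set Q := \sum_(k < m) _ in h1.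
  have -> : \sum_(k < m) X z k = Q.
    apply: eq_bigr => k _; rewrite /X /b rmorphM/= power_sum_homogeneous rmorphXn/=; ring.
  have leP : normc P <= 2 * \sum_(k < N) lacunary_coeff w J k.
    rewrite (le_trans (ler_normc_sum _ _ _))// mulr_sumr; apply: ler_sum => k _.
    rewrite normcM normc_real ger0_norm// mulrC ler_wpM2r//.
    rewrite (le_trans (lacunary_power_sum_le J0 Z_bound _ _))// ler_piMr// exprn_ile1 ?enorm_ge0//.
    exact: le_trans rz (ltW r1).
  have -> : Q = f (r%:C%C *: z) - (f (r%:C%C *: z) - (P + Q)) - P by ring.
  rewrite (le_trans (ler_normcB _ _))// lerD// (le_trans (ler_normcB _ _))// lerD//.
have GD z : enorm z = 1 -> D0 <= \sum_(k < m) b k ^+ 2 * normc (W (N + k) z) ^+ 2.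
  move=> z1; rewrite /m (sum_blocks (fun k => b k ^+ 2 * normc (W (N + k) z) ^+ 2)) /D0 mulr_suml.
  apply: ler_sum => c _; have [i iJ ipk] := Z_peak (b0 + c) z1.
  have Ni : (N + (J * c + i) = J * (b0 + c) + i)%N by rewrite /N; lia.
  rewrite (bigD1 (Ordinal iJ))//= -[leLHS]addr0 lerD//; last first.
    by apply: sumr_ge0 => j _; rewrite mulr_ge0// sqr_ge0.
  rewrite /b Ni /lacunary_coeff block_index//.
  have := degree_bounds J0 (J * (b0 + c) + i); rewrite block_index// => /andP[_ hi].
  rewrite exprMn -[leLHS]mulrA -[leRHS]mulrA ler_wpM2l ?sqr_ge0//; apply: ler_pM; rewrite ?exprn_ge0 ?(ltW r0)//.
    by rewrite -exprM ler_wiXn2l ?(ltW r0) ?(ltW r1)//; lia.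
  have -> : 4^-1 = 2^-1 ^+ 2 :> R by field.
  by rewrite lerXn2r ?nnegrE ?normc_ge0.
have bphi j k := bounded_measurable_pair_product (N + j) (N + k).
have bOff : bounded_measurable Off.
  by apply: bounded_measurable_sum => k; apply: bounded_measurable_sum => j; exact: bounded_measurableZ.
have main : D0 * sphere_integral (\1_E : V -> R) +
    2 * \sum_(k < m) \sum_(j < k) b j * b k * pair_coeff (N + j) (N + k) <=
    L ^+ 2 * sphere_integral (\1_E : V -> R).
  have -> : \sum_(k < m) \sum_(j < k) b j * b k * pair_coeff (N + j) (N + k) =
      sphere_integral (fun z => \1_E z * Off z).
    have bs k : bounded_measurable (fun z => \sum_(j < k) b j * b k * (\1_E z * pair_product (N + j) (N + k) z)).
      by apply: bounded_measurable_sum => j; exact/bounded_measurableZ/bounded_measurableM.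
    rewrite [RHS](_ : _ = sphere_integral (fun z => \sum_(k < m) \sum_(j < k) b j * b k *
        (\1_E z * pair_product (N + j) (N + k) z))); last first.
      apply: eq_sphere_integral => z _; rewrite mulr_sumr; apply: eq_bigr => k _.
      by rewrite mulr_sumr; apply: eq_bigr => j _; rewrite mulrCA.
    rewrite sphere_integral_sum//; apply: eq_bigr => k _.
    rewrite sphere_integral_sum => [|j]; last exact/bounded_measurableZ/bounded_measurableM.
    by apply: eq_bigr => j _; rewrite sphere_integralZ//; exact: bounded_measurableM.
  have bEO := bounded_measurableM bE bOff.
  rewrite -!sphere_integralZ// -sphere_integralD; try exact: bounded_measurableZ.
  apply: sphere_integral_le.
  - by apply: bounded_measurableD; exact: bounded_measurableZ.
  - exact: bounded_measurableZ.
  - move=> z z1; rewrite indicE; case: (boolP (z \in E)) => [|_]; rewrite ?mulr0 ?mul0r ?mulr0 ?addr0//.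
    rewrite inE => Ez; rewrite !mulr1 mul1r.
    have := GE z; have := GD _ z1; have := GL _ Ez; have := normc_ge0 (\sum_(k < m) X z k).
    nra.
have Sb : \sum_(k < m) b k ^+ 2 <=
    J%:R * \sum_(b < B) A (b0 + b) ^+ 2 * r ^+ (2 * block_scale J (b0 + b) ^ 2).
  rewrite -(sum_divn (fun c => A (b0 + c) ^+ 2 * r ^+ (2 * block_scale J (b0 + c) ^ 2)) B J0).
  apply: ler_sum => k _; have E1 : ((N + k) %/ J = b0 + k %/ J)%N.
    by rewrite /N mulnC divnMDl.
  rewrite /b exprMn /lacunary_coeff E1 ler_wpM2l ?sqr_ge0// -exprM.
  have /andP[lo _] := degree_bounds J0 (N + k); rewrite E1 in lo.
  by rewrite ler_wiXn2l ?(ltW r0) ?(ltW r1)// mulnC leq_mul2r lo orbT.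
have Sb0 : 0 < \sum_(k < m) b k ^+ 2.
  have m0 : (0 < m)%N by rewrite muln_gt0 J0; case: (B) B1.
  rewrite (bigD1 (Ordinal m0))//= ltr_pwDl//.
    by rewrite exprn_gt0// mulr_gt0// ?exprn_gt0//; exact: A0.
  by apply: sumr_ge0 => k _; exact: sqr_ge0.
have := @off_diagonal_le _ b (fun j k => pair_coeff (N + j) (N + k)) _ m eta0 Sb0 (tail m).
have := ler_wpM2l (ltW eta0) Sb.
move: main; rewrite -/D0; set I0 := sphere_integral _; set O := \sum_(k < m) \sum_(j < k) _.
set Q := \sum_(k < m) _; set T := \sum_(b < B) _; lra.
Qed.

Hypothesis w_sum : forall C : R, exists n, C < \sum_(k < n) w ((scale_ratio J)^-1 ^+ k) ^+ 2.

(** If [E] had positive measure [s], the choice [eta = s / (16 J)] would absorb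
the off-diagonal part of [energy_bound] in the diagonal one: the sums of
[w (scale b) ^ 2 * r ^ (2 * block_scale b ^ 2)] would be bounded uniformly in
[r], and so would those of [w (scale b) ^ 2]. *)
Lemma bounded_radial_null (M : R) (r : nat -> R) : (forall n, r n = 1 - n.+2%:R^-1) ->
  (exists n0, forall n z, (n0 <= n)%N -> E z -> normc (f ((r n)%:C%C *: z)) <= M) ->
  sphere_integral (\1_E : V -> R) = 0.
Proof.
move=> rE [n0 fM].
set s := sphere_integral _.
have s_ge0 : 0 <= s by rewrite /s sphere_integral_indic// fine_ge0.
apply/eqP; rewrite eq_le s_ge0 andbT leNgt; apply/negP => s0.
have JR : 0 < J%:R :> R by rewrite ltr0n.
pose eta := s / (16 * J%:R); have eta0 : 0 < eta by rewrite divr_gt0// mulr_gt0.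
have [b0 tail] := pair_tail (exprn_gt0 2 eta0) pair_coeff_summable.
have b0J : (b0 <= J * b0)%N by rewrite leq_pmull.
have {}tail m := tail _ m b0J.
set L := M + 1 + 2 * \sum_(k < J * b0) lacunary_coeff w J k.
pose tau n b := A (b0 + b) ^+ 2 * r n ^+ (2 * block_scale J (b0 + b) ^ 2).
have r01 n : 0 < r n < 1.
  by rewrite rE subr_gt0 invf_lt1 ?ltr0n// ltr1n/= gtrBl invr_gt0 ltr0n.
have tau0 n b : 0 <= tau n b.
  by have /andP[h _] := r01 n; rewrite mulr_ge0 ?sqr_ge0// exprn_ge0// ltW.
have w1 : 0 < w 1 by apply: w_gt0; rewrite ltr01 lexx.
have A_le b : A b <= w 1.
  by apply: w_incr; rewrite ?in_itv/= ?(scale_gt0 J0) ?(scale_le1 J0) ?ltr01 ?lexx.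
have claim1 n B : (n0 <= n)%N -> \sum_(b < B) tau n b <= 8 * L ^+ 2 + 2 * w 1 ^+ 2.
  move=> nn; have /andP[r0 r1] := r01 n.
  have [B0 B0P] := energy_bound (r01 n) eta0 (fun z => fM n z nn) tail.
  have := B0P _ (leq_maxr B B0); set B' := maxn B B0.
  have mono : \sum_(b < B) tau n b <= \sum_(b < B') tau n b.
    have BB' : (B <= B')%N := leq_maxl B B0.
    rewrite -(subnKC BB') big_split_ord/= lerDl.
    by apply: sumr_ge0 => b _; exact: tau0.
  rewrite -/L -/s; set U := \sum_(b < B') _; rewrite -/(\sum_(b < B') tau n b).
  set T := \sum_(b < B') tau n b in mono * => main.
  (* Every term of [T] but the first is at most the preceding term of [U]:
     its exponent is larger by [block_scale_growth]. *)
  have TU : T - w 1 ^+ 2 <= U.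
    have T1 : T <= tau n 0%N + \sum_(b < B') tau n b.+1.
      by rewrite /T -(big_ord_recl B' (fun b : 'I_B'.+1 => tau n b)) big_ord_recr/= lerDl.
    have t0 : tau n 0%N <= w 1 ^+ 2.
      rewrite /tau addn0 -[leRHS]mulr1; apply: ler_pM; rewrite ?sqr_ge0 ?exprn_ge0 ?(ltW r0)//.
        by rewrite lerXn2r ?nnegrE ?A_le ?(ltW (A0 _)) ?(ltW w1)//.
      by rewrite exprn_ile1// ltW.
    have : \sum_(b < B') tau n b.+1 <= U.
      apply: ler_sum => b _; rewrite /tau addnS; apply: ler_pM; rewrite ?sqr_ge0 ?exprn_ge0 ?(ltW r0)//.
        rewrite lerXn2r ?nnegrE ?(ltW (A0 _))//; apply: w_incr.
        - by rewrite in_itv/= (scale_gt0 J0) (scale_le1 J0).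
        - by rewrite in_itv/= (scale_gt0 J0) (scale_le1 J0).
        - have q1 : 1 < scale_ratio J :> R := scale_ratio_gt1 J0.
          have q0 := lt_trans ltr01 q1.
          rewrite /scale [leLHS]exprS ler_piMl ?exprn_ge0 ?invr_ge0 ?(ltW q0)//.
          by rewrite invf_le1// ltW.
      rewrite ler_wiXn2l ?(ltW r0) ?(ltW r1)//.
      exact: block_scale_growth.
    lra.
  have e : 2 * eta * J%:R = s / 8 by rewrite /eta; field; rewrite gt_eqF.
  rewrite e in main; apply: (le_trans mono).
  rewrite -(ler_pM2r s0); have := ler_wpM2r s_ge0 TU; lra.
have claim2 B : \sum_(b < B) A (b0 + b) ^+ 2 <= 2 * (8 * L ^+ 2 + 2 * w 1 ^+ 2).
  (* A radius so close to [1] that all the powers involved are at least [1 / 2]. *)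
  pose p := (2 * block_scale J (b0 + B) ^ 2)%N.
  have := claim1 (n0 + 2 * p)%N B (leq_addr _ _); set n := (n0 + 2 * p)%N.
  have /andP[r0 r1] := r01 n.
  have bern m : 1 - m%:R / n.+2%:R <= r n ^+ m.
    elim: m => [|m ih]; first by rewrite mul0r subr0 expr0.
    rewrite exprSr; apply: (le_trans _ (ler_wpM2r (ltW r0) ih)); rewrite rE.
    have : 0 <= m%:R / n.+2%:R * n.+2%:R^-1 :> R by rewrite !mulr_ge0.
    by move: (n.+2%:R^-1 : R) => v; rewrite -natr1; lra.
  have half : 2^-1 <= r n ^+ p.
    rewrite (le_trans _ (bern p))// lerBrDr -lerBrDl ler_pdivrMr ?ltr0n//.
    have : (2 * p)%:R <= n.+2%:R :> R by rewrite ler_nat /n; lia.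
    by rewrite natrM; lra.
  move=> h; rewrite -ler_pdivrMl//; apply: le_trans h; rewrite mulr_sumr.
  apply: ler_sum => b _; rewrite mulrC ler_wpM2l ?sqr_ge0// (le_trans half)//.
  rewrite ler_wiXn2l ?(ltW r0) ?(ltW r1)// /p leq_mul2l/= leq_exp2r//.
  by rewrite leq_pexp2l ?expn_gt0// ltnS leq_add2l ltnW.
have [n] := w_sum (\sum_(k < b0.+1) w ((scale_ratio J)^-1 ^+ k) ^+ 2 +
  2 * (8 * L ^+ 2 + 2 * w 1 ^+ 2)).
apply/negP; rewrite -leNgt.
apply: (@le_trans _ _ (\sum_(k < b0.+1 + n) w ((scale_ratio J)^-1 ^+ k) ^+ 2)).
  rewrite addnC big_split_ord/= lerDl; apply: sumr_ge0 => k _; exact: sqr_ge0.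
by rewrite big_split_ord/= lerD2l; exact: claim2.
Qed.

End Divergence.

(** * Absence of radial limits *)

Section NoRadialLimit.
Context {R : realType} {d : nat}.
Local Notation V := 'rV[R[i]]_d.
Local Notation sigma := (sphere_measure R d).
Local Notation S := ([set z : V | enorm z = 1] : set (borel_space R d)).
Local Notation radius n := (1 - n.+2%:R^-1 : R).

Let radius01 n : 0 < radius n < 1.
Proof. by rewrite subr_gt0 invf_lt1 ?ltr0n// ltr1n/= gtrBl invr_gt0 ltr0n. Qed.

Lemma radial_limit_bounded (f : V -> R[i]) z : has_radial_limit f z ->
  exists M : nat, forall n, (M <= n)%N -> normc (f ((radius n)%:C%C *: z)) <= M%:R.
Proof.
move=> /cvg_ex[l fl].
have : nbhs l [set y : R[i] | normc (y - l) < 1] by apply/nbhs_normcP; exists 1.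
move=> /fl; rewrite /at_left /within/= => /nbhs_ballP[e /= e0 eP].
have [N Ne] := ltr_add_invr e0; rewrite add0r in Ne.
have [K KP] : exists K : nat, normc l + 1 <= K%:R.
  by exists (Num.truncn (normc l + 1)).+1; apply/ltW/truncnS_gt.
exists (N + K)%N => n Nn; have /andP[r0 r1] := radius01 n.
have : normc (f ((radius n)%:C%C *: z) - l) < 1.
  apply: eP => //; rewrite /ball/= opprB addrC subrK ger0_norm ?invr_ge0//.
  by apply: le_lt_trans Ne; rewrite lef_pV2 ?posrE ?ltr0n// ler_nat; lia.
move=> h.
have := le_normcD (f ((radius n)%:C%C *: z) - l) l; rewrite subrK => h2.
have : K%:R <= (N + K)%:R :> R by rewrite ler_nat leq_addl.
lra.
Qed.

(** A function with a radial limit at a point is bounded on a sequence of radii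
tending to [1], by some integer and from some index on. The points where this
happens for given bounds form a measurable set. *)
Lemma no_radial_limit_ae (f : V -> R[i]) : holomorphic_ball f ->
  (forall (E : set (borel_space R d)) (M : R), measurable E -> E `<=` S ->
    (exists n0, forall n z, (n0 <= n)%N -> E z -> normc (f ((radius n)%:C%C *: z)) <= M) ->
    sigma E = 0%E) ->
  {ae sigma, forall z, unit_sphere z -> ~ has_radial_limit f z}.
Proof.
move=> hf null.
pose E M : set (borel_space R d) := S `\` \bigcup_(n in [set n | (M <= n)%N])
  [set z : V | enorm z = 1 /\ M%:R < normc (f ((radius n)%:C%C *: z))].
have mE M : measurable (E M).
  apply: measurableD; first exact: measurable_sphere.
  apply: bigcup_measurable => n _; apply: measurable_sphere_gt => z z1 e e0.
  have /andP[r0 r1] := radius01 n.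
  have n1 : normc (radius n)%:C%C < 1 by rewrite normc_real ger0_norm// ltW.
  have [r r00 rP] := holomorphic_scaled_continuous hf n1 z1 e0.
  exists r => // z' /rP; apply: le_lt_trans.
  set x := f _; set y := f _; rewrite ler_norml; apply/andP; split.
    by have := le_normcD (y - x) x; rewrite subrK normcBC; lra.
  by have := le_normcD (x - y) y; rewrite subrK; lra.
apply: (@negligibleS _ _ _ _ (\bigcup_M E M)).
  move=> z /= /not_implyP[z1 /contrapT /radial_limit_bounded[M MP]].
  exists M => //; split => // -[n /= Mn [_]]; rewrite ltNge => /negP; apply.
  exact: MP.
apply: negligible_bigcup => M; apply/negligibleP => //.
apply: (null _ M%:R) => //; first by move=> z [].
exists M => n z Mn [z1 nb]; rewrite leNgt; apply/negP => big; apply: nb.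
by exists n.
Qed.

End NoRadialLimit.

Section PartTwo.
Context {R : realType} {d : nat}.
Local Notation V := 'rV[R[i]]_d.
Hypothesis d0 : (0 < d)%N.
Variables (w : R -> R).
Hypothesis w_gt0 : forall t, 0 < t <= 1 -> 0 < w t.
Hypothesis w_incr : {in `]0, 1] &, {homo w : s t / s <= t}}.
Variable eps : R.
Hypothesis eps_gt0 : 0 < eps.
Hypothesis w_decr : {in `]0, 1] &, {homo (fun t => w t / t `^ (1 - eps)) :
  s t / s <= t >-> t <= s}}.

(** The terms of block [b] are the [J] peak polynomials of scale
[block_scale J b], each with its own degree. *)
Theorem bloch_no_radial_limits : lim (weight_integral w x @[x --> 0^'+]) = +oo%E ->
  exists2 f : V -> R[i], bloch_space w f &
    {ae sphere_measure R d, forall z, unit_sphere z -> ~ has_radial_limit f z}.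
Proof.
move=> Ioo; have [J [Z0 ZP]] := exists_peak_polynomials R d0.
have J0 : (0 < J)%N.
  have e1 : enorm (delta_mx 0 (Ordinal d0) : V) = 1.
    rewrite /enorm (bigD1 (Ordinal d0))//= !mxE !eqxx big1 => [|j ne].
      by rewrite addr0 normc1 expr1n sqrtr1.
    by rewrite mxE (negPf ne) andbF normc0 expr0n.
  have [_ _ _ /(_ _ e1)[i _]] := ZP 1%N isT.
  exact: leq_ltn_trans (ltn_ord i).
pose Z k := Z0 (block_scale J (k %/ J)) (Ordinal (ltn_pmod k J0)).
have m0 b := block_scale_gt0 J b.
have Z1 k zeta : zeta \in Z k -> enorm zeta = 1.
  by have [h _ _ _] := ZP _ (m0 (k %/ J)%N); exact: h.
have Z_size k : (size (Z k) <= (8 * d * block_scale J (k %/ J)).+1 ^ (2 * d))%N.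
  by have [_ h _ _] := ZP _ (m0 (k %/ J)%N); exact: h.
have Z_bound k z : enorm z = 1 -> normc (\sum_(zeta <- Z k) cdot z zeta ^+ degree J k) <= 2.
  move=> z1; have [_ _ h _] := ZP _ (m0 (k %/ J)%N); apply: h => //.
  by have /andP[] := degree_bounds J0 k.
have Z_peak b z : enorm z = 1 -> exists2 i, (i < J)%N &
    2^-1 <= normc (\sum_(zeta <- Z (J * b + i)) cdot z zeta ^+ degree J (J * b + i)).
  move=> z1; have [_ _ _ /(_ _ z1)[i h]] := ZP _ (m0 b); exists i => //.
  have E : ((J * b + i) %/ J)%N = b := block_index b (ltn_ord i).
  have -> : Z (J * b + i)%N = Z0 (block_scale J b) i.
    rewrite /Z E; congr (Z0 _ _); apply: val_inj => /=.
    by rewrite mulnC modnMDl modn_small.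
  by apply: h; have := degree_bounds J0 (J * b + i)%N; rewrite E.
have fB := lacunary_bloch w_gt0 w_incr J0 Z1 Z_size Z_bound eps_gt0 w_decr.
exists (lacunary_fun w J Z) => //; apply: no_radial_limit_ae; first exact: fB.1.
move=> E M mE ES EM.
have q1 : 1 < scale_ratio J :> R := scale_ratio_gt1 J0.
have w_sum := weight_sum_unbounded w_gt0 w_incr q1 Ioo.
have := @bounded_radial_null R d w J Z w_gt0 w_incr J0 Z1 Z_size Z_bound Z_peak E mE ES w_sum
  M (fun n => 1 - n.+2%:R^-1) (fun=> erefl) EM.
rewrite sphere_integral_indic// => /eqP; rewrite fine_eq0 ?fin_num_measure// => /eqP.
exact.
Qed.

End PartTwo.

Theorem proposition1p1 (R : realType) (d : nat) (hd : (1 <= d)%N)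
    (w : R -> R)
    (w_gt0 : forall t, 0 < t <= 1 -> 0 < w t)
    (w_incr : {in `]0, 1] &, {homo w : s t / s <= t}}) :
  let I0 : \bar R := lim (weight_integral w x @[x --> 0^'+]) in
  ((I0 < +oo)%E ->
     forall f : 'rV[R[i]]_d -> R[i], bloch_space w f ->
     {ae sphere_measure R d, forall z, unit_sphere z -> has_radial_limit f z})
  /\
  (I0 = +oo%E ->
     (exists2 eps : R, 0 < eps &
        {in `]0, 1] &, {homo (fun t => w t / t `^ (1 - eps)) :
                         s t / s <= t >-> t <= s}}) ->
     exists2 f : 'rV[R[i]]_d -> R[i], bloch_space w f &
     {ae sphere_measure R d,
        forall z, unit_sphere z -> ~ has_radial_limit f z}).
Proof.
move=> I0; split => [Ifin f fB|Ioo [eps eps0 w_decr]].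
  exact: (bloch_radial_limits w_gt0 w_incr Ifin fB).
exact: (bloch_no_radial_limits hd w_gt0 w_incr eps0 w_decr Ioo).
Qed.
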